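(* Let $M$ be a connected compact manifold of finite dimension $m\ge 3$, let $X$ be a $C^1$ vector field on $M$ (inwardly transverse to $\partial M$ if $\partial M\neq\emptyset$) with flow $X_t$, and let $\Gamma\subset M$ be a singular-hyperbolic set for $X$, with singular-hyperbolic splitting $T_\Gamma M=E\oplus F$. Then $\Gamma$ admits a singular-adapted metric, i.e. there exist a Riemannian metric on $T_\Gamma M$ with induced norm $|\cdot|$ and a constant $\lambda>0$ such that for all $x\in\Gamma$ and all $t>0$ $$|DX_t|_{E_x}|\cdot|(DX_t|_{F_x})^{-1}|\le e^{-\lambda t},\qquad |DX_t|_{E_x}|\le e^{-\lambda t},\qquad |\det(DX_t|_{F_x})|\ge e^{\lambda t}.$$
   Context: $\Gamma$ is a compact set invariant under the flow $X_t$, and $T_\Gamma M$ is the restriction of $TM$ to $\Gamma$. Fix any Riemannian metric on $M$ with norm $\|\cdot\|$. Dominated splitting over $\Gamma$: a continuous $DX_t$-invariant splitting $T_\Gamma M=E\oplus F$ with $E_x\ne\{0\}$, $F_x\neq\{0\}$ for every $x\in\Gamma$, for which there are $K,\lambda>0$ with $\|DX_t|_{E_x}\|\cdot\|DX_{-t}|_{F_{X_t(x)}}\|<Ke^{-\lambda t}$ for all $x\in\Gamma$, $t>0$. Partially hyperbolic set: a compact invariant set with a dominated splitting $E\oplus F$ such that $E$ is uniformly contracted: there are $C,\lambda>0$ with $\|DX_t|_{E_x}\|\le Ce^{-\lambda t}$ for all $x\in\Gamma$, $t\ge 0$. $F$ is called the central subbundle. Singular-hyperbolic set: a partially hyperbolic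 set whose central subbundle $F$ is volume expanding: there are $C,\lambda>0$ with $|\det(DX_t|_{F_x})|>Ce^{\lambda t}$ for all $x\in\Gamma$, $t>0$. A Riemannian metric on $T_\Gamma M$ means a continuously varying family of inner products on the spaces $T_xM$, $x\in\Gamma$. Determinants and operator norms in the conclusion are computed with respect to the metric asserted to exist. *)

(* Defs.v *)
From mathcomp Require Import all_boot all_order all_algebra.
From mathcomp Require Import boolp classical_sets functions reals.
From mathcomp Require Import topology normedtype sequences derive exp.
Set Implicit Arguments.
Unset Strict Implicit.
Unset Printing Implicit Defensive.
Import Order.TTheory GRing.Theory Num.Theory.
Import numFieldNormedType.Exports.
Local Open Scope classical_set_scope.
Local Open Scope ring_scope.

Section Calculus.
Context {R : realType}.

(* The sets A below are relatively open in a half-space, or flow domains read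
   in such sets; the library's ['d f u] would need f on a full neighbourhood
   of u. *)
Definition has_diff_within (V W : normedModType R) (A : set V) (f : V -> W)
    (u : V) (L : V -> W) : Prop :=
  forall e : R, 0 < e ->
    \forall v \near within A (nbhs u), `|f v - f u - L (v - u)| <= e * `|v - u|.

(* [Df i] is the i-th partial derivative. *)
Fixpoint Ck (k p : nat) (W : normedModType R) (A : set 'rV[R]_p)
    (f : 'rV[R]_p -> W) : Prop :=
  match k with
  | 0 => {within A, continuous f}
  | k'.+1 => exists Df : 'I_p -> 'rV[R]_p -> W,
      (forall u, A u ->
         has_diff_within A f u (fun h => \sum_(i < p) h 0 i *: Df i u)) /\
      (forall i, Ck k' A (Df i))
  end.

Definition smooth (p : nat) (W : normedModType R) (A : set 'rV[R]_p)
    (f : 'rV[R]_p -> W) : Prop := forall k, Ck k A f.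

(* Linear maps act on row vectors from the right: the differential is
   h |-> h *m jac_within A f u. *)
Definition jac_within (p q : nat) (A : set 'rV[R]_p)
    (f : 'rV[R]_p -> 'rV[R]_q) (u : 'rV[R]_p) : 'M[R]_(p, q) :=
  xget 0 [set L | has_diff_within A f u (fun h => h *m L)].

Definition half_space (m : nat) : set 'rV[R]_m :=
  [set u | forall i : 'I_m, i = 0 :> nat -> 0 <= u 0 i].

End Calculus.

Section Manifold.
Context {R : realType} (m : nat) (M : topologicalType).

(* [cmap] and [cinv] are total functions, meaningful on [cdom] and [cimg]. *)
Record chart := Chart {
  cdom : set M;
  cmap : M -> 'rV[R]_m;
  cinv : 'rV[R]_m -> M;
  cdom_open : open cdom;
  cimg_open : exists2 V : set 'rV[R]_m,
    open V & cmap @` cdom = V `&` half_space (m := m);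
  cmapK : forall x, cdom x -> cinv (cmap x) = x;
  cmap_continuous : {within cdom, continuous cmap};
  cinv_continuous : {within cmap @` cdom, continuous cinv}
}.

Definition cimg (c : chart) : set 'rV[R]_m := cmap c @` cdom c.

(* The set on which f : M -> M, defined on A, reads in the charts c, c'. *)
Definition rep_dom (A : set M) (f : M -> M) (c c' : chart) : set 'rV[R]_m :=
  [set u | [/\ cimg c u, A (cinv c u) & cdom c' (f (cinv c u))]].

Definition rep (f : M -> M) (c c' : chart) (u : 'rV[R]_m) : 'rV[R]_m :=
  cmap c' (f (cinv c u)).

(* A C^oo structure of manifold with (possibly empty) boundary. [chart_at x]
   is a chosen chart around x. The tangent space T_xM is 'rV[R]_m, read as
   coordinates in [chart_at x]; objects on TM are compared at different points
   only after conversion to a common chart by [tchange]. *)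
Record smooth_structure := SmoothStructure {
  atlas : set chart;
  chart_at : M -> chart;
  chart_at_atlas : forall x, atlas (chart_at x);
  chart_at_dom : forall x, cdom (chart_at x) x;
  atlas_compat : forall c c', atlas c -> atlas c' ->
    smooth (rep_dom setT id c c') (rep id c c')
}.

(* Coordinates in c of a tangent vector at x |-> its coordinates in c'. *)
Definition tchange (c c' : chart) (x : M) : 'M[R]_m :=
  jac_within (rep_dom setT id c c') (rep id c c') (cmap c x).

Variable S : smooth_structure.
Local Notation pt := (chart_at S).

Definition boundary : set M :=
  [set x | exists i : 'I_m, i = 0 :> nat /\ cmap (pt x) x 0 i = 0].

(* Tangent map at x of f : A -> M. *)
Definition tmap (A : set M) (f : M -> M) (x : M) : 'M[R]_m :=
  jac_within (rep_dom A f (pt x) (pt (f x))) (rep f (pt x) (pt (f x)))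
    (cmap (pt x) x).

Definition C1_vector_field (X : M -> 'rV[R]_m) : Prop :=
  forall c, atlas S c ->
    Ck 1 (cimg c) (fun u => X (cinv c u) *m tchange (pt (cinv c u)) c (cinv c u)).

Definition inward_transverse (X : M -> 'rV[R]_m) : Prop :=
  forall x, boundary x -> forall i : 'I_m, i = 0 :> nat -> 0 < X x 0 i.

(* Since M is compact and X points inwards at the boundary, the flow is defined
   on M for all t >= 0, and for t < 0 exactly at the points of X_{-t}(M); this
   is all of R * M when the boundary is empty. Outside [flow_dom] the values of
   Phi are meaningless. *)
Definition flow_dom (Phi : R -> M -> M) : set (R * M) :=
  [set p | 0 <= p.1 \/ exists y, Phi (- p.1) y = p.2].

(* Phi is the flow of X: the C^1 (local) one-parameter group generated by X. *)
Record is_flow (X : M -> 'rV[R]_m) (Phi : R -> M -> M) : Prop := IsFlow {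
  flow0 : forall x, Phi 0 x = x;
  flowD : forall s t x, flow_dom Phi (s, x) -> flow_dom Phi (t, Phi s x) ->
    flow_dom Phi (s + t, x) /\ Phi (s + t) x = Phi t (Phi s x);
  flow_velocity : forall t x, flow_dom Phi (t, x) ->
    has_diff_within (V := R^o) [set s | flow_dom Phi (s, x)]
      (fun s => cmap (pt (Phi t x)) (Phi s x)) t
      (fun h => h *: X (Phi t x));
  flow_continuous : {within flow_dom Phi, continuous (fun p => Phi p.1 p.2)};
  (* w : 'rV_(1 + m) stands for the pair (t, u) in R * R^m *)
  flow_C1 : forall c c', atlas S c -> atlas S c' ->
    Ck 1 [set w : 'rV[R]_(1 + m) |
            [/\ cimg c (rsubmx w),
                flow_dom Phi (lsubmx w 0 0, cinv c (rsubmx w)) &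
                cdom c' (Phi (lsubmx w 0 0) (cinv c (rsubmx w)))]]
      (fun w => cmap c' (Phi (lsubmx w 0 0) (cinv c (rsubmx w))))
}.

Definition Dflow (Phi : R -> M -> M) (t : R) (x : M) : 'M[R]_m :=
  tmap [set y | flow_dom Phi (t, y)] (Phi t) x.

Definition flow_invariant (Phi : R -> M -> M) (Gamma : set M) : Prop :=
  forall t x, Gamma x -> flow_dom Phi (t, x) /\ Gamma (Phi t x).

(* A family of inner products is given by its Gram matrices in [chart_at x]. *)
Definition inner_products_on (Gamma : set M) (g : M -> 'M[R]_m) : Prop :=
  forall x, Gamma x -> (g x)^T = g x /\
    forall v : 'rV[R]_m, v != 0 -> 0 < (v *m g x *m v^T) 0 0.

Definition gram_in (g : M -> 'M[R]_m) (c : chart) (x : M) : 'M[R]_m :=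
  tchange c (pt x) x *m g x *m (tchange c (pt x) x)^T.

Definition riemannian_metric (g : M -> 'M[R]_m) : Prop :=
  inner_products_on setT g /\
  forall c, atlas S c -> smooth (cimg c) (fun u => gram_in g c (cinv c u)).

Definition riemannian_metric_on (Gamma : set M) (g : M -> 'M[R]_m) : Prop :=
  inner_products_on Gamma g /\
  forall c, atlas S c -> {within Gamma `&` cdom c, continuous (gram_in g c)}.

Definition tnorm (G : 'M[R]_m) (v : 'rV[R]_m) : R :=
  Num.sqrt ((v *m G *m v^T) 0 0).

(* Norm of the restriction to the (row space of) W of L : T_xM -> T_yM, for
   the inner products G on T_xM and G' on T_yM. *)
Definition opnorm (G G' W L : 'M[R]_m) : R :=
  sup [set tnorm G' (v *m L) | v in
        [set v : 'rV[R]_m | (v <= W)%MS /\ tnorm G v <= 1]].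

(* |det (L|W)| for L injective on W: the factor by which L multiplies the
   volume of the parallelepiped spanned by a basis of W. *)
Definition absdet (G G' W L : 'M[R]_m) : R :=
  let B := row_base W in
  Num.sqrt (\det (B *m L *m G' *m (B *m L)^T)) /
  Num.sqrt (\det (B *m G *m B^T)).

(* Subbundles of T_Gamma M: E x is represented by the row space of a matrix,
   and continuity means the existence of local continuous frames e. *)
Definition continuous_subbundle (Gamma : set M) (E : M -> 'M[R]_m) : Prop :=
  forall x0, Gamma x0 -> exists (k : nat) (U : set M) (e : M -> 'M[R]_(k, m)),
    [/\ open U, U x0, U `<=` cdom (pt x0),
        {within Gamma `&` U, continuous e} &
        forall x, Gamma x -> U x -> row_free (e x) /\
          (e x == E x *m tchange (pt x) (pt x0) x)%MS].

Definition invariant_subbundle (Phi : R -> M -> M) (Gamma : set M)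
    (E : M -> 'M[R]_m) : Prop :=
  forall t x, Gamma x -> (E x *m Dflow Phi t x == E (Phi t x))%MS.

Section Hyperbolicity.
Variables (Phi : R -> M -> M) (g : M -> 'M[R]_m) (Gamma : set M).
Variables (E F : M -> 'M[R]_m).

Definition flow_opnorm (W : M -> 'M[R]_m) (t : R) (x : M) : R :=
  opnorm (g x) (g (Phi t x)) (W x) (Dflow Phi t x).

(* |(DX_t|W_x)^-1|, the norm of a map W_{X_t(x)} -> W_x *)
Definition flow_inv_opnorm (W : M -> 'M[R]_m) (t : R) (x : M) : R :=
  opnorm (g (Phi t x)) (g x) (W (Phi t x)) (invmx (Dflow Phi t x)).

Definition flow_absdet (W : M -> 'M[R]_m) (t : R) (x : M) : R :=
  absdet (g x) (g (Phi t x)) (W x) (Dflow Phi t x).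

Record dominated_splitting : Prop := DominatedSplitting {
  splitting_full : forall x, Gamma x -> row_full (E x + F x)%MS;
  splitting_direct : forall x, Gamma x -> (E x :&: F x)%MS = 0;
  splitting_neq0 : forall x, Gamma x -> E x != 0 /\ F x != 0;
  splitting_continuous :
    continuous_subbundle Gamma E /\ continuous_subbundle Gamma F;
  splitting_invariant :
    invariant_subbundle Phi Gamma E /\ invariant_subbundle Phi Gamma F;
  splitting_dominated : exists K lambda : R, [/\ 0 < K, 0 < lambda &
    forall x t, Gamma x -> 0 < t ->
      flow_opnorm E t x * flow_opnorm F (- t) (Phi t x)
        < K * expR (- lambda * t)]
}.

Record partially_hyperbolic : Prop := PartiallyHyperbolic {
  ph_compact : compact Gamma;
  ph_invariant : flow_invariant Phi Gamma;
  ph_dominated : dominated_splitting;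
  ph_contracted : exists C lambda : R, [/\ 0 < C, 0 < lambda &
    forall x t, Gamma x -> 0 <= t ->
      flow_opnorm E t x <= C * expR (- lambda * t)]
}.

Record singular_hyperbolic : Prop := SingularHyperbolic {
  sh_partially_hyperbolic : partially_hyperbolic;
  sh_expanding : exists C lambda : R, [/\ 0 < C, 0 < lambda &
    forall x t, Gamma x -> 0 < t ->
      flow_absdet F t x > C * expR (lambda * t)]
}.

Record singular_adapted : Prop := SingularAdapted {
  sa_metric : riemannian_metric_on Gamma g;
  sa_rate : exists2 lambda : R, 0 < lambda & forall x t, Gamma x -> 0 < t ->
    [/\ flow_opnorm E t x * flow_inv_opnorm F t x <= expR (- lambda * t),
        flow_opnorm E t x <= expR (- lambda * t) &
        flow_absdet F t x >= expR (lambda * t)]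
}.

End Hyperbolicity.
End Manifold.

(* Main.v *)
Require Import Defs.
From mathcomp Require Import all_boot all_order all_algebra.
From mathcomp Require Import ring lra.
From mathcomp Require Import boolp classical_sets functions reals.
From mathcomp Require Import topology normedtype sequences derive realfun exp.
From mathcomp Require Import measure lebesgue_measure lebesgue_integral ftc.
Set Implicit Arguments.
Unset Strict Implicit.
Unset Printing Implicit Defensive.
Import Order.TTheory GRing.Theory Num.Theory.
Import numFieldNormedType.Exports.
Local Open Scope classical_set_scope.
Local Open Scope ring_scope.

(** Over the compact set Gamma the tangent maps of the flow form a linear cocycle D
    that is defined for all times, and the theorem is one about such cocycles,
    adapted_form. Write a_t, b_t and d_t for the logarithms of the growth of D_t
    on E, of the growth of its inverse on F and of the volume growth of D_t on F,
    all for the given metric g. The first two are subadditive along orbits, the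
    third is additive. For one large time T the constants of the hypotheses are
    absorbed (large_time): there is eps > 0 such that a_T / T, (a_T + b_T) / T and
    - d_T / T are all at most - eps.

    A subadditive function of time is bounded, up to an additive constant, by the
    integral along the orbit of its time-T mean (subadditive_average), and an
    additive one differs from this integral by a coboundary l (cocycle_average).
    So a and b, the time-T means slightly enlarged, are continuous functions on
    Gamma whose orbit integrals dominate the growth on E and the inverse growth
    on F without any constant at one later time L.

    On E this suffices for a metric with the same bound at all times t > 0: take
    the integral over s in [0, L] of the metrics pulled back by D_s and divided
    by the exponential of the orbit integral of a (metricE_growth). Following the
    orbit for time t translates the window of integration by t, and the integrand
    does not increase over time L.

    On F two things are needed at once, a bound for the inverse growth and one for
    the volume growth, and changing the scale of a metric to improve one of them
    would spoil the other. The integrals of the pulled-back metrics over windows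
    [th - L, th], once weighted by the exponential of the orbit integral of b,
    increase with th, hence so does the volume they define, and for each x there
    is exactly one end point theta x for which the square of that volume is
    exp (l x) times the one of g (windowF_surj). With this choice the volume
    growth is exactly the orbit integral of d_T / T, which is at least eps * t. The
    inverse growth remains bounded by the orbit integral of b, because the end
    point, as seen from x, does not move backwards when x moves along its orbit:
    theta x <= theta (phi t x) + t (theta_homo). Indeed, moving it backwards would
    lose volume, whereas volume shrinks at most as if every length shrank at the
    rate that b allows. Declaring E and F orthogonal gives the metric; the product
    of the two norms is controlled by the orbit integral of a + b.

    Norms enter the definition of a and b as Hilbert-Schmidt norms (hsnorm), which
    are visibly continuous and still submultiplicative.

    The passage to cocycles happens in charts. The only delicate point is the
    negative times: on a manifold with boundary the maps Phi t, t < 0, are defined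
    on images of the flow, which could be too thin for differentials to be unique.
    At points of Gamma they are unique because they invert differentials at
    positive times (flow_tangent_inv), and the cocycle identity for all times
    follows from the one for nonnegative times (Dflow_add). *)

(** * Positive definite forms and their determinants *)

Section Forms.
Context {R : rcfType}.

Definition qform n (P : 'M[R]_n) (v : 'rV[R]_n) : R := (v *m P *m v^T) 0 0.

Definition posdef n (P : 'M[R]_n) : Prop :=
  P^T = P /\ forall v, v != 0 -> 0 < qform P v.

Lemma qform0 n (P : 'M[R]_n) : qform P 0 = 0.
Proof. by rewrite /qform !mul0mx mxE. Qed.

Lemma qform_ge0 n (P : 'M[R]_n) v : posdef P -> 0 <= qform P v.
Proof.
by move=> [_ Pgt0]; have [->|/Pgt0/ltW//] := eqVneq v 0; rewrite qform0.
Qed.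

Lemma qform_congr n p (A : 'M[R]_(p, n)) (P : 'M[R]_n) (v : 'rV[R]_p) :
  qform (A *m P *m A^T) v = qform P (v *m A).
Proof. by rewrite /qform trmx_mul !mulmxA. Qed.

Lemma sym_congr n p (A : 'M[R]_(p, n)) (P : 'M[R]_n) :
  P^T = P -> (A *m P *m A^T)^T = A *m P *m A^T.
Proof. by move=> sP; rewrite !trmx_mul trmxK sP mulmxA. Qed.

Lemma posdef_congr n p (A : 'M[R]_(p, n)) (P : 'M[R]_n) :
  row_free A -> posdef P -> posdef (A *m P *m A^T).
Proof.
move=> fA [sP P0]; split; first exact: sym_congr.
move=> v v0; rewrite qform_congr; apply: P0; apply: contraNneq v0 => vA0.
by apply/eqP/(row_free_inj fA); rewrite vA0 mul0mx.
Qed.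

Lemma qform1 n (v : 'rV[R]_n) : qform 1%:M v = \sum_i v 0 i ^+ 2.
Proof.
by rewrite /qform mulmx1 mxE; apply: eq_bigr => i _; rewrite mxE expr2.
Qed.

Lemma qformZ n (c : R) (P : 'M[R]_n) v : qform (c *: P) v = c * qform P v.
Proof. by rewrite /qform -scalemxAr -scalemxAl mxE. Qed.

Lemma qformD n (P Q : 'M[R]_n) v : qform (P + Q) v = qform P v + qform Q v.
Proof. by rewrite /qform mulmxDr mulmxDl mxE. Qed.

Lemma posdefZ n (c : R) (P : 'M[R]_n) : 0 < c -> posdef P -> posdef (c *: P).
Proof.
move=> c0 [sP P0]; split; first by rewrite linearZ /= sP.
by move=> v v0; rewrite qformZ mulr_gt0 // P0.
Qed.

Definition schur n (P : 'M[R]_(1 + n)) : 'M[R]_n :=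
  drsubmx P - (P 0 0)^-1 *: (dlsubmx P *m ursubmx P).

Definition schur_elim n (P : 'M[R]_(1 + n)) : 'M[R]_(1 + n) :=
  block_mx 1%:M 0 (- (P 0 0)^-1 *: dlsubmx P) 1%:M.

Lemma schur_elimP n (P : 'M[R]_(1 + n)) : P^T = P -> P 0 0 != 0 ->
  schur_elim P *m P *m (schur_elim P)^T = block_mx (P 0 0)%:M 0 0 (schur P).
Proof.
move=> sP a0; rewrite -{2}(submxK P).
have ul : ulsubmx P = (P 0 0)%:M.
  by rewrite [LHS]mx11_scalar !mxE; congr ((P _ _)%:M); apply/val_inj.
have dl : (dlsubmx P)^T = ursubmx P by rewrite trmx_dlsub sP.
rewrite /schur_elim /schur tr_block_mx !trmx1 trmx0 linearZ /= dl ul.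
rewrite !mulmx_block !mulmx1 !mul1mx !mul0mx !mulmx0 !addr0.
rewrite -!scalemxAl -!scalemxAr !mul_scalar_mx mul_mx_scalar !scalerA.
rewrite mulNr mulVf// !scaleN1r !addNr mul0mx scaler0 add0r.
by rewrite scaleNr addrC.
Qed.

Lemma det_schur_elim n (P : 'M[R]_(1 + n)) : \det (schur_elim P) = 1.
Proof. by rewrite det_lblock !det1 mulr1. Qed.

Lemma det_schur n (P : 'M[R]_(1 + n)) : P^T = P -> P 0 0 != 0 ->
  \det P = P 0 0 * \det (schur P).
Proof.
move=> sP a0; have /(congr1 determinant) := schur_elimP sP a0.
rewrite !det_mulmx det_tr det_schur_elim mulr1 mul1r => ->.
by rewrite det_ublock det_scalar expr1.
Qed.

Lemma schur_sym n (P : 'M[R]_(1 + n)) : P^T = P -> (schur P)^T = schur P.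
Proof.
move=> sP; rewrite /schur linearB linearZ /= trmx_mul trmx_drsub trmx_ursub.
by rewrite trmx_dlsub sP.
Qed.

Lemma qform_schur n (P : 'M[R]_(1 + n)) w : P^T = P -> P 0 0 != 0 ->
  qform (schur P) w = qform P (row_mx 0 w *m schur_elim P).
Proof.
move=> sP a0; rewrite -qform_congr schur_elimP// /qform.
rewrite mul_row_block !mul0mx !mulmx0 !add0r tr_row_mx mul_row_col.
by rewrite mul0mx add0r.
Qed.

Lemma row_schur_elim n (P : 'M[R]_(1 + n)) (w : 'rV_n) :
  row_mx 0 w *m schur_elim P =
  row_mx (w *m (- (P 0 0)^-1 *: dlsubmx P)) w.
Proof.
by rewrite mul_row_block !mul0mx !mulmx1 !add0r.
Qed.

Lemma qform_delta n (P : 'M[R]_n) i : qform P (delta_mx 0 i) = P i i.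
Proof. by rewrite /qform -rowE trmx_delta -colE !mxE. Qed.

Lemma posdef_diag_gt0 n (P : 'M[R]_n) i : posdef P -> 0 < P i i.
Proof.
case=> _ P0; rewrite -qform_delta P0//; apply/eqP => /matrixP/(_ 0 i).
by rewrite !mxE !eqxx => /eqP; rewrite oner_eq0.
Qed.

Lemma posdef_schur n (P : 'M[R]_(1 + n)) : posdef P -> posdef (schur P).
Proof.
move=> pP; have [sP P0] := pP; have a0 := posdef_diag_gt0 0 pP.
split; first exact: schur_sym.
move=> v v0; rewrite qform_schur ?gt_eqF// P0// row_schur_elim.
by apply: contraNneq v0; rewrite -[X in _ = X]row_mx0 => /eq_row_mx[_ ->].
Qed.

(** Gaussian elimination, one Schur complement at a time. This normal form
    replaces the spectral theorem: comparing P with a second form reduces to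
    comparing the identity with it. *)
Lemma posdef_diagonalize n (P : 'M[R]_n) : posdef P ->
  exists2 C, C \in unitmx & C *m P *m C^T = 1%:M.
Proof.
elim: n P => [|n IH] P pP.
  by exists 1%:M; [exact: unitmx1|apply/matrixP => -[]].
have [sP _] := pP; have a0 := posdef_diag_gt0 0 pP.
have [C uC HC] := IH _ (posdef_schur (P := P) pP).
pose s := (Num.sqrt (P 0 0))^-1.
have s0 : s != 0 by rewrite invr_eq0 gt_eqF// sqrtr_gt0.
pose B : 'M[R]_(1 + n) := block_mx s%:M 0 0 C.
have uB : B \in unitmx.
  rewrite unitmxE det_ublock det_scalar expr1 unitrM unitfE s0.
  by rewrite -unitmxE uC.
exists (B *m schur_elim P).
  by rewrite unitmx_mul uB unitmxE det_schur_elim unitr1.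
transitivity (B *m (schur_elim P *m P *m (schur_elim P)^T) *m B^T).
  by rewrite trmx_mul !mulmxA.
rewrite schur_elimP ?gt_eqF// /B tr_block_mx !trmx0 tr_scalar_mx !mulmx_block.
rewrite !(mulmx0, mul0mx, addr0, add0r) HC -!scalar_mxM mulrAC.
have -> : s * s * P 0 0 = 1.
  by rewrite -expr2 exprVn sqr_sqrtr ?ltW// mulVf// gt_eqF.
by rewrite -scalar_mx_block.
Qed.

Lemma posdef_det_gt0 n (P : 'M[R]_n) : posdef P -> 0 < \det P.
Proof.
move=> /posdef_diagonalize[C uC /(congr1 determinant)].
rewrite !det_mulmx det_tr det1 mulrAC -expr2 => e.
have : 0 < \det C ^+ 2 * \det P by rewrite e ltr01.
by rewrite pmulr_rgt0// exprn_even_gt0//= -unitfE -unitmxE.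
Qed.

Lemma posdef_unit n (P : 'M[R]_n) : posdef P -> P \in unitmx.
Proof. by move=> /posdef_det_gt0 ?; rewrite unitmxE unitfE gt_eqF. Qed.

(** By induction on the size: in the factorization of the determinant both the
    upper left entry and the determinant of the Schur complement are at least
    1, the latter because the complement takes the values of P at vectors
    whose last coordinates are the given ones. *)
Lemma det_ge1 n (P : 'M[R]_n) : P^T = P ->
  (forall v, qform 1%:M v <= qform P v) -> 1 <= \det P.
Proof.
elim: n P => [|n IH]; first by move=> P _ _; rewrite det_mx00.
change (forall P : 'M[R]_(1 + n), P^T = P ->
  (forall v, qform 1%:M v <= qform P v) -> 1 <= \det P) => P sP P1.
have a1 : 1 <= P 0 0.
  by have := P1 (delta_mx 0 0); rewrite !qform_delta mxE eqxx.
have a0 : 0 < P 0 0 by exact: lt_le_trans a1.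
rewrite det_schur ?gt_eqF//.
have S1 : 1 <= \det (schur P).
  apply: IH => [|v]; first exact: schur_sym.
  rewrite qform_schur ?gt_eqF//; apply: le_trans (P1 _).
  rewrite row_schur_elim !qform1 big_split_ord /= -[leLHS]add0r lerD//.
    by rewrite sumr_ge0// => *; exact: sqr_ge0.
  by apply: ler_sum => i _; rewrite row_mxEr.
by rewrite -[1]mulr1 ler_pM.
Qed.

Lemma le_det n (P Q : 'M[R]_n) : posdef Q -> P^T = P ->
  (forall v, qform Q v <= qform P v) -> \det Q <= \det P.
Proof.
move=> /posdef_diagonalize[C uC HC] sP QP.
have c0 : 0 < \det C ^+ 2 by rewrite exprn_even_gt0//= -unitfE -unitmxE.
have dC (X : 'M_n) : \det (C *m X *m C^T) = \det C ^+ 2 * \det X.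
  by rewrite !det_mulmx det_tr mulrAC -expr2.
rewrite -(ler_pM2l c0) -!dC HC det1; apply: det_ge1; first exact: sym_congr.
by move=> v; rewrite -HC !qform_congr.
Qed.

End Forms.

(** * Hilbert-Schmidt norms and Gram determinants *)

Section HilbertSchmidt.
Context {R : rcfType}.

Lemma qformE n (P : 'M[R]_n) v :
  qform P v = \sum_i \sum_j v 0 i * v 0 j * P i j.
Proof.
rewrite /qform mxE exchange_big; apply: eq_bigr => j _ /=.
rewrite !mxE mulr_suml; apply: eq_bigr => i _.
by rewrite mulrAC.
Qed.

Lemma qform_delta2 n (P : 'M[R]_n) i j (a b : R) : P^T = P ->
  qform P (a *: delta_mx 0 i - b *: delta_mx 0 j) =
  a ^+ 2 * P i i + b ^+ 2 * P j j - 2 * (a * b * P i j).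
Proof.
move=> sP; have entry k l :
      ((delta_mx 0 k : 'rV_n) *m P *m (delta_mx 0 l : 'rV_n)^T) 0 0 = P k l.
  by rewrite -rowE trmx_delta -colE !mxE.
have sPij : P j i = P i j by rewrite -[in LHS]sP mxE.
rewrite /qform !mulmxBl [(_ - _)^T]linearB /= !mulmxBr ![(_ *: _)^T]linearZ /=.
rewrite -!scalemxAl -!scalemxAr.
have addE (A B : 'M[R]_1) : (A - B) 0 0 = A 0 0 - B 0 0 by rewrite !mxE.
have scaleE c (A : 'M[R]_1) : (c *: A) 0 0 = c * A 0 0 by rewrite mxE.
by rewrite !(addE, scaleE, entry) sPij; ring.
Qed.

(** For each pair of indices the form is nonnegative on
    v_j e_i - v_i e_j; the bound is the sum of these inequalities. *)
Lemma qform_le_trace n (P : 'M[R]_n) v : P^T = P ->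
  (forall w, 0 <= qform P w) -> qform P v <= \tr P * qform 1%:M v.
Proof.
move=> sP P0.
have : 0 <= \sum_i \sum_j
    qform P (v 0 j *: delta_mx 0 i - v 0 i *: delta_mx 0 j).
  by apply: sumr_ge0 => i _; apply: sumr_ge0 => j _.
under eq_bigr => i _ do under eq_bigr => j _ do rewrite qform_delta2//.
under eq_bigr => i _ do rewrite sumrB big_split/=.
rewrite sumrB big_split/=.
have -> : \sum_i \sum_j v 0 j ^+ 2 * P i i = \tr P * qform 1%:M v.
  rewrite qform1 mulr_suml; apply: eq_bigr => i _.
  by rewrite mulr_sumr; apply: eq_bigr => j _; rewrite mulrC.
have -> : \sum_i \sum_j v 0 i ^+ 2 * P j j = \tr P * qform 1%:M v.
  rewrite qform1 mulr_sumr; apply: eq_bigr => i _.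
  by rewrite -mulr_sumr mulrC.
have -> : \sum_i \sum_j 2 * (v 0 j * v 0 i * P i j) = 2 * qform P v.
  rewrite qformE mulr_sumr; apply: eq_bigr => i _.
  by rewrite mulr_sumr; apply: eq_bigr => j _; rewrite (mulrC (v 0 j)).
by lra.
Qed.

(** The square of the Hilbert-Schmidt norm of A between spaces with inner
    products g and h. It replaces the operator norm because it is a polynomial
    expression in the entries, hence continuous, while still being
    submultiplicative. *)
Definition hsnorm n (g h A : 'M[R]_n) : R :=
  \tr (invmx g *m (A *m h *m A^T)).

Lemma trace_invmx n (g C P : 'M[R]_n) : C \in unitmx -> C *m g *m C^T = 1%:M ->
  \tr (invmx g *m P) = \tr (C *m P *m C^T).
Proof.
move=> uC HC.
have -> : invmx g = C^T *m C.
  have e : g *m (C^T *m C) = 1%:M.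
    by apply: mulmx1C; rewrite -mulmxA; exact: mulmx1C.
  have ug : g \in unitmx by case: (mulmx1_unit e).
  by rewrite -[LHS]mulmx1 -e mulKmx.
by rewrite mxtrace_mulC mulmxA mxtrace_mulC mulmxA.
Qed.

(** In a basis that is orthonormal for g both sides are sums of diagonal
    entries. *)
Lemma ler_trace_invmx n (g P Q : 'M[R]_n) : posdef g ->
  (forall v, qform P v <= qform Q v) ->
  \tr (invmx g *m P) <= \tr (invmx g *m Q).
Proof.
move=> /posdef_diagonalize[C uC HC] PQ; rewrite !(trace_invmx _ uC HC).
by apply: ler_sum => i _; rewrite -!qform_delta !qform_congr.
Qed.

Lemma hsnorm_ge0 n (g h A : 'M[R]_n) : posdef g -> posdef h ->
  0 <= hsnorm g h A.
Proof.
move=> pg ph; rewrite -[X in X <= _](_ : \tr (invmx g *m 0) = 0).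
  by rewrite ler_trace_invmx// => v; rewrite qform_congr {1}/qform mulmx0 mul0mx
    mxE qform_ge0.
by rewrite mulmx0 linear0.
Qed.

Lemma qform_hsnorm n (g h A : 'M[R]_n) v : posdef g -> posdef h ->
  qform h (v *m A) <= hsnorm g h A * qform g v.
Proof.
move=> pg ph; have [C uC HC] := posdef_diagonalize pg.
pose w := v *m invmx C; have -> : v = w *m C by rewrite mulmxKV.
rewrite -(qform_congr C g) HC /hsnorm (trace_invmx _ uC HC).
rewrite -(qform_congr A h) -qform_congr; apply: qform_le_trace.
  by do 2 apply: sym_congr; case: ph.
by move=> u; rewrite !qform_congr qform_ge0.
Qed.

Lemma hsnorm_le n (g h A : 'M[R]_n) c : posdef g ->
  (forall v, qform h (v *m A) <= c * qform g v) -> hsnorm g h A <= c * n%:R.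
Proof.
move=> pg H; rewrite /hsnorm (_ : c * n%:R = \tr (invmx g *m (c *: g))).
  by apply: ler_trace_invmx => // v; rewrite qform_congr qformZ.
by rewrite -scalemxAr linearZ /= mulVmx ?posdef_unit// mxtrace1.
Qed.

Lemma hsnormM n (g h k A B : 'M[R]_n) : posdef g -> posdef h -> posdef k ->
  hsnorm g k (A *m B) <= hsnorm g h A * hsnorm h k B.
Proof.
move=> pg ph pk; rewrite mulrC {2}/hsnorm.
have -> : hsnorm h k B * \tr (invmx g *m (A *m h *m A^T)) =
    \tr (invmx g *m (hsnorm h k B *: (A *m h *m A^T))).
  by rewrite -scalemxAr linearZ.
apply: ler_trace_invmx => // v; rewrite qformZ !qform_congr mulmxA.
exact: qform_hsnorm.
Qed.

Lemma hsnorm_gt0 n (g h A : 'M[R]_n) (v : 'rV[R]_n) : posdef g -> posdef h ->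
  v *m A != 0 -> 0 < hsnorm g h A.
Proof.
move=> pg ph vA; rewrite lt_neqAle hsnorm_ge0// andbT.
apply: contraNneq vA => H; have := qform_hsnorm A v pg ph.
rewrite -H mul0r; case: ph => _ /(_ (v *m A)).
by case: eqVneq => // _ /(_ isT)/lt_geF->.
Qed.

(** Changes of coordinates at both ends are invisible to the norm, so its
    continuity can be checked in local coordinates. *)
Lemma hsnorm_conj n (g h A S T : 'M[R]_n) : g \in unitmx -> S \in unitmx ->
    T \in unitmx ->
  hsnorm (S *m g *m S^T) (T *m h *m T^T) (S *m A *m invmx T) = hsnorm g h A.
Proof.
move=> ug uS uT; rewrite /hsnorm.
have -> : invmx (S *m g *m S^T) = (invmx S)^T *m invmx g *m invmx S.
  have e : (S *m g *m S^T) *m ((invmx S)^T *m invmx g *m invmx S) = 1%:M.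
    rewrite !mulmxA -(mulmxA _ S^T) -trmx_mul mulVmx// trmx1 mulmx1.
    by rewrite -(mulmxA S) mulmxV// mulmx1 mulmxV.
  have uu : S *m g *m S^T \in unitmx by case: (mulmx1_unit e).
  by rewrite -[LHS]mulmx1 -e mulKmx.
rewrite !trmx_mul !mulmxA.
rewrite -(mulmxA _ (invmx T) T) mulVmx// mulmx1.
rewrite -(mulmxA _ T^T) -trmx_mul mulVmx// trmx1 mulmx1.
rewrite mxtrace_mulC !mulmxA -trmx_mul mulVmx// trmx1 mul1mx.
by rewrite -(mulmxA _ (invmx S) S) mulVmx// mulmx1.
Qed.

End HilbertSchmidt.

Section Subspaces.
Context {R : rcfType}.

(** The square of the volume of the parallelepiped spanned by the rows of B. *)
Definition gramdet k n (P : 'M[R]_n) (B : 'M[R]_(k, n)) : R :=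
  \det (B *m P *m B^T).

Lemma gramdet_gt0 k n (P : 'M[R]_n) (B : 'M[R]_(k, n)) :
  posdef P -> row_free B -> 0 < gramdet P B.
Proof. by move=> pP fB; exact/posdef_det_gt0/posdef_congr. Qed.

Lemma gramdetZ k n (P : 'M[R]_n) (B : 'M[R]_(k, n)) c :
  gramdet (c *: P) B = c ^+ k * gramdet P B.
Proof. by rewrite /gramdet -scalemxAr -scalemxAl detZ. Qed.

Lemma le_gramdet k n (P Q : 'M[R]_n) (B : 'M[R]_(k, n)) : posdef Q ->
  P^T = P -> row_free B ->
  (forall v, (v <= B)%MS -> qform Q v <= qform P v) ->
  gramdet Q B <= gramdet P B.
Proof.
move=> pQ sP fB QP; apply: le_det; first exact: posdef_congr.
  exact: sym_congr.
by move=> v; rewrite !qform_congr QP// submxMl.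
Qed.

Lemma eq_gramdet k n (P Q : 'M[R]_n) (B : 'M[R]_(k, n)) : posdef P ->
  posdef Q -> row_free B ->
  (forall v, (v <= B)%MS -> qform Q v = qform P v) ->
  gramdet Q B = gramdet P B.
Proof.
move=> pP pQ fB QP; apply: le_anti; have [sP _] := pP; have [sQ _] := pQ.
by rewrite !le_gramdet// => v /QP->.
Qed.

(** A change of basis multiplies all Gram determinants by the square of its
    determinant, so their quotients depend on the subspace only. *)
Lemma gramdet_basis k l n (P Q : 'M[R]_n) (A : 'M[R]_(k, n))
    (B : 'M[R]_(l, n)) : row_free A -> row_free B -> (A == B)%MS ->
  gramdet P A * gramdet Q B = gramdet Q A * gramdet P B.
Proof.
move=> fA fB /eqmxP AB.
have kl : k = l by rewrite -(eqP fA) -(eqP fB) AB.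
subst l; have /submxP[C ->] : (A <= B)%MS by rewrite AB.
have H X : gramdet X (C *m B) = \det C ^+ 2 * gramdet X B.
  rewrite /gramdet.
  have -> : C *m B *m X *m (C *m B)^T = C *m (B *m X *m B^T) *m C^T.
    by rewrite trmx_mul !mulmxA.
  by rewrite det_mulmx det_mulmx det_tr; ring.
by rewrite !H; ring.
Qed.

End Subspaces.

(** * Integrals of continuous functions *)

Section Integral.
Context {R : realType}.
Implicit Types (f g F G : R -> R) (a b c s t x : R).

Definition primitive f F := forall x, is_derive x 1 F (f x).

Lemma primitive_unique f F G a b : primitive f F -> primitive f G ->
  F b - F a = G b - G a.
Proof.
move=> pF pG; have : forall x, is_derive x 1 (F - G) 0.
  by move=> x; rewrite -(subrr (f x)); exact: is_deriveB.
move=> /(@is_derive_0_is_cst R _ a b); rewrite !fctE => H.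
by have -> : F b = F a - G a + G b; [rewrite H; ring|ring].
Qed.

Lemma primitive_right f a : continuous f ->
  exists F, forall x, a < x -> is_derive x 1 F (f x).
Proof.
move=> cf; exists (fun x => \int[lebesgue_measure]_(t in `[a, x]) f t)%R.
move=> x ax.
have [|||] := @continuous_FTC1_closed R f a x (x + 1) _ _ ax; first lra.
- apply: continuous_compact_integrable; first exact: segment_compact.
  exact: continuous_subspaceT.
- exact: cf.
by move=> d; rewrite derive1E => e; exact: DeriveDef d e.
Qed.

Lemma is_derive_near f g x d : (\forall y \near x, f y = g y) ->
  is_derive x 1 f d -> is_derive x 1 g d.
Proof.
move=> fg [df dd]; apply: DeriveDef; first exact: near_eq_derivable df.
by rewrite -dd; apply/esym/near_eq_derive.
Qed.

Lemma is_derive0_right F c x y : (forall z, c < z -> is_derive z 1 F 0) ->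
  c < x -> c < y -> F x = F y.
Proof.
move=> dF; wlog xy : x y / x <= y.
  by move=> H cx cy; case: (leP x y) => [/H->|/ltW/H->].
move=> cx cy; apply/esym/eqP; rewrite -subr_eq0.
have [z|| z _ ->] := @MVT_segment R F (cst 0) x y xy; last by rewrite mul0r.
  by rewrite in_itv/= => /andP[xz _]; apply: dF; exact: lt_trans xz.
apply: derivable_within_continuous => z; rewrite in_itv/= => /andP[xz _].
by have [] : is_derive z 1 F 0 by apply: dF; exact: lt_le_trans xz.
Qed.

(** The primitives started at the various points c agree, after subtraction of
    their value at 0, wherever two of them are defined. *)
Lemma primitive_exists f : continuous f -> exists F, primitive f F.
Proof.
move=> cf; pose G c := sval (cid (primitive_right c cf)).
have dG c x : c < x -> is_derive x 1 (G c) (f x).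
  by rewrite /G; case: cid => F /= + ?; apply.
have indep c c' x : c < Num.min x 0 -> c' < Num.min x 0 ->
    G c x - G c 0 = G c' x - G c' 0.
  rewrite !lt_min => /andP[cx c0] /andP[c'x c'0].
  pose m := Num.max c c'.
  have : forall z, m < z -> is_derive z 1 (G c - G c') 0.
    move=> z; rewrite gt_max => /andP[cz c'z]; rewrite -(subrr (f z)).
    by apply: is_deriveB; exact: dG.
  move=> /(@is_derive0_right _ m x 0); rewrite !fctE !gt_max.
  rewrite cx c'x c0 c'0 => /(_ isT isT) H.
  have -> : G c x = G c 0 - G c' 0 + G c' x by rewrite -H; ring.
  by ring.
exists (fun x => G (Num.min x 0 - 1) x - G (Num.min x 0 - 1) 0) => x.
pose c := Num.min x 0 - 2.
have kx : Num.min x 0 <= x by rewrite ge_min lexx.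
have k0 : Num.min x 0 <= 0 by rewrite ge_min lexx orbT.
apply: (@is_derive_near (fun y => G c y - G c 0)).
  near=> y; apply: indep; last by rewrite ltrBlDr ltrDl.
  have : x - 1 < y by near: y; apply: (cvgr_gt x); [exact: cvg_id|lra].
  by rewrite /c lt_min => ?; apply/andP; split; lra.
rewrite -[f x]subr0; apply: is_deriveB; apply: dG.
by rewrite /c; lra.
Unshelve. all: by end_near. Qed.

(** A difference of values of a primitive, so that Chasles' relation and the
    translation of the bounds hold for all a and b, whatever their order. *)
Definition int f a b :=
  let F := xget (fun=> 0) [set F | primitive f F] in F b - F a.

Lemma intE f F a b : primitive f F -> int f a b = F b - F a.
Proof.
move=> pF; apply: (@primitive_unique f _ F a b _ pF).
by apply: (@xgetPex _ (fun=> 0) (primitive f)); exists F.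
Qed.

Lemma intxx f a : int f a a = 0. Proof. exact: subrr. Qed.

Lemma int_chasles f b a c : int f a b + int f b c = int f a c.
Proof. by rewrite /int; ring. Qed.

Lemma intD f g a b : continuous f -> continuous g ->
  int (fun s => f s + g s) a b = int f a b + int g a b.
Proof.
move=> /primitive_exists[F pF] /primitive_exists[G pG].
rewrite (intE _ _ pF) (intE _ _ pG) (@intE _ (F + G)) ?fctE; first by ring.
by move=> x; exact: is_deriveD.
Qed.

Lemma intZ c f a b : continuous f ->
  int (fun s => c * f s) a b = c * int f a b.
Proof.
move=> /primitive_exists[F pF]; rewrite (intE _ _ pF) (@intE _ (c \*: F)).
  by rewrite mulrBr.
by move=> x; exact: is_deriveZ.
Qed.

Lemma int_cst c a b : int (cst c) a b = c * (b - a).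
Proof.
rewrite (@intE _ (c \*: (@id R))) ?mulrBr// => x.
by rewrite /cst -[X in is_derive _ _ _ X]mulr1; exact: is_deriveZ.
Qed.

Lemma int_shift f t a b : continuous f ->
  int (fun s => f (s + t)) a b = int f (a + t) (b + t).
Proof.
move=> /primitive_exists[F pF]; rewrite (intE _ _ pF).
rewrite (@intE _ (fun s => F (s + t)))// => x.
have := @is_derive1_comp R F (fun s => s + t) x (f (x + t)) 1 (pF _).
rewrite mulr1; apply.
by rewrite -[X in is_derive _ _ _ X]addr0; exact: is_deriveD.
Qed.

Lemma int_ge0 f a b : continuous f -> a <= b ->
  (forall s, a <= s <= b -> 0 <= f s) -> 0 <= int f a b.
Proof.
move=> /primitive_exists[F pF] ab f0; rewrite (intE _ _ pF).
have [||z zab ->] := @MVT_segment R F f a b ab.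
- by move=> ? _; exact: pF.
- by apply: derivable_within_continuous => z _; case: (pF z).
- by rewrite mulr_ge0 ?subr_ge0// f0//; move: zab; rewrite in_itv.
Qed.

Lemma le_int f g a b : continuous f -> continuous g -> a <= b ->
  (forall s, a <= s <= b -> f s <= g s) -> int f a b <= int g a b.
Proof.
move=> cf cg ab fg; rewrite -subr_ge0.
have cNf : continuous (fun s => -1 * f s).
  by move=> x; apply: cvgM; [exact: cvg_cst|exact: cf].
have -> : int g a b - int f a b = int (fun s => g s + -1 * f s) a b.
  by rewrite intD// intZ// mulN1r.
apply: int_ge0 => // [x|s sab]; first by apply: cvgD; [exact: cg|exact: cNf].
by rewrite mulN1r subr_ge0 fg.
Qed.

Lemma int_gt0 f a b : continuous f -> a < b -> (forall s, 0 < f s) ->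
  0 < int f a b.
Proof.
move=> /primitive_exists[F pF] ab f0; rewrite (intE _ _ pF).
have [||z zab ->] := @MVT R F f a b ab.
- by move=> ? _; exact: pF.
- by apply: derivable_within_continuous => z _; case: (pF z).
- by rewrite mulr_gt0 ?subr_gt0.
Qed.

Lemma int_sum n (f : 'I_n -> R -> R) a b : (forall i, continuous (f i)) ->
  int (fun s => \sum_i f i s) a b = \sum_i int (f i) a b.
Proof.
move=> cf; have /choice[F pF] : forall i, exists F, primitive (f i) F.
  by move=> i; exact: primitive_exists.
rewrite (@intE _ (\sum_i F i)).
  rewrite !fct_sumE -sumrB; apply: eq_bigr => i _.
  by rewrite (intE _ _ (pF i)).
by move=> x; apply: is_derive_sum => i; exact: pF.
Qed.

Lemma norm_int_le f a b K : continuous f -> a <= b ->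
  (forall s, a <= s <= b -> `|f s| <= K) -> `|int f a b| <= K * (b - a).
Proof.
move=> cf ab fK; have cK c : continuous (cst c : R -> R) by move=> ?; exact: cvg_cst.
rewrite ler_norml -mulNr -!int_cst; apply/andP; split; apply: le_int => // s.
  by move=> /fK; rewrite ler_norml => /andP[].
by move=> /fK; rewrite ler_norml => /andP[].
Qed.

End Integral.

(** * Limits of matrices and parametric integrals *)

Lemma cvg_at_comp {S T U : topologicalType} (h : S -> T) (k : T -> U)
    (p0 : S) (y0 : T) (l : U) :
  h p @[p --> p0] --> y0 -> k y @[y --> y0] --> l -> k (h p) @[p --> p0] --> l.
Proof. by move=> ch ck V /ck; exact: ch. Qed.

Lemma cvg_pair_at {S T U : topologicalType} (f : S -> T) (g : S -> U)
    (p0 : S) (a : T) (b : U) :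
  f p @[p --> p0] --> a -> g p @[p --> p0] --> b ->
  (f p, g p) @[p --> p0] --> (a, b).
Proof. by move=> fa gb; exact: (cvg_pair fa gb). Qed.

Section InvertibleMatrices.
Context {R : realType} {n : nat}.
Implicit Types A B C : 'M[R]_n.

Lemma unitmx_left A B : A *m B = 1%:M -> A \in unitmx.
Proof. by move=> /mulmx1_unit[]. Qed.

Lemma unitmx_right A B : A *m B = 1%:M -> B \in unitmx.
Proof. by move=> /mulmx1_unit[]. Qed.

Lemma mulmx_invmx_mid B A C : B \in unitmx ->
  A *m B *m (invmx B *m C) = A *m C.
Proof. by move=> uB; rewrite mulmxA mulmxK. Qed.

Lemma unitmx_idem A : A \in unitmx -> A = A *m A -> A = 1%:M.
Proof. by move=> uA e; rewrite -[LHS](mulKmx uA) -e mulVmx. Qed.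

Lemma right_inverse_mul A B C : A \in unitmx -> B \in unitmx ->
  B *m C = 1%:M -> C = invmx (A *m B) *m A.
Proof.
move=> uA uB BC; have uAB : A *m B \in unitmx by rewrite unitmx_mul uA.
by rewrite -[LHS](mulKmx uAB) -(mulmxA A) BC mulmx1.
Qed.

Lemma invmx_of_right_inverse A B : A *m B = 1%:M -> invmx B = A.
Proof.
move=> AB; have uB := unitmx_right AB.
by rewrite -[RHS](mulmxK uB) AB mul1mx.
Qed.

End InvertibleMatrices.

Section MatrixLimits.
Context {R : realType} {T : Type} (F : set_system T) {FF : Filter F}.

Lemma cvg_mxP k n (f : T -> 'M[R]_(k, n)) (A : 'M[R]_(k, n)) :
  f x @[x --> F] --> A <-> forall i j, f x i j @[x --> F] --> A i j.
Proof.
split=> [fA i j|fA].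
  exact: (continuous_cvg _ (@coord_continuous _ _ _ i j A) fA).
move=> U [P AP PU].
have : \forall x \near F, forall i j, P i j (f x i j).
  apply: filter_forall => i; apply: filter_forall => j.
  exact: fA (AP i j).
by apply: filterS => x Px; exact: PU.
Qed.

Lemma cvg_sumr (I : finType) (f : I -> T -> R) (a : I -> R) :
  (forall i, f i x @[x --> F] --> a i) ->
  \sum_i f i x @[x --> F] --> \sum_i a i.
Proof. by move=> fa; apply: cvg_big => //; exact: add_continuous. Qed.

Lemma cvg_prodr (I : finType) (f : I -> T -> R) (a : I -> R) :
  (forall i, f i x @[x --> F] --> a i) ->
  \prod_i f i x @[x --> F] --> \prod_i a i.
Proof. by move=> fa; apply: cvg_big => //; exact: mul_continuous. Qed.

Lemma cvg_mulmx k n p (f : T -> 'M[R]_(k, n)) (g : T -> 'M[R]_(n, p))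
    (A : 'M[R]_(k, n)) (B : 'M[R]_(n, p)) :
  f x @[x --> F] --> A -> g x @[x --> F] --> B ->
  f x *m g x @[x --> F] --> A *m B.
Proof.
move=> /cvg_mxP fA /cvg_mxP gB; apply/cvg_mxP => i j.
under eq_cvg do rewrite mxE.
by rewrite mxE; apply: cvg_sumr => l; apply: cvgM.
Qed.

Lemma cvg_trmx k n (f : T -> 'M[R]_(k, n)) (A : 'M[R]_(k, n)) :
  f x @[x --> F] --> A -> (f x)^T @[x --> F] --> A^T.
Proof.
move=> /cvg_mxP fA; apply/cvg_mxP => i j.
by under eq_cvg do rewrite mxE; rewrite mxE; exact: fA.
Qed.

Lemma cvg_row_mx k n p (f : T -> 'M[R]_(k, n)) (g : T -> 'M[R]_(k, p))
    (A : 'M[R]_(k, n)) (B : 'M[R]_(k, p)) :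
  f x @[x --> F] --> A -> g x @[x --> F] --> B ->
  row_mx (f x) (g x) @[x --> F] --> row_mx A B.
Proof.
move=> /cvg_mxP fA /cvg_mxP gB; apply/cvg_mxP => i j.
rewrite -(splitK j); case: (fintype.split j) => l /=.
  by rewrite row_mxEl; under eq_cvg do rewrite row_mxEl; exact: fA.
by rewrite row_mxEr; under eq_cvg do rewrite row_mxEr; exact: gB.
Qed.

Lemma cvg_const_mx k n (f : T -> R) (a : R) :
  f x @[x --> F] --> a -> const_mx (f x) @[x --> F] --> (const_mx a : 'M[R]_(k, n)).
Proof.
move=> fa; apply/cvg_mxP => i j; rewrite mxE.
by under eq_cvg do rewrite mxE.
Qed.

Lemma cvg_trace n (f : T -> 'M[R]_n) (A : 'M[R]_n) :
  f x @[x --> F] --> A -> \tr (f x) @[x --> F] --> \tr A.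
Proof. by move=> /cvg_mxP fA; apply: cvg_sumr => i; exact: fA. Qed.

Lemma cvg_det n (f : T -> 'M[R]_n) (A : 'M[R]_n) :
  f x @[x --> F] --> A -> \det (f x) @[x --> F] --> \det A.
Proof.
move=> /cvg_mxP fA; apply: cvg_sumr => s; apply: cvgM; first exact: cvg_cst.
by apply: cvg_prodr => i; exact: fA.
Qed.

Lemma cvg_invmx n (f : T -> 'M[R]_n) (A : 'M[R]_n) : A \in unitmx ->
  f x @[x --> F] --> A -> invmx (f x) @[x --> F] --> invmx A.
Proof.
rewrite unitmxE unitfE => uA fA.
have dA := cvg_det fA.
have near_unit : \forall x \near F, f x \in unitmx.
  by near do rewrite unitmxE unitfE; exact: (cvgr_neq0 _ dA).
have E X : X \in unitmx -> invmx X = (\det X)^-1 *: \adj X.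
  by rewrite /invmx => ->.
rewrite E ?unitmxE ?unitfE//.
have : (\det (f x))^-1 *: \adj (f x) @[x --> F] --> (\det A)^-1 *: \adj A.
  apply/cvg_mxP => i j; rewrite !mxE.
  under eq_cvg do rewrite !mxE.
  apply: cvgM; first exact: cvgV.
  apply: cvgM; first exact: cvg_cst.
  apply: cvg_det; apply/cvg_mxP => k l; rewrite !mxE.
  by under eq_cvg do rewrite !mxE; move/cvg_mxP : fA; apply.
apply: cvg_trans; apply: near_eq_cvg.
by apply: filterS near_unit => x /E->.
Unshelve. all: by end_near. Qed.

End MatrixLimits.

Section ParametricIntegral.
Context {R : realType}.

Lemma norm_int_le_dist (f : R -> R) a b K : continuous f ->
  (forall s, Num.min a b <= s <= Num.max a b -> `|f s| <= K) ->
  `|int f a b| <= K * `|b - a|.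
Proof.
move=> cf fK; have [ab|/ltW ba] := leP a b.
  rewrite [`|b - a|]ger0_norm ?subr_ge0//; apply: norm_int_le => // s.
  by move: (fK s); rewrite (min_l ab) (max_r ab).
have -> : int f a b = - int f b a by rewrite /int opprB.
rewrite normrN [`|b - a|]distrC [`|a - b|]ger0_norm ?subr_ge0//.
apply: norm_int_le => // s; by move: (fK s); rewrite (min_r ba) (max_l ba).
Qed.

(** The bounds stay in a fixed segment [A, B], whose compactness turns the joint
    continuity of the integrand at each (x0, s) into uniform convergence on
    [A, B]. *)
Lemma int_cvg (X : topologicalType) (x0 : X) (f : X -> R -> R) (a b : X -> R) :
  (forall x, continuous (f x)) ->
  (forall s, f p.1 p.2 @[p --> (x0, s)] --> f x0 s) ->
  a x @[x --> x0] --> a x0 -> b x @[x --> x0] --> b x0 ->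
  int (f x) (a x) (b x) @[x --> x0] --> int (f x0) (a x0) (b x0).
Proof.
move=> cf fx0 ca cb.
pose A := Num.min (a x0) (b x0) - 1; pose B := Num.max (a x0) (b x0) + 1.
have Aa : A < a x0 by rewrite ltrBlDr ltr_pwDr// ge_min lexx.
have Ab : A < b x0 by rewrite ltrBlDr ltr_pwDr// ge_min lexx orbT.
have aB : a x0 < B by rewrite ltr_pwDr// le_max lexx.
have bB : b x0 < B by rewrite ltr_pwDr// le_max lexx orbT.
have unif (eta : R) : 0 < eta ->
    \forall x \near x0, forall s, A <= s <= B -> `|f x s - f x0 s| <= eta.
  move=> eta0; have /compact_near_coveringP cov := @segment_compact R A B.
  have := cov X (nbhs x0) (fun x s => `|f x s - f x0 s| <= eta) _.
  suff H : forall s, `[A, B]%classic s ->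
      \forall s' \near s & x \near x0, `|f x s' - f x0 s'| <= eta.
    by move=> /(_ _ H); apply: filterS => x + s sAB; apply; rewrite /= in_itv.
  move=> s _; have e2 : 0 < eta / 2 by rewrite divr_gt0.
  have N1 : \forall s' \near s, `|f x0 s - f x0 s'| < eta / 2.
    exact: (cvgr_dist_lt _ _ (cf x0 s)).
  have [[U V] /= [Us Vx] UV] : \forall p \near (x0, s),
      `|f x0 s - f p.1 p.2| < eta / 2 by exact: (cvgr_dist_lt _ _ (fx0 s)).
  exists ([set s' | V s' /\ `|f x0 s - f x0 s'| < eta / 2], U) => /=.
    by split=> //; exact: filterI.
  move=> [s' x] /= [[Vs' d1] Ux]; have /= d2 := UV (x, s') (conj Ux Vs').
  rewrite distrC (le_trans (ler_distD (f x0 s) _ _))// [eta]splitr.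
  by rewrite lerD// ltW// distrC.
have [P pP] := primitive_exists (cf x0).
have PC y : P z @[z --> y] --> P y.
  by apply/differentiable_continuous/derivable1_diffP; case: (pP y).
have main : int (f x0) (a x) (b x) @[x --> x0] --> int (f x0) (a x0) (b x0).
  rewrite (intE _ _ pP); under eq_cvg do rewrite (intE _ _ pP).
  by apply: cvgB; [exact: (continuous_cvg _ (PC _) cb)|
    exact: (continuous_cvg _ (PC _) ca)].
apply/cvgrPdist_lt => e e0.
pose eta := e / (4 * (B - A)).
have BA : 0 < B - A by lra.
have eta0 : 0 < eta by rewrite divr_gt0// mulr_gt0.
have M : \forall x \near x0,
    `|int (f x0) (a x0) (b x0) - int (f x0) (a x) (b x)| < e / 2.
  by apply: (cvgr_dist_lt _ _ main); rewrite divr_gt0.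
near=> x.
have Aax : A < a x by near: x; exact: (cvgr_gt _ ca).
have Abx : A < b x by near: x; exact: (cvgr_gt _ cb).
have axB : a x < B by near: x; exact: (cvgr_lt _ ca).
have bxB : b x < B by near: x; exact: (cvgr_lt _ cb).
have ux : forall s, A <= s <= B -> `|f x s - f x0 s| <= eta.
  by near: x; exact: unif.
have cN : continuous (fun s => -1 * f x0 s).
  by move=> s; apply: cvgM; [exact: cvg_cst|exact: cf].
have dif : `|int (f x) (a x) (b x) - int (f x0) (a x) (b x)| <= e / 4.
  have -> : int (f x) (a x) (b x) - int (f x0) (a x) (b x) =
      int (fun s => f x s + -1 * f x0 s) (a x) (b x).
    by rewrite intD// intZ// mulN1r.
  apply: (@le_trans _ _ (eta * `|b x - a x|)).
    apply: norm_int_le_dist => [s|s /andP[s1 s2]].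
      by apply: cvgD; [exact: cf|exact: cN].
    rewrite mulN1r; apply: ux.
    move: s1 s2; rewrite ge_min le_max => /orP[s1|s1] /orP[s2|s2];
      by apply/andP; split; lra.
  have -> : e / 4 = eta * (B - A).
    by rewrite /eta invfM mulrA -mulrA mulVf ?mulr1// gt_eqF.
  by rewrite ler_pM2l// ler_norml; apply/andP; split; lra.
have main' : `|int (f x0) (a x0) (b x0) - int (f x0) (a x) (b x)| < e / 2.
  by near: x.
rewrite (le_lt_trans (ler_distD (int (f x0) (a x) (b x)) _ _))//.
rewrite [X in _ + X]distrC; lra.
Unshelve. all: by end_near. Qed.

Definition mxint k n (f : R -> 'M[R]_(k, n)) a b : 'M[R]_(k, n) :=
  \matrix_(i, j) int (fun s => f s i j) a b.

Lemma mxint_cvg (X : topologicalType) k n (x0 : X) (f : X -> R -> 'M[R]_(k, n))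
    (a b : X -> R) :
  (forall x, continuous (f x)) ->
  (forall s, f p.1 p.2 @[p --> (x0, s)] --> f x0 s) ->
  a x @[x --> x0] --> a x0 -> b x @[x --> x0] --> b x0 ->
  mxint (f x) (a x) (b x) @[x --> x0] --> mxint (f x0) (a x0) (b x0).
Proof.
move=> cf fx0 ca cb; apply/cvg_mxP => i j.
under eq_cvg do rewrite mxE.
rewrite mxE; apply: int_cvg => // [x s|s].
  by have /cvg_mxP := cf x s; apply.
by have /cvg_mxP := fx0 s; apply.
Qed.

Lemma continuous_entry k n (f : R -> 'M[R]_(k, n)) i j :
  continuous f -> continuous (fun s => f s i j).
Proof. by move=> cf s; have /cvg_mxP := cf s; apply. Qed.

Lemma mul_mxint k n p q (A : 'M[R]_(p, k)) (B : 'M[R]_(n, q))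
    (f : R -> 'M[R]_(k, n)) a b : continuous f ->
  A *m mxint f a b *m B = mxint (fun s => A *m f s *m B) a b.
Proof.
move=> cf; apply/matrixP => i j; rewrite !mxE.
have cfe i' j' := @continuous_entry _ _ _ i' j' cf.
have cZ c i' j' : continuous (fun s => c * f s i' j').
  by move=> s; apply: cvgM; [exact: cvg_cst|exact: cfe].
under [X in _ = int X _ _]funext => s.
  rewrite mxE.
  under eq_bigr => l _ do rewrite mxE mulr_suml.
  over.
have E (l : 'I_n) (r : 'I_k) s : A i r * f s r l * B l j = A i r * B l j * f s r l.
  by rewrite mulrAC.
have cE l r : continuous (fun s => A i r * f s r l * B l j).
  by rewrite (funext (E l r)); exact: cZ.
rewrite int_sum; last first.
  move=> l s; apply: (@cvg_sumr R _ _ _ _ (fun r s => A i r * f s r l * B l j)) => r.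
  exact: cE.
apply: eq_bigr => l _; rewrite int_sum//.
rewrite !mxE mulr_suml; apply: eq_bigr => r _.
by rewrite (funext (E l r)) intZ// mxE mulrAC.
Qed.

Lemma qform_mxint n (f : R -> 'M[R]_n) a b v : continuous f ->
  qform (mxint f a b) v = int (fun s => qform (f s) v) a b.
Proof. by move=> cf; rewrite /qform mul_mxint// mxE. Qed.

Lemma mxint_sym n (f : R -> 'M[R]_n) a b : (forall s, (f s)^T = f s) ->
  (mxint f a b)^T = mxint f a b.
Proof.
move=> sf; apply/matrixP => i j; rewrite !mxE; congr int; apply/funext => s.
by rewrite -[in LHS]sf mxE.
Qed.

Lemma continuous_qform n (f : R -> 'M[R]_n) v : continuous f ->
  continuous (fun s => qform (f s) v).
Proof.
move=> cf s; have : (v *m f x *m v^T) @[x --> s] --> v *m f s *m v^T.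
  by apply: cvg_mulmx; [apply: cvg_mulmx; [exact: cvg_cst|exact: cf]|exact: cvg_cst].
by move/cvg_mxP; apply.
Qed.

Lemma posdef_mxint n (f : R -> 'M[R]_n) a b : a < b -> continuous f ->
  (forall s, posdef (f s)) -> posdef (mxint f a b).
Proof.
move=> ab cf pf; split; first by apply: mxint_sym => s; case: (pf s).
move=> v v0; rewrite qform_mxint//; apply: int_gt0 => //.
  exact: continuous_qform.
by move=> s; have [_] := pf s; apply.
Qed.

End ParametricIntegral.

(** * Averages along a flow on a compact space *)

Lemma continuous_comp2 {S T U V : topologicalType} (f : T -> U -> V)
    (a : S -> T) (b : S -> U) :
  continuous (fun p => f p.1 p.2) -> continuous a -> continuous b ->
  continuous (fun s => f (a s) (b s)).
Proof.
move=> cf ca cb s; apply: (cvg_comp (fun s => (a s, b s)) _ _ (cf (a s, b s))).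
by apply: cvg_pair; [exact: ca|exact: cb].
Qed.

Lemma continuous_pair2 {S T U : topologicalType} (f : S -> T -> U) x :
  continuous (fun p => f p.1 p.2) -> continuous (f x).
Proof.
move=> cf; apply: (continuous_comp2 cf); first by move=> ?; exact: cvg_cst.
by move=> ?; exact: cvg_id.
Qed.

Lemma continuous_pair1 {S T U : topologicalType} (f : S -> T -> U) y :
  continuous (fun p => f p.1 p.2) -> continuous (f^~ y).
Proof.
move=> cf; apply: (continuous_comp2 cf); first by move=> ?; exact: cvg_id.
by move=> ?; exact: cvg_cst.
Qed.

Lemma continuous_sumr {R : realType} {T : topologicalType} (I : finType)
    (f : I -> T -> R) :
  (forall i, continuous (f i)) -> continuous (fun s => \sum_i f i s).
Proof. by move=> cf s; apply: cvg_sumr => i; exact: cf. Qed.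

Lemma compact_bounded {R : realType} {T : topologicalType} (A : set T)
    (f : T -> R) : compact A -> continuous f ->
  exists C, forall x, A x -> `|f x| <= C.
Proof.
move=> cA cf; have := @continuous_compact T R f A.
move=> /(_ (continuous_subspaceT cf) cA) /compact_bounded[M [_ MP]].
exists (M + 1) => x Ax; apply: MP; first by rewrite ltrDl.
by exists x.
Qed.

Section Flow.
Context {R : realType} {G : topologicalType} (phi : R -> G -> G).
Hypothesis G_compact : compact [set: G].
Hypothesis phiD : forall s t x, phi (s + t) x = phi t (phi s x).
Hypothesis phi_continuous : continuous (fun p : R * G => phi p.1 p.2).

Implicit Types (a b : G -> R) (x y : G).

Definition orbit_int (a : G -> R) (t : R) (x : G) : R :=
  int (fun s => a (phi s x)) 0 t.

Lemma continuous_orbit a x : continuous a -> continuous (fun s => a (phi s x)).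
Proof.
move=> ca s.
apply: (@continuous_comp _ _ _ (phi^~ x) a); last exact: ca.
exact: (continuous_pair1 phi_continuous).
Qed.

Lemma orbit_intD a s t x : continuous a ->
  orbit_int a (s + t) x = orbit_int a s x + orbit_int a t (phi s x).
Proof.
move=> ca; rewrite /orbit_int -(int_chasles _ s 0); congr (_ + _).
rewrite -[X in int _ X _]add0r [X in int _ _ X]addrC -int_shift; last first.
  exact: continuous_orbit.
by congr (int _ _ _); apply/funext => r; rewrite addrC phiD.
Qed.

Lemma orbit_int_le a b t x : continuous a -> continuous b -> 0 <= t ->
  (forall y, a y <= b y) -> orbit_int a t x <= orbit_int b t x.
Proof. by move=> ca cb t0 ab; apply: le_int => //; exact: continuous_orbit. Qed.

Lemma orbit_int_cst c t x : orbit_int (cst c) t x = c * t.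
Proof.
by rewrite /orbit_int (_ : (fun _ => _) = cst c)// int_cst subr0.
Qed.

Lemma orbit_int_add a b t x : continuous a -> continuous b ->
  orbit_int (fun y => a y + b y) t x = orbit_int a t x + orbit_int b t x.
Proof. by move=> ca cb; apply: intD; exact: continuous_orbit. Qed.

Lemma orbit_int_scale c a t x : continuous a ->
  orbit_int (fun y => c * a y) t x = c * orbit_int a t x.
Proof. by move=> ca; apply: intZ; exact: continuous_orbit. Qed.

Lemma continuous_orbit_int a : continuous a ->
  continuous (fun p : R * G => orbit_int a p.1 p.2).
Proof.
move=> ca p; apply: (@int_cvg R _ p (fun p s => a (phi s p.2)) (cst 0) fst).
- by move=> q; exact: continuous_orbit.
- move=> s; apply: (@continuous_comp2 ((R * G) * R)%type _ _ _
    (fun s x => a (phi s x)) snd (fun q => q.1.2) _ _ _ (p, s)) => q.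
  + apply: (@continuous_comp _ _ _ (fun p => phi p.1 p.2) a); last exact: ca.
    exact: phi_continuous.
  + exact: cvg_snd.
  + by apply: (@continuous_comp _ _ _ fst snd); [exact: cvg_fst|exact: cvg_snd].
- exact: cvg_cst.
- exact: cvg_fst.
Qed.

(** Chopping an orbit piece of length n T at the points s + j T bounds the
    subadditive function by a sum over j; the mean over s in [0, T] of these
    sums is an integral along the orbit. *)
Lemma subadditive_average (al : R -> G -> R) T :
  continuous (fun p => al p.1 p.2) ->
  (forall s t x, al (s + t) x <= al s x + al t (phi s x)) -> 0 < T ->
  exists C, forall n x,
    al (n%:R * T) x <= C + orbit_int (fun y => al T y / T) (n%:R * T) x.
Proof.
move=> cal subal T0.
have cK : compact (`[- T, T]%classic `*` [set: G]).
  by apply: compact_setX => //; exact: segment_compact.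
have [C HC] := compact_bounded cK cal.
have bnd s x : - T <= s <= T -> al s x <= C.
  move=> sT; apply: le_trans (ler_norm _) _.
  by apply: (HC (s, x)); split => //=; rewrite in_itv.
have calT : continuous (al T) by exact: continuous_pair2.
exists (3 * C) => n x.
pose f s := al T (phi s x).
have cf : continuous f by exact: continuous_orbit.
have cfj j : continuous (fun s => f (s + j%:R * T)).
  move=> s; apply: (@continuous_comp _ _ _ (fun s => s + j%:R * T) f); last exact: cf.
  by apply: cvgD; [exact: cvg_id|exact: cvg_cst].
have chop k y : al (k%:R * T) y <= C + \sum_(j < k) al T (phi (j%:R * T) y).
  elim: k y => [|k IH] y.
    by rewrite big_ord0 addr0 mul0r bnd//; apply/andP; split; lra.
  rewrite -natr1 mulrDl mul1r big_ord_recr /= addrA (le_trans (subal _ _ _))//.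
  by rewrite lerD2r.
have pointwise s : 0 <= s <= T ->
    al (n%:R * T) x <= 3 * C + \sum_(j < n) f (s + j%:R * T).
  move=> /andP[s0 sT].
  have -> : n%:R * T = s + n%:R * T + - s by ring.
  apply: le_trans (subal _ _ _) _; apply: le_trans (lerD (subal _ _ _) (lexx _)) _.
  have h1 : al s x <= C by rewrite bnd//; apply/andP; split; lra.
  have h2 : al (- s) (phi (s + n%:R * T) x) <= C.
    by rewrite bnd//; apply/andP; split; lra.
  have h3 := chop n (phi s x).
  under eq_bigr => j _ do rewrite /f phiD.
  by lra.
have csum : continuous (fun s => \sum_(j < n) f (s + j%:R * T)).
  by apply: continuous_sumr => j; exact: cfj.
have integ : T * al (n%:R * T) x <= 3 * C * T + int f 0 (n%:R * T).
  have -> : int f 0 (n%:R * T) = int (fun s => \sum_(j < n) f (s + j%:R * T)) 0 T.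
    rewrite int_sum//; elim: n {pointwise csum} => [|k IH].
      by rewrite big_ord0 mul0r intxx.
    rewrite big_ord_recr /= -IH int_shift// add0r -natr1 mulrDl mul1r.
    by rewrite [T + _]addrC int_chasles.
  have -> : T * al (n%:R * T) x = int (cst (al (n%:R * T) x)) 0 T.
    by rewrite int_cst subr0 mulrC.
  have -> : 3 * C * T = int (cst (3 * C)) 0 T by rewrite int_cst subr0.
  rewrite -intD//; last by move=> ?; exact: cvg_cst.
  apply: le_int => //; first by move=> ?; exact: cvg_cst.
  - by move=> s; apply: cvgD; [exact: cvg_cst|exact: csum].
  - exact: ltW.
have -> : orbit_int (fun y => al T y / T) (n%:R * T) x =
    T^-1 * int f 0 (n%:R * T).
  rewrite -orbit_int_scale//; congr (int _ _ _).
  by apply/funext => s; rewrite mulrC.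
rewrite -(ler_pM2l T0) mulrDr mulVKf ?gt_eqF//.
by rewrite (mulrC T (3 * C)).
Qed.

(** By additivity, both l (phi t x) + d t x - l x and the orbit integral are 1 / T
    times the difference of the integrals of d over [T, T + t] and over [0, t]. *)
Lemma cocycle_average (d : R -> G -> R) T (l := fun x => int (d^~ x) 0 T / T) :
  continuous (fun p => d p.1 p.2) ->
  (forall s t x, d (s + t) x = d s x + d t (phi s x)) -> 0 < T ->
  continuous l /\ forall t x,
    l (phi t x) + d t x = l x + orbit_int (fun y => d T y / T) t x.
Proof.
move=> cd dD T0.
have cx x : continuous (d^~ x) by exact: continuous_pair1.
split=> [x|t x].
  apply: cvgM; last exact: cvg_cst.
  apply: (@int_cvg R G x (fun x s => d s x) (cst 0) (cst T)) => //.
  - move=> s; apply: (@continuous_comp2 (G * R)%type _ _ _ d snd fst _ _ _ (x, s)) => //.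
    + by move=> ?; exact: cvg_snd.
    + by move=> ?; exact: cvg_fst.
  - exact: cvg_cst.
  - exact: cvg_cst.
have cdT : continuous (d T) by exact: continuous_pair2.
have cshift r : continuous (fun s => d (s + r) x).
  move=> s; apply: (@continuous_comp _ _ _ (fun s => s + r) (d^~ x)); last exact: cx.
  by apply: cvgD; [exact: cvg_id|exact: cvg_cst].
have e1 : int (d^~ (phi t x)) 0 T = int (d^~ x) t (T + t) - T * d t x.
  have -> : d^~ (phi t x) = (fun s => d (s + t) x + cst (- d t x) s).
    by apply/funext => s; rewrite [s + t]addrC dD /cst; ring.
  rewrite intD//; last by move=> ?; exact: cvg_cst.
  by rewrite int_cst (@int_shift _ (d^~ x))// add0r; ring.
have e2 : orbit_int (fun y => d T y / T) t x =
    T^-1 * (int (d^~ x) T (T + t) - int (d^~ x) 0 t).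
  have -> : orbit_int (fun y => d T y / T) t x = T^-1 * orbit_int (d T) t x.
    rewrite -orbit_int_scale//; congr (int _ _ _).
    by apply/funext => s; rewrite mulrC.
  congr (_ * _); rewrite /orbit_int.
  have -> : (fun s => d T (phi s x)) = (fun s => d (s + T) x + -1 * d s x).
    by apply/funext => s; rewrite dD; ring.
  rewrite intD//; last by move=> s; apply: cvgM; [exact: cvg_cst|exact: cx].
  by rewrite intZ// (@int_shift _ (d^~ x))// add0r (addrC t T); ring.
rewrite /l e1 e2.
have h1 := int_chasles (d^~ x) t 0 (T + t).
have h2 := int_chasles (d^~ x) T 0 (T + t).
have -> : int (d^~ x) t (T + t) =
    int (d^~ x) 0 T + int (d^~ x) T (T + t) - int (d^~ x) 0 t by lra.
by field; rewrite gt_eqF.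
Qed.

End Flow.

(** * Adapted metrics for a linear cocycle *)

Section FrameProjection.
Context {R : rcfType}.

(** The sum of the two Gram forms vanishes only on vectors orthogonal to all
    rows of e and f, and these rows span the whole space. *)
Lemma frames_gram_unit k l n (e : 'M[R]_(k, n)) (f : 'M[R]_(l, n)) :
  row_full (e + f)%MS -> e^T *m e + f^T *m f \in unitmx.
Proof.
move=> full.
have sq j (a : 'M[R]_(j, n)) v : qform (a^T *m a) v = qform 1%:M (v *m a^T).
  by rewrite -qform_congr mulmx1 trmxK.
have sq0 j (w : 'rV[R]_j) : 0 <= qform 1%:M w.
  by rewrite qform1 sumr_ge0// => i _; exact: sqr_ge0.
have sq_eq0 j (w : 'rV[R]_j) : qform 1%:M w = 0 -> w = 0.
  rewrite qform1 => /psumr_eq0P H; apply/rowP => i; rewrite mxE; apply/eqP.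
  by rewrite -sqrf_eq0 H// => *; exact: sqr_ge0.
apply: posdef_unit; split; first by rewrite linearD /= !trmx_mul !trmxK.
move=> v v0; rewrite qformD !sq lt_neqAle addr_ge0// andbT eq_sym.
apply: contraNneq v0 => /eqP; rewrite paddr_eq0// => /andP[/eqP/sq_eq0 ve].
move=> /eqP/sq_eq0 vf.
have ker j (a : 'M[R]_(j, n)) : v *m a^T = 0 -> a *m v^T = 0.
  by move=> H; rewrite -[LHS]trmxK trmx_mul trmxK H trmx0.
have vT : 1%:M *m v^T = 0.
  have : (1%:M <= e + f)%MS by exact: submx_full.
  move=> /sub_addsmxP[[a b] ->] /=.
  by rewrite mulmxDl -!mulmxA !ker// !mulmx0 addr0.
by rewrite -[v]trmxK -[v^T]mul1mx vT trmx0.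
Qed.

(** A projection in terms of frames e of its image and f of its kernel; the
    formula is what makes its continuity visible. *)
Lemma proj_frames k l n (e : 'M[R]_(k, n)) (f : 'M[R]_(l, n)) (P : 'M[R]_n) :
  row_full (e + f)%MS -> e *m P = e -> f *m P = 0 ->
  P = invmx (e^T *m e + f^T *m f) *m (e^T *m e).
Proof.
move=> /frames_gram_unit u eP fP; apply: (can_inj (mulKmx u)).
by rewrite mulKVmx// mulmxDl -!mulmxA eP fP mulmx0 addr0.
Qed.

End FrameProjection.

Section Window.
Context {R : realType}.

(** Sliding the window [a, a + L] to the right replaces values of f by values
    taken a time L later. *)
Lemma window_homo (f : R -> R) L a b : continuous f ->
  (forall s, f s <= f (s + L)) -> a <= b ->
  int f a (a + L) <= int f b (b + L).
Proof.
move=> cf fL ab.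
have h1 := int_chasles f b a (b + L); have h2 := int_chasles f (a + L) a (b + L).
have : int f a b <= int f (a + L) (b + L).
  rewrite -int_shift//; apply: le_int => // s.
  apply: (@continuous_comp _ _ _ (fun s => s + L) f); last exact: cf.
  by apply: cvgD; [exact: cvg_id|exact: cvg_cst].
by lra.
Qed.

Lemma window_antihomo (f : R -> R) L a b : continuous f ->
  (forall s, f (s + L) <= f s) -> a <= b ->
  int f b (b + L) <= int f a (a + L).
Proof.
move=> cf fL ab.
have cN : continuous (fun s => -1 * f s).
  by move=> s; apply: cvgM; [exact: cvg_cst|exact: cf].
have := @window_homo (fun s => -1 * f s) L a b cN _ ab.
rewrite !intZ// => H; suff : -1 * int f a (a + L) <= -1 * int f b (b + L) by lra.
by apply: H => s; rewrite !mulN1r lerN2.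
Qed.

End Window.

(** G is the base space, D t x maps the fibre at x to the fibre at phi t x, and
    all fibres are R^m, in coordinates depending on the base point in no
    continuous way. For x near x0, tau x0 x converts the coordinates used at x0
    into those used at x; continuity at x0 of a family of forms or
    endomorphisms is continuity after conversion by tau x0. *)
Section Cocycle.
Context {R : realType} {m : nat} {G : topologicalType}.
Variables (phi : R -> G -> G) (D : R -> G -> 'M[R]_m) (tau : G -> G -> 'M[R]_m).
Hypothesis G_compact : compact [set: G].
Hypothesis phi0 : forall x, phi 0 x = x.
Hypothesis phiD : forall s t x, phi (s + t) x = phi t (phi s x).
Hypothesis phi_continuous : continuous (fun p : R * G => phi p.1 p.2).
Hypothesis tau1 : forall x, tau x x = 1%:M.
Hypothesis tau_unit : forall x0, \forall x \near x0, tau x0 x \in unitmx.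
Hypothesis D0 : forall x, D 0 x = 1%:M.
Hypothesis DD : forall s t x, D (s + t) x = D s x *m D t (phi s x).
Hypothesis D_continuous : forall p0 : R * G,
  tau p0.2 p.2 *m D p.1 p.2 *m invmx (tau (phi p0.1 p0.2) (phi p.1 p.2))
    @[p --> p0] --> D p0.1 p0.2.

Implicit Types (x y : G) (s t : R).

Definition continuous_form (P : G -> 'M[R]_m) := forall x0,
  tau x0 x *m P x *m (tau x0 x)^T @[x --> x0] --> P x0.

Definition continuous_endo (P : G -> 'M[R]_m) := forall x0,
  tau x0 x *m P x *m invmx (tau x0 x) @[x --> x0] --> P x0.

Lemma D_V t x : D t x *m D (- t) (phi t x) = 1%:M.
Proof. by rewrite -DD subrr D0. Qed.

Lemma phi_V t x : phi (- t) (phi t x) = x.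
Proof. by rewrite -phiD subrr phi0. Qed.

Lemma D_unit t x : D t x \in unitmx.
Proof. by case: (mulmx1_unit (D_V t x)). Qed.

Definition pullback t (P : G -> 'M[R]_m) x := D t x *m P (phi t x) *m (D t x)^T.

Lemma qform_pullback t (P : G -> 'M[R]_m) x v :
  qform (pullback t P x) v = qform (P (phi t x)) (v *m D t x).
Proof. exact: qform_congr. Qed.

Lemma posdef_pullback t (P : G -> 'M[R]_m) x :
  posdef (P (phi t x)) -> posdef (pullback t P x).
Proof. by apply: posdef_congr; rewrite row_free_unit D_unit. Qed.

Lemma pullback_continuous (P : G -> 'M[R]_m) : continuous_form P -> forall p0 : R * G,
  tau p0.2 p.2 *m pullback p.1 P p.2 *m (tau p0.2 p.2)^T @[p --> p0] -->
  pullback p0.1 P p0.2.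
Proof.
move=> cP p0; set y0 := phi p0.1 p0.2.
pose X p := tau p0.2 p.2 *m D p.1 p.2 *m invmx (tau y0 (phi p.1 p.2)).
pose Y p := tau y0 (phi p.1 p.2) *m P (phi p.1 p.2) *m (tau y0 (phi p.1 p.2))^T.
have cY : Y p @[p --> p0] --> P y0.
  exact: (@cvg_at_comp _ _ _ (fun p : R * G => phi p.1 p.2)
    (fun y => tau y0 y *m P y *m (tau y0 y)^T) p0 y0 _ (phi_continuous (x := p0))).
have cX : X p @[p --> p0] --> D p0.1 p0.2 by exact: D_continuous.
have XYX : X p *m Y p *m (X p)^T @[p --> p0] --> pullback p0.1 P p0.2.
  by apply: cvg_mulmx; [exact: cvg_mulmx|exact: cvg_trmx].
apply: cvg_trans XYX; apply: near_eq_cvg.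
have : \forall p \near p0, tau y0 (phi p.1 p.2) \in unitmx.
  exact: (phi_continuous (x := p0) (tau_unit y0)).
apply: filterS => p u; rewrite /X /Y /pullback.
set A := tau y0 _ in u *; rewrite !trmx_mul !mulmxA.
rewrite mulmxKV// -(mulmxA _ A^T) -trmx_mul mulVmx// trmx1 mulmx1.
by [].
Qed.

Lemma pullback_continuous_time (P : G -> 'M[R]_m) x :
  continuous_form P -> continuous (fun s => pullback s P x).
Proof.
move=> cP s.
have cs : (r, x) @[r --> s] --> (s, x).
  by apply: cvg_pair_at; [exact: cvg_id|exact: cvg_cst].
have := @cvg_at_comp _ _ _ (fun r : R => (r, x)) _ _ _ _ cs
  (@pullback_continuous P cP (s, x)).
have E : (fun r => tau x x *m pullback r P x *m (tau x x)^T) =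
    (fun r => pullback r P x).
  by apply/funext => r; rewrite tau1 trmx1 mulmx1 mul1mx.
by rewrite /= E.
Qed.

Section Weighted.
Variables (c : R -> G -> R) (g : G -> 'M[R]_m).
Hypothesis c_continuous : continuous (fun p : R * G => c p.1 p.2).
Hypothesis g_continuous : continuous_form g.

Definition weighted s x := expR (c s x) *: pullback s g x.

Lemma weighted_continuous_time x : continuous (fun s => weighted s x).
Proof.
move=> s; apply: cvgZ.
  apply: (@continuous_comp _ _ _ (c^~ x) expR); last exact: continuous_expR.
  exact: (continuous_pair1 c_continuous).
exact: pullback_continuous_time.
Qed.

Lemma weighted_continuous p0 :
  tau p0.2 p.2 *m weighted p.1 p.2 *m (tau p0.2 p.2)^T @[p --> p0] -->
  weighted p0.1 p0.2.
Proof.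
rewrite /weighted; under eq_cvg do rewrite -scalemxAr -scalemxAl.
apply: cvgZ; last exact: pullback_continuous.
apply: (@continuous_comp _ _ _ (fun p : R * G => c p.1 p.2) expR).
  exact: c_continuous.
exact: continuous_expR.
Qed.

Lemma mxint_weighted_continuous (a b : G -> R) x0 :
  a x @[x --> x0] --> a x0 -> b x @[x --> x0] --> b x0 ->
  tau x0 x *m mxint (weighted^~ x) (a x) (b x) *m (tau x0 x)^T @[x --> x0]
    --> mxint (weighted^~ x0) (a x0) (b x0).
Proof.
move=> ca cb.
pose f x s := tau x0 x *m weighted s x *m (tau x0 x)^T.
have cf x : continuous (f x).
  move=> s; apply: cvg_mulmx; last exact: cvg_cst.
  by apply: cvg_mulmx; [exact: cvg_cst|exact: weighted_continuous_time].
have f0 : f x0 = weighted^~ x0.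
  by apply/funext => s; rewrite /f tau1 trmx1 mulmx1 mul1mx.
have : mxint (f x) (a x) (b x) @[x --> x0] --> mxint (f x0) (a x0) (b x0).
  apply: mxint_cvg => // s.
  have cs : (q.2, q.1) @[q --> (x0, s)] --> (s, x0).
    by apply: cvg_pair_at; [exact: cvg_snd|exact: cvg_fst].
  rewrite f0; exact: (@cvg_at_comp _ _ _ (fun q : G * R => (q.2, q.1)) _ _ _ _ cs
    (@weighted_continuous (s, x0))).
rewrite f0; apply: cvg_trans; apply: near_eq_cvg; near=> x.
by rewrite mul_mxint//; exact: weighted_continuous_time.
Unshelve. all: by end_near. Qed.

End Weighted.

Section HSCocycle.
Variables (g Pi : G -> 'M[R]_m).
Hypothesis g_posdef : forall x, posdef (g x).
Hypothesis g_continuous : continuous_form g.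
Hypothesis Pi_continuous : continuous_endo Pi.
Hypothesis Pi_idem : forall x, Pi x *m Pi x = Pi x.
Hypothesis Pi_equivariant : forall t x, Pi x *m D t x = D t x *m Pi (phi t x).

(** Composing with the projection Pi measures the restriction of the cocycle to
    an invariant subbundle without choosing frames. *)
Definition hsflow t x := hsnorm (g x) (g (phi t x)) (Pi x *m D t x).

Lemma hsflow_submul s t x :
  hsflow (s + t) x <= hsflow s x * hsflow t (phi s x).
Proof.
rewrite /hsflow phiD DD mulmxA -[in leLHS]Pi_idem -(mulmxA (Pi x) (Pi x)).
rewrite Pi_equivariant (mulmxA (Pi x)) -(mulmxA (Pi x *m _)).
by rewrite -(Pi_equivariant s x); apply: hsnormM.
Qed.

Lemma hsflow_continuous : continuous (fun p : R * G => hsflow p.1 p.2).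
Proof.
move=> p0; set y0 := phi p0.1 p0.2; set x0 := p0.2.
pose T (p : R * G) := tau x0 p.2; pose S (p : R * G) := tau y0 (phi p.1 p.2).
have snd_continuous : (@snd R G) p @[p --> p0] --> x0 by exact: cvg_snd.
have uS : \forall p \near p0, S p \in unitmx.
  exact: (phi_continuous (x := p0) (tau_unit y0)).
have uT : \forall p \near p0, T p \in unitmx.
  exact: (snd_continuous _ (tau_unit x0)).
have cg : T p *m g p.2 *m (T p)^T @[p --> p0] --> g x0.
  exact: (@cvg_at_comp _ _ _ (@snd R G)
    (fun x => tau x0 x *m g x *m (tau x0 x)^T) p0 x0).
have cg' : S p *m g (phi p.1 p.2) *m (S p)^T @[p --> p0] --> g y0.
  exact: (@cvg_at_comp _ _ _ (fun p : R * G => phi p.1 p.2)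
    (fun y => tau y0 y *m g y *m (tau y0 y)^T) p0 y0 (g y0)
    (phi_continuous (x := p0)) (@g_continuous y0)).
have cPi : T p *m Pi p.2 *m invmx (T p) @[p --> p0] --> Pi x0.
  exact: (@cvg_at_comp _ _ _ (@snd R G)
    (fun x => tau x0 x *m Pi x *m invmx (tau x0 x)) p0 x0).
have cD : T p *m D p.1 p.2 *m invmx (S p) @[p --> p0] --> D p0.1 x0.
  exact: D_continuous.
pose A p := (T p *m Pi p.2 *m invmx (T p)) *m (T p *m D p.1 p.2 *m invmx (S p)).
have cA : A p @[p --> p0] --> Pi x0 *m D p0.1 x0 by exact: cvg_mulmx.
have : hsnorm (T p *m g p.2 *m (T p)^T) (S p *m g (phi p.1 p.2) *m (S p)^T) (A p)
    @[p --> p0] --> hsflow p0.1 x0.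
  apply: cvg_trace; apply: cvg_mulmx; first by apply: cvg_invmx => //; exact: posdef_unit.
  by apply: cvg_mulmx; [exact: cvg_mulmx|exact: cvg_trmx].
apply: cvg_trans; apply: near_eq_cvg; near=> p.
have uSp : S p \in unitmx by near: p.
have uTp : T p \in unitmx by near: p.
rewrite /A !mulmxA mulmxKV// -(mulmxA (T p) (Pi p.2)) hsnorm_conj//.
exact: posdef_unit.
Unshelve. all: by end_near. Qed.

Lemma hsflow_gt0 t x : Pi x != 0 -> 0 < hsflow t x.
Proof.
move=> P0; have [i Hi] : exists i, row i (Pi x *m D t x) != 0.
  apply/existsP; apply: contra_neqT P0 => /existsPn H.
  rewrite -[Pi x](mulmxK (D_unit t x)).
  rewrite (_ : Pi x *m D t x = 0) ?mul0mx//; apply/row_matrixP => i.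
  by rewrite row0; apply/eqP; rewrite -[_ == _]negbK H.
by apply: (@hsnorm_gt0 _ _ _ _ _ (delta_mx 0 i)); rewrite -?rowE.
Qed.

(** The Hilbert-Schmidt norm exceeds the operator norm on the subbundle by a
    factor that depends only on m and on the norms of the projections Pi x,
    and these are bounded by compactness. *)
Lemma hsflow_bound : exists2 K, 0 < K & forall t x c, 0 <= c ->
  (forall v, v *m Pi x = v -> qform (g (phi t x)) (v *m D t x) <= c * qform (g x) v) ->
  hsflow t x <= K * c.
Proof.
have [K HK] : exists K, forall x, [set: G] x -> `|hsflow 0 x| <= K.
  by apply: compact_bounded => //; exact: (continuous_pair2 hsflow_continuous).
exists ((`|K| + 1) * (m%:R + 1)) => [|t x c c0 H].
  by rewrite mulr_gt0// ltr_wpDl.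
apply: (@le_trans _ _ (c * (`|K| + 1) * m%:R)); last first.
  rewrite [leLHS](_ : _ = (`|K| + 1) * m%:R * c); last by ring.
  by rewrite ler_wpM2r// ler_wpM2l// ?addr_ge0// lerDl.
apply: hsnorm_le => // v; rewrite mulmxA.
apply: le_trans (H (v *m Pi x) _) _; first by rewrite -mulmxA Pi_idem.
rewrite -mulrA ler_wpM2l//.
have := qform_hsnorm (Pi x *m D 0 x) v (g_posdef x) (g_posdef (phi 0 x)).
rewrite {1}phi0 D0 mulmx1 => /le_trans; apply.
rewrite ler_wpM2r ?qform_ge0// -[X in hsnorm _ _ X]mulmx1 -(D0 x).
rewrite (le_trans (ler_norm _))// (le_trans (HK x I))//.
by rewrite (le_trans (ler_norm _))// lerDl.
Qed.

Lemma qform_hsflow t x v : v *m Pi x = v ->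
  qform (g (phi t x)) (v *m D t x) <= hsflow t x * qform (g x) v.
Proof.
by move=> {1}<-; rewrite -mulmxA; exact: qform_hsnorm.
Qed.

End HSCocycle.


Section Splitting.
Variables (g E F : G -> 'M[R]_m).
Hypothesis g_posdef : forall x, posdef (g x).
Hypothesis g_continuous : continuous_form g.
Hypothesis EF_full : forall x, row_full (E x + F x)%MS.
Hypothesis EF_cap : forall x, (E x :&: F x)%MS = 0.
Hypothesis E_neq0 : forall x, E x != 0.
Hypothesis F_neq0 : forall x, F x != 0.
Hypothesis E_inv : forall t x, (E x *m D t x == E (phi t x))%MS.
Hypothesis F_inv : forall t x, (F x *m D t x == F (phi t x))%MS.

Implicit Types (P Q : 'M[R]_m).

Definition local_frame x0 k (W : G -> 'M[R]_m) (e : G -> 'M[R]_(k, m)) :=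
  e x @[x --> x0] --> e x0 /\
  \forall x \near x0, row_free (e x) /\ (e x *m tau x0 x == W x)%MS.

Hypothesis E_frame : forall x0, exists k e, @local_frame x0 k E e.
Hypothesis F_frame : forall x0, exists k e, @local_frame x0 k F e.

Definition PiE x := proj_mx (E x) (F x).
Definition PiF x := proj_mx (F x) (E x).

Lemma PiDE x : PiE x + PiF x = 1%:M.
Proof.
by rewrite -[LHS]mul1mx mulmxDr add_proj_mx// submx_full.
Qed.

Lemma FE_cap x : (F x :&: E x)%MS = 0.
Proof. by rewrite capmxC EF_cap. Qed.

Lemma PiE_id n x (v : 'M_(n, m)) : (v <= E x)%MS -> v *m PiE x = v.
Proof. exact: proj_mx_id. Qed.

Lemma PiF_id n x (v : 'M_(n, m)) : (v <= F x)%MS -> v *m PiF x = v.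
Proof. exact: (proj_mx_id (FE_cap x)). Qed.

Lemma PiE_0 n x (v : 'M_(n, m)) : (v <= F x)%MS -> v *m PiE x = 0.
Proof. exact: proj_mx_0. Qed.

Lemma PiF_0 n x (v : 'M_(n, m)) : (v <= E x)%MS -> v *m PiF x = 0.
Proof. exact: (proj_mx_0 (FE_cap x)). Qed.

Lemma PiE_sub n x (v : 'M_(n, m)) : (v *m PiE x <= E x)%MS.
Proof. exact: proj_mx_sub. Qed.

Lemma PiF_sub n x (v : 'M_(n, m)) : (v *m PiF x <= F x)%MS.
Proof. exact: proj_mx_sub. Qed.

Lemma PiE_sub1 x : (PiE x <= E x)%MS.
Proof. by rewrite -[PiE x]mul1mx PiE_sub. Qed.

Lemma PiF_sub1 x : (PiF x <= F x)%MS.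
Proof. by rewrite -[PiF x]mul1mx PiF_sub. Qed.

Lemma PiE_idem x : PiE x *m PiE x = PiE x.
Proof. exact/PiE_id/PiE_sub1. Qed.

Lemma PiF_idem x : PiF x *m PiF x = PiF x.
Proof. exact/PiF_id/PiF_sub1. Qed.

Lemma E_pushed n t x (v : 'M_(n, m)) :
  (v <= E x)%MS -> (v *m D t x <= E (phi t x))%MS.
Proof. by move=> vE; rewrite -(eqmxP (E_inv t x)) submxMr. Qed.

Lemma F_pushed n t x (v : 'M_(n, m)) :
  (v <= F x)%MS -> (v *m D t x <= F (phi t x))%MS.
Proof. by move=> vF; rewrite -(eqmxP (F_inv t x)) submxMr. Qed.

Lemma PiE_equivariant t x : PiE x *m D t x = D t x *m PiE (phi t x).
Proof.
have -> : D t x *m PiE (phi t x) =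
    PiE x *m D t x *m PiE (phi t x) + PiF x *m D t x *m PiE (phi t x).
  by rewrite -!mulmxDl PiDE mul1mx.
have -> := PiE_id (E_pushed t (PiE_sub1 x)).
by have -> := PiE_0 (F_pushed t (PiF_sub1 x)); rewrite addr0.
Qed.

Lemma PiF_equivariant t x : PiF x *m D t x = D t x *m PiF (phi t x).
Proof.
have -> : D t x *m PiF (phi t x) =
    PiE x *m D t x *m PiF (phi t x) + PiF x *m D t x *m PiF (phi t x).
  by rewrite -!mulmxDl PiDE mul1mx.
have -> := PiF_id (F_pushed t (PiF_sub1 x)).
by have -> := PiF_0 (E_pushed t (PiE_sub1 x)); rewrite add0r.
Qed.

Lemma proj_frame_continuous (A B : G -> 'M[R]_m) x0 k l
    (e : G -> 'M[R]_(k, m)) (f : G -> 'M[R]_(l, m)) :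
  (forall x, row_full (A x + B x)%MS) -> (forall x, (A x :&: B x)%MS = 0) ->
  local_frame x0 A e -> local_frame x0 B f ->
  tau x0 x *m proj_mx (A x) (B x) *m invmx (tau x0 x) @[x --> x0] -->
    proj_mx (A x0) (B x0).
Proof.
move=> full cap [ce eA] [cf fB].
have formula x : tau x0 x \in unitmx -> (e x *m tau x0 x == A x)%MS ->
    (f x *m tau x0 x == B x)%MS ->
    row_full (e x + f x)%MS /\
    tau x0 x *m proj_mx (A x) (B x) *m invmx (tau x0 x) =
    invmx ((e x)^T *m e x + (f x)^T *m f x) *m ((e x)^T *m e x).
  move=> u eAx fBx.
  have full' : row_full (e x + f x)%MS.
    rewrite /row_full -(@mxrankMfree _ _ _ _ (e x + f x)%MS (tau x0 x)).
      by rewrite addsmxMr (adds_eqmx (eqmxP eAx) (eqmxP fBx)); exact: full.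
    by rewrite row_free_unit.
  have eA' : (e x *m tau x0 x <= A x)%MS by rewrite (eqmxP eAx).
  have fB' : (f x *m tau x0 x <= B x)%MS by rewrite (eqmxP fBx).
  have e1 := proj_mx_id (cap x) eA'; have f0 := proj_mx_0 (cap x) fB'.
  split => //; move: (proj_mx _ _) e1 f0 => Q e1 f0.
  apply: proj_frames => //; first by rewrite !mulmxA e1 mulmxK.
  by rewrite !mulmxA f0 mul0mx.
have [_ eA0] := nbhs_singleton eA; have [_ fB0] := nbhs_singleton fB.
have u0 := nbhs_singleton (tau_unit x0).
have [full0 <-] : row_full (e x0 + f x0)%MS /\
    invmx ((e x0)^T *m e x0 + (f x0)^T *m f x0) *m ((e x0)^T *m e x0) =
    proj_mx (A x0) (B x0).
  have [full0 <-] := formula x0 u0 eA0 fB0.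
  by rewrite tau1 mul1mx invmx1 mulmx1.
have lim : invmx ((e x)^T *m e x + (f x)^T *m f x) *m ((e x)^T *m e x) @[x --> x0]
    --> invmx ((e x0)^T *m e x0 + (f x0)^T *m f x0) *m ((e x0)^T *m e x0).
  have cee : (e x)^T *m e x @[x --> x0] --> (e x0)^T *m e x0.
    by apply: cvg_mulmx => //; exact: cvg_trmx.
  have cff : (f x)^T *m f x @[x --> x0] --> (f x0)^T *m f x0.
    by apply: cvg_mulmx => //; exact: cvg_trmx.
  apply: cvg_mulmx => //; apply: cvg_invmx; first exact: frames_gram_unit.
  exact: cvgD.
apply: cvg_trans lim; apply: near_eq_cvg; near=> x => /=.
have ux : tau x0 x \in unitmx by near: x; exact: tau_unit.
have [_ eAx] : row_free (e x) /\ (e x *m tau x0 x == A x)%MS by near: x.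
have [_ fBx] : row_free (f x) /\ (f x *m tau x0 x == B x)%MS by near: x.
by have [_ ->] := formula x ux eAx fBx.
Unshelve. all: by end_near. Qed.

Lemma PiE_continuous : continuous_endo PiE.
Proof.
move=> x0; have [k [e eE]] := E_frame x0; have [l [f fF]] := F_frame x0.
exact: (proj_frame_continuous EF_full EF_cap eE fF).
Qed.

Lemma PiF_continuous : continuous_endo PiF.
Proof.
move=> x0; have [k [e eE]] := E_frame x0; have [l [f fF]] := F_frame x0.
have full x : row_full (F x + E x)%MS by rewrite /row_full addsmxC; exact: EF_full.
exact: (proj_frame_continuous full FE_cap fF eE).
Qed.

(** The square of the volume that P gives to a parallelepiped in F x, relative
    to the volume that g gives to it. *)
Definition volratio x P :=
  gramdet P (row_base (F x)) / gramdet (g x) (row_base (F x)).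

Lemma baseF_free x : row_free (row_base (F x)).
Proof. exact: row_base_free. Qed.

Lemma baseF_sub x n (v : 'M_(n, m)) : (v <= row_base (F x) -> v <= F x)%MS.
Proof. by rewrite eq_row_base. Qed.

Lemma gramdet_g_gt0 x : 0 < gramdet (g x) (row_base (F x)).
Proof. by apply: gramdet_gt0 => //; exact: baseF_free. Qed.

Lemma volratioE x k (A : 'M_(k, m)) P : row_free A -> (A == F x)%MS ->
  volratio x P = gramdet P A / gramdet (g x) A.
Proof.
move=> fA AF; apply/eqP.
have AB : (A == row_base (F x))%MS.
  apply/eqmxP; apply: eqmx_trans (eqmxP AF) _.
  exact: eqmx_sym (eq_row_base (F x)).
have g0 : gramdet (g x) (row_base (F x)) != 0 by rewrite gt_eqF// gramdet_g_gt0.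
have gA0 : gramdet (g x) A != 0 by rewrite gt_eqF// gramdet_gt0.
rewrite eqr_div//; apply/eqP.
by rewrite (gramdet_basis P (g x) fA (baseF_free x) AB) mulrC.
Qed.

Lemma volratio_gt0 x P : posdef P -> 0 < volratio x P.
Proof.
by move=> pP; rewrite divr_gt0 ?gramdet_g_gt0// gramdet_gt0// baseF_free.
Qed.

Lemma volratio_g x : volratio x (g x) = 1.
Proof. by rewrite /volratio divff// gt_eqF// gramdet_g_gt0. Qed.

Lemma volratioZ x P c :
  volratio x (c *: P) = c ^+ \rank (F x) * volratio x P.
Proof. by rewrite /volratio gramdetZ mulrA. Qed.

Lemma le_volratio x P Q : posdef Q -> posdef P ->
  (forall v, (v <= F x)%MS -> qform Q v <= qform P v) ->
  volratio x Q <= volratio x P.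
Proof.
move=> pQ [sP _] QP; rewrite ler_pM2r ?invr_gt0 ?gramdet_g_gt0//.
by apply: le_gramdet => // [|v /baseF_sub/QP//]; exact: baseF_free.
Qed.

(** The multiplicativity of determinants: passing from g to h changes the volume
    growth by a coboundary. *)
Lemma volratio_pullback t x (h : G -> 'M[R]_m) :
  volratio x (pullback t h x) =
  volratio (phi t x) (h (phi t x)) * volratio x (pullback t g x).
Proof.
have fA : row_free (row_base (F x) *m D t x).
  rewrite /row_free mxrankMfree ?row_free_unit ?D_unit//.
  exact: baseF_free.
have AF : (row_base (F x) *m D t x == F (phi t x))%MS.
  apply/eqmxP; apply: eqmx_trans (eqmxP (F_inv t x)).
  by apply: eqmxMr; exact: eq_row_base.
have push (k : G -> 'M[R]_m) : gramdet (pullback t k x) (row_base (F x)) =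
    gramdet (k (phi t x)) (row_base (F x) *m D t x).
  by rewrite /gramdet; move: (row_base _) => B; rewrite trmx_mul !mulmxA.
rewrite (volratioE _ fA AF) /volratio !push.
by rewrite mulrA divfK// gt_eqF// gramdet_gt0.
Qed.

Lemma volratio_cvg {T : Type} (Fl : set_system T) {FF : Filter Fl} (y : T -> G)
    (P : T -> 'M[R]_m) x0 P0 :
  y p @[p --> Fl] --> x0 ->
  tau x0 (y p) *m P p *m (tau x0 (y p))^T @[p --> Fl] --> P0 ->
  volratio (y p) (P p) @[p --> Fl] --> volratio x0 P0.
Proof.
move=> cy cP; have [k [e [ce eF]]] := F_frame x0.
have cyg : tau x0 (y p) *m g (y p) *m (tau x0 (y p))^T @[p --> Fl] --> g x0.
  by move=> V /g_continuous; exact: cy.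
have cye : e (y p) @[p --> Fl] --> e x0 by move=> V /ce; exact: cy.
have lim (Q : T -> 'M[R]_m) Q0 :
    tau x0 (y p) *m Q p *m (tau x0 (y p))^T @[p --> Fl] --> Q0 ->
    gramdet (Q p) (e (y p) *m tau x0 (y p)) @[p --> Fl] --> gramdet Q0 (e x0).
  move=> cQ; have : \det (e (y p) *m (tau x0 (y p) *m Q p *m (tau x0 (y p))^T)
      *m (e (y p))^T) @[p --> Fl] --> gramdet Q0 (e x0).
    by apply: cvg_det; apply: cvg_mulmx; [exact: cvg_mulmx|exact: cvg_trmx].
  have -> // : (fun p => gramdet (Q p) (e (y p) *m tau x0 (y p))) =
    (fun p => \det (e (y p) *m (tau x0 (y p) *m Q p *m (tau x0 (y p))^T)
      *m (e (y p))^T)).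
  by apply/funext => p; rewrite /gramdet trmx_mul !mulmxA.
have [fe0 eF0] := nbhs_singleton eF.
rewrite tau1 mulmx1 in eF0.
rewrite (volratioE _ fe0 eF0).
have : gramdet (P p) (e (y p) *m tau x0 (y p)) /
    gramdet (g (y p)) (e (y p) *m tau x0 (y p)) @[p --> Fl] -->
    gramdet P0 (e x0) / gramdet (g x0) (e x0).
  apply: cvgM; first exact: lim.
  by apply: cvgV; [rewrite gt_eqF// gramdet_gt0|exact: lim].
apply: cvg_trans; apply: near_eq_cvg.
have : \forall p \near Fl, (row_free (e (y p)) /\
    (e (y p) *m tau x0 (y p) == F (y p))%MS) /\ tau x0 (y p) \in unitmx.
  exact: cy (filterI eF (tau_unit x0)).
apply: filterS => p [[fe eFp] u]; apply/esym/volratioE => //.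
by rewrite /row_free mxrankMfree// row_free_unit.
Qed.

(** An additive weight c turns the pullback by D t into a translation of the
    window of integration by t, up to the scalar factor exp (- c t x). *)
Lemma pullback_mxint c t x (p q : G -> R) :
  continuous (fun p : R * G => c p.1 p.2) ->
  (forall s r y, c (s + r) y = c s y + c r (phi s y)) ->
  pullback t (fun y => mxint (weighted c g ^~ y) (p y) (q y)) x =
  expR (- c t x) *:
    mxint (weighted c g ^~ x) (p (phi t x) + t) (q (phi t x) + t).
Proof.
move=> cc cD; have cw y := @weighted_continuous_time c g cc g_continuous y.
rewrite /pullback mul_mxint//.
have -> : (fun s => D t x *m weighted c g s (phi t x) *m (D t x)^T) =
    (fun s => expR (- c t x) *: weighted c g (s + t) x).
  apply/funext => s; rewrite /weighted -scalemxAr -scalemxAl scalerA.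
  rewrite [s + t]addrC cD -expRD addrA addNr add0r.
  by rewrite /pullback DD phiD trmx_mul !mulmxA.
apply/matrixP => i j; rewrite !mxE -int_shift; last exact: continuous_entry.
rewrite -intZ; last first.
  move=> s; apply: (@continuous_comp _ _ _ (fun s => s + t)
    (fun s => weighted c g s x i j)).
    by apply: cvgD; [exact: cvg_id|exact: cvg_cst].
  exact: (continuous_entry (cw x)).
by congr int; apply/funext => s; rewrite mxE.
Qed.

(** A metric for E whose growth is bounded by the integral of a along orbits, with
    no multiplicative constant, given that such a bound holds at the single
    time L: the pulled-back metrics, divided by the bound, do not increase over
    time L, so their integral over a window of length L decreases when the
    window moves forward. *)
Section Contracting.
Variables (a : G -> R) (L : R).
Hypothesis a_continuous : continuous a.
Hypothesis L_gt0 : 0 < L.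
Hypothesis a_bound : forall x, hsflow g PiE L x <= expR (orbit_int phi a L x).

Definition rateE t x := - orbit_int phi a t x.

Definition metricE x := mxint (weighted rateE g ^~ x) 0 L.

Lemma rateE_continuous : continuous (fun p : R * G => rateE p.1 p.2).
Proof. by move=> p; apply: cvgN; exact: continuous_orbit_int. Qed.

Lemma rateE_add s t x : rateE (s + t) x = rateE s x + rateE t (phi s x).
Proof. by rewrite /rateE orbit_intD// opprD. Qed.

Lemma weightedE_time x : continuous (weighted rateE g ^~ x).
Proof. exact: (weighted_continuous_time rateE_continuous g_continuous). Qed.

Lemma metricE_posdef x : posdef (metricE x).
Proof.
apply: posdef_mxint => //; first exact: weightedE_time.
by move=> s; apply: posdefZ; [exact: expR_gt0|exact: posdef_pullback].
Qed.

Lemma metricE_continuous : continuous_form metricE.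
Proof.
move=> x0; apply: (mxint_weighted_continuous rateE_continuous g_continuous
  (a := cst 0) (b := cst L)); exact: cvg_cst.
Qed.

Lemma metricE_growth t x v : (v <= E x)%MS -> 0 <= t ->
  qform (metricE (phi t x)) (v *m D t x) <=
  expR (orbit_int phi a t x) * qform (metricE x) v.
Proof.
move=> vE t0; rewrite -(qform_pullback t metricE x v).
rewrite (pullback_mxint t x (cst 0) (cst L) rateE_continuous rateE_add).
rewrite qformZ opprK ler_pM2l ?expR_gt0// /metricE.
have cw := weightedE_time (x := x).
rewrite !qform_mxint ?[_ + t]addrC -?[t + 0]addrC//.
pose f s := qform (weighted rateE g s x) v.
have : int f t (t + L) <= int f 0 (0 + L).
  apply: window_antihomo => //; first exact: continuous_qform.
  move=> s; rewrite /f !qformZ rateE_add expRD -mulrA ler_pM2l ?expR_gt0//.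
  rewrite !qform_pullback phiD DD mulmxA.
  have vsE : (v *m D s x <= E (phi s x))%MS by exact: E_pushed.
  apply: (@le_trans _ _ (expR (rateE L (phi s x)) * (hsflow g PiE L (phi s x) *
      qform (g (phi s x)) (v *m D s x)))).
    by rewrite ler_pM2l ?expR_gt0//; apply: qform_hsflow => //; exact: PiE_id.
  rewrite mulrA ler_piMl ?qform_ge0//.
  by rewrite mulrC /rateE expRN ler_pdivrMr ?expR_gt0// mul1r.
by rewrite !add0r.
Qed.

End Contracting.

(** Dually, the metrics pulled back to F and multiplied by exp V do not decrease
    over time L, so that a window metric increases with the end point th of
    its window. The end point may then depend on the base point, and this
    freedom is used to prescribe the volume. *)
Section Expanding.
Variables (b : G -> R) (L eps : R).
Hypothesis b_continuous : continuous b.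
Hypothesis L_gt0 : 0 < L.
Hypothesis eps_gt0 : 0 < eps.
Hypothesis b_bound : forall x,
  hsflow g PiF (- L) (phi L x) <= expR (orbit_int phi b L x).

Local Notation V := (orbit_int phi b).

(** The factor exp (eps * th) makes the growth in th at least exponential, hence
    the volume strictly increasing and onto. *)
Definition windowF th x := expR (eps * th) *: mxint (weighted V g ^~ x) (th - L) th.

Lemma V_continuous : continuous (fun p : R * G => V p.1 p.2).
Proof. exact: continuous_orbit_int. Qed.

Lemma V_add s t x : V (s + t) x = V s x + V t (phi s x).
Proof. exact: orbit_intD. Qed.

Lemma weightedF_time x : continuous (weighted V g ^~ x).
Proof. exact: (weighted_continuous_time V_continuous g_continuous). Qed.

Lemma windowF_posdef th x : posdef (windowF th x).
Proof.
apply: posdefZ; first exact: expR_gt0.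
apply: posdef_mxint => [||s]; first by rewrite ltrBlDr ltrDl.
  exact: weightedF_time.
by apply: posdefZ; [exact: expR_gt0|exact: posdef_pullback].
Qed.

Lemma windowF_homo th th' x w : (w <= F x)%MS -> th <= th' ->
  expR (eps * (th' - th)) * qform (windowF th x) w <= qform (windowF th' x) w.
Proof.
move=> wF thth'; rewrite /windowF !qformZ mulrA -expRD.
rewrite mulrBr subrK ler_pM2l ?expR_gt0//.
have cw := weightedF_time (x := x).
rewrite !qform_mxint//.
pose f s := qform (weighted V g s x) w.
have : int f (th - L) (th - L + L) <= int f (th' - L) (th' - L + L).
  apply: window_homo; [exact: continuous_qform| |by rewrite lerD2r].
  move=> s; rewrite /f !qformZ V_add expRD -mulrA ler_pM2l ?expR_gt0//.
  rewrite !qform_pullback phiD DD mulmxA; set y := phi s x.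
  have uF : (w *m D s x <= F y)%MS by exact: F_pushed.
  set u := w *m D s x in uF *.
  have := @qform_hsflow g PiF g_posdef (- L) (phi L y) (u *m D L y).
  rewrite phi_V -(mulmxA u _ (D (- L) _)) D_V mulmx1 => /(_ _)/le_trans; apply.
    by apply: PiF_id; exact: F_pushed.
  by rewrite ler_wpM2r ?qform_ge0.
by rewrite !subrK.
Qed.

Lemma rankF_gt0 x : (0 < \rank (F x))%N.
Proof. by rewrite lt0n mxrank_eq0. Qed.

Lemma volratio_windowF_homo th th' x : th <= th' ->
  expR (eps * (th' - th)) * volratio x (windowF th x) <=
  volratio x (windowF th' x).
Proof.
move=> thth'; apply: (@le_trans _ _
    (volratio x (expR (eps * (th' - th)) *: windowF th x))).
  rewrite volratioZ ler_pM2r; last by apply: volratio_gt0; exact: windowF_posdef.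
  apply: ler_eXnr; first exact: rankF_gt0.
  by rewrite -expR0 ler_expR mulr_ge0 ?subr_ge0// ltW.
apply: le_volratio.
- by apply: posdefZ; [exact: expR_gt0|exact: windowF_posdef].
- exact: windowF_posdef.
- by move=> w wF; rewrite qformZ windowF_homo.
Qed.

Lemma volratio_windowF_lt th th' x : th < th' ->
  volratio x (windowF th x) < volratio x (windowF th' x).
Proof.
move=> thth'; apply: lt_le_trans (volratio_windowF_homo x (ltW thth')).
rewrite ltr_pMl; last by apply: volratio_gt0; exact: windowF_posdef.
by rewrite -expR0 ltr_expR mulr_gt0 ?subr_gt0.
Qed.

Lemma volratio_windowF_continuous_time x :
  continuous (fun th => volratio x (windowF th x)).
Proof.
move=> th0; apply: (@volratio_cvg _ _ _ (cst x)); first exact: cvg_cst.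
have -> : (fun th => tau x (cst x th) *m windowF th x *m (tau x (cst x th))^T) =
    windowF^~ x.
  by apply/funext => th; rewrite /cst tau1 trmx1 mulmx1 mul1mx.
apply: cvgZ.
  apply: (@continuous_comp _ _ _ (fun th : R => eps * th) expR).
    by apply: cvgM; [exact: cvg_cst|exact: cvg_id].
  exact: continuous_expR.
apply: (@mxint_cvg _ _ _ _ th0 (fun _ s => weighted V g s x) (fun th => th - L) id).
- by move=> _; exact: weightedF_time.
- move=> s; apply: (@cvg_at_comp (R * R)%type R _ snd (weighted V g ^~ x)
    (th0, s) s); first exact: cvg_snd.
  exact: weightedF_time.
- by apply: cvgB; [exact: cvg_id|exact: cvg_cst].
- exact: cvg_id.
Qed.

Lemma volratio_windowF_continuous th x0 :
  volratio x (windowF th x) @[x --> x0] --> volratio x0 (windowF th x0).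
Proof.
apply: volratio_cvg; first exact: cvg_id.
rewrite /windowF.
have -> : (fun x => tau x0 x *m (expR (eps * th) *:
      mxint (weighted V g ^~ x) (th - L) th) *m (tau x0 x)^T) =
    (fun x => expR (eps * th) *: (tau x0 x *m
      mxint (weighted V g ^~ x) (th - L) th *m (tau x0 x)^T)).
  by apply/funext => x; rewrite -scalemxAr -scalemxAl.
apply: cvgZ; first exact: cvg_cst.
apply: (mxint_weighted_continuous V_continuous g_continuous
  (a := cst (th - L)) (b := cst th)); exact: cvg_cst.
Qed.

(** Intermediate values between 0 and k, the end point at which the volume would
    be c if it grew exactly like exp (eps * th). *)
Lemma windowF_surj x c : 0 < c ->
  exists th, volratio x (windowF th x) = c.
Proof.
move=> c0; pose r th := volratio x (windowF th x).
have r0 th : 0 < r th by apply: volratio_gt0; exact: windowF_posdef.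
pose k := ln (c / r 0) / eps.
have ek : expR (eps * k) * r 0 = c.
  have cr : 0 < c / r 0 by exact: divr_gt0 c0 (r0 0).
  by rewrite mulrC /k mulrCA divff ?gt_eqF// mulr1 lnK// mulrCA divff ?gt_eqF ?r0// mulr1.
pose lo := Num.min 0 k; pose hi := Num.max 0 k.
have lohi : lo <= hi by rewrite le_max ge_min lexx.
have rlo : r lo <= c.
  rewrite -ek /lo; have [k0|/ltW k0] := leP 0 k.
    by rewrite ler_peMl ?(ltW (r0 _))// -expR0 ler_expR mulr_ge0// ltW.
  have := volratio_windowF_homo x k0; rewrite sub0r mulrN expRN -/(r _) -/(r _).
  by rewrite mulrC ler_pdivrMr ?expR_gt0// mulrC.
have rhi : c <= r hi.
  rewrite -ek /hi; have [k0|/ltW k0] := leP 0 k.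
    by have := volratio_windowF_homo x k0; rewrite subr0.
  rewrite ler_piMl ?(ltW (r0 _))// -expR0 ler_expR.
  by rewrite mulr_ge0_le0// ltW.
have [||th _ rth] := @IVT R r lo hi c lohi; last by exists th.
  exact/continuous_subspaceT/volratio_windowF_continuous_time.
have lr : r lo <= r hi by exact: le_trans rlo rhi.
by rewrite (min_l lr) (max_r lr) rlo.
Qed.

Section Target.
Variable l : G -> R.
Hypothesis l_continuous : continuous l.

Definition theta x :=
  xget 0 [set th | volratio x (windowF th x) = expR (l x)].

Lemma thetaP x : volratio x (windowF (theta x) x) = expR (l x).
Proof.
apply: (@xgetPex _ 0 [set th | volratio x (windowF th x) = expR (l x)]).
exact/windowF_surj/expR_gt0.
Qed.

(** Continuity of the root of a strictly increasing function that depends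
    continuously on x: the signs at theta x0 + e and theta x0 - e persist near
    x0. *)
Lemma theta_continuous : continuous theta.
Proof.
move=> x0; apply/cvgrPdist_lt => e e0.
have cl : expR (l x) @[x --> x0] --> expR (l x0).
  by apply: (@continuous_comp _ _ _ l expR); [exact: l_continuous|exact: continuous_expR].
pose dif th x := volratio x (windowF th x) - expR (l x).
have cdif th : dif th x @[x --> x0] --> dif th x0.
  by apply: cvgB => //; exact: volratio_windowF_continuous.
have up : \forall x \near x0, 0 < dif (theta x0 + e) x.
  apply: (cvgr_gt _ (cdif _)); rewrite /dif subr_gt0 -thetaP.
  by apply: volratio_windowF_lt; rewrite ltrDl.
have lo : \forall x \near x0, dif (theta x0 - e) x < 0.
  apply: (cvgr_lt _ (cdif _)); rewrite /dif subr_lt0 -thetaP.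
  by apply: volratio_windowF_lt; rewrite ltrBlDr ltrDl.
have inj x th th' : volratio x (windowF th x) < volratio x (windowF th' x) ->
    th < th'.
  move=> H; rewrite ltNge le_eqVlt; apply/negP => /orP[/eqP e1|/(volratio_windowF_lt x)].
    by rewrite e1 ltxx in H.
  by move=> /(lt_trans H); rewrite ltxx.
near=> x.
have : 0 < dif (theta x0 + e) x by near: x.
rewrite /dif subr_gt0 -thetaP => /inj h1.
have : dif (theta x0 - e) x < 0 by near: x.
rewrite /dif subr_lt0 -thetaP => /inj h2.
by rewrite ltr_norml; apply/andP; split; lra.
Unshelve. all: by end_near. Qed.

Definition metricF x := windowF (theta x) x.

Lemma metricF_posdef x : posdef (metricF x).
Proof. exact: windowF_posdef. Qed.

Lemma metricF_continuous : continuous_form metricF.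
Proof.
move=> x0; rewrite /metricF /windowF.
have -> : (fun x => tau x0 x *m (expR (eps * theta x) *:
      mxint (weighted V g ^~ x) (theta x - L) (theta x)) *m (tau x0 x)^T) =
    (fun x => expR (eps * theta x) *: (tau x0 x *m
      mxint (weighted V g ^~ x) (theta x - L) (theta x) *m (tau x0 x)^T)).
  by apply/funext => x; rewrite -scalemxAr -scalemxAl.
apply: cvgZ.
  apply: (@continuous_comp _ _ _ (fun x => eps * theta x) expR).
    by apply: cvgM; [exact: cvg_cst|exact: theta_continuous].
  exact: continuous_expR.
apply: (mxint_weighted_continuous V_continuous g_continuous
  (a := fun x => theta x - L) (b := theta)); last exact: theta_continuous.
by apply: cvgB; [exact: theta_continuous|exact: cvg_cst].
Qed.

Lemma volratio_metricF x : volratio x (metricF x) = expR (l x).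
Proof. exact: thetaP. Qed.

Lemma pullback_metricF t x : pullback t metricF x =
  expR (- (V t x + eps * t)) *: windowF (theta (phi t x) + t) x.
Proof.
rewrite /pullback {1}/metricF {1}/windowF -scalemxAr -scalemxAl.
have := pullback_mxint t x (fun y => theta y - L) theta V_continuous V_add.
rewrite /pullback => ->; rewrite /windowF !scalerA -!expRD addrAC.
by congr (expR _ *: _); ring.
Qed.

Section Growth.
Variable delta : G -> R.
Hypothesis delta_continuous : continuous delta.
Hypothesis l_cocycle : forall t x,
  volratio x (pullback t g x) * expR (l (phi t x)) =
  expR (l x + orbit_int phi delta t x).
Hypothesis delta_b : forall x, 0 <= (\rank (F x))%:R * b x + delta x.

Lemma rankF_phi t x : \rank (F (phi t x)) = \rank (F x).
Proof.
by rewrite -(eqmxP (F_inv t x)) mxrankMfree// row_free_unit D_unit.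
Qed.

Lemma volratio_pullback_metricF t x :
  volratio x (pullback t metricF x) = expR (l x + orbit_int phi delta t x).
Proof. by rewrite volratio_pullback volratio_metricF mulrC l_cocycle. Qed.

(** The window of phi t x, seen from x, ends at theta (phi t x) + t. Since volumes
    increase with the end point it suffices to compare volumes, and there the
    claim reduces to the integral of rank F * b + delta being nonnegative:
    volume cannot shrink faster than all lengths do. *)
Lemma theta_homo t x : 0 <= t -> theta x <= theta (phi t x) + t.
Proof.
move=> t0; rewrite leNgt; apply/negP => /(volratio_windowF_lt x).
rewrite thetaP; apply/negP; rewrite -leNgt.
have := volratio_pullback_metricF t x; rewrite pullback_metricF volratioZ.
set k := \rank (F x).
rewrite -expRM_natl mulrN expRN => H.
have -> : volratio x (windowF (theta (phi t x) + t) x) =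
    expR (k%:R * (V t x + eps * t)) * expR (l x + orbit_int phi delta t x).
  by rewrite -H mulrA divff ?mul1r// gt_eqF// expR_gt0.
rewrite -expRD ler_expR.
suff : 0 <= k%:R * V t x + orbit_int phi delta t x.
  have et : 0 <= k%:R * (eps * t) by rewrite !mulr_ge0// ltW.
  by move=> kV; rewrite mulrDr addrCA lerDl addrAC addr_ge0.
have cd : continuous (fun s => delta (phi s x)).
  exact: (@continuous_orbit R G phi phi_continuous).
have cb : continuous (fun s => k%:R * b (phi s x)).
  move=> s; apply: cvgM; first exact: cvg_cst.
  by apply: (@continuous_orbit R G phi phi_continuous b x).
rewrite -orbit_int_scale// /orbit_int -intD//.
apply: int_ge0 => // [s|s _]; first by apply: cvgD; [exact: cb|exact: cd].
by rewrite /k -(rankF_phi s x).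
Qed.

Lemma metricF_growth t x w : (w <= F x)%MS -> 0 <= t ->
  qform (metricF x) w <=
  expR (V t x + eps * t) * qform (metricF (phi t x)) (w *m D t x).
Proof.
move=> wF t0; rewrite -(qform_pullback t metricF x w) pullback_metricF.
rewrite (qformZ _ (windowF (theta (phi t x) + t) x)).
rewrite expRN mulrA divff ?gt_eqF ?expR_gt0// mul1r.
apply: le_trans (windowF_homo wF (theta_homo x t0)).
rewrite ler_peMl ?qform_ge0//; first exact: metricF_posdef.
by rewrite -expR0 ler_expR mulr_ge0 ?(ltW eps_gt0)// subr_ge0 theta_homo.
Qed.

End Growth.
End Target.
End Expanding.

(** The two logarithmic growth rates of squared norms are subadditive, and that of
    squared volumes is additive. *)
Section Adapted.
Variables (C lam K lam' Cd lamd : R).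
Hypothesis C_gt0 : 0 < C.
Hypothesis lam_gt0 : 0 < lam.
Hypothesis E_contracted : forall x t v, 0 <= t -> (v <= E x)%MS ->
  qform (g (phi t x)) (v *m D t x) <= C * expR (- lam * t) * qform (g x) v.
Hypothesis K_gt0 : 0 < K.
Hypothesis lam'_gt0 : 0 < lam'.
Hypothesis EF_dominated : forall x t, 0 < t -> exists p q,
  [/\ 0 <= p, 0 <= q, p * q <= K * expR (- lam' * t),
   forall v, (v <= E x)%MS ->
     qform (g (phi t x)) (v *m D t x) <= p * qform (g x) v &
   forall w, (w <= F (phi t x))%MS ->
     qform (g x) (w *m D (- t) (phi t x)) <= q * qform (g (phi t x)) w].
Hypothesis Cd_gt0 : 0 < Cd.
Hypothesis lamd_gt0 : 0 < lamd.
Hypothesis F_expanding : forall x t, 0 < t ->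
  Cd * expR (lamd * t) <= volratio x (pullback t g x).

Definition growthE t x := ln (hsflow g PiE t x).
Definition growthF t x := ln (hsflow g PiF (- t) (phi t x)).
Definition growth_vol t x := ln (volratio x (pullback t g x)).

Lemma PiE_neq0 x : PiE x != 0.
Proof.
apply: contraNneq (E_neq0 x) => P0.
by rewrite -(PiE_id (submx_refl (E x))) P0 mulmx0.
Qed.

Lemma PiF_neq0 x : PiF x != 0.
Proof.
apply: contraNneq (F_neq0 x) => P0.
by rewrite -(PiF_id (submx_refl (F x))) P0 mulmx0.
Qed.

Lemma hsE_gt0 t x : 0 < hsflow g PiE t x.
Proof. by apply: hsflow_gt0 => //; exact: PiE_neq0. Qed.

Lemma hsF_gt0 t x : 0 < hsflow g PiF t x.
Proof. by apply: hsflow_gt0 => //; exact: PiF_neq0. Qed.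

Lemma hsE_continuous : continuous (fun p : R * G => hsflow g PiE p.1 p.2).
Proof. exact: (hsflow_continuous g_posdef g_continuous PiE_continuous). Qed.

Lemma hsF_continuous : continuous (fun p : R * G => hsflow g PiF p.1 p.2).
Proof. exact: (hsflow_continuous g_posdef g_continuous PiF_continuous). Qed.

Lemma growthE_continuous : continuous (fun p : R * G => growthE p.1 p.2).
Proof.
move=> p; apply: (@continuous_comp _ _ _
  (fun p : R * G => hsflow g PiE p.1 p.2) (@ln R)).
  exact: hsE_continuous.
exact/continuous_ln/hsE_gt0.
Qed.

Lemma growthF_continuous : continuous (fun p : R * G => growthF p.1 p.2).
Proof.
move=> p; apply: (@continuous_comp _ _ _
  (fun p : R * G => hsflow g PiF (- p.1) (phi p.1 p.2)) (@ln R)).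
  apply: (continuous_comp2 (f := hsflow g PiF) hsF_continuous).
    by move=> q; apply: cvgN; exact: cvg_fst.
  exact: phi_continuous.
exact/continuous_ln/hsF_gt0.
Qed.

Lemma growthE_sub s t x : growthE (s + t) x <= growthE s x + growthE t (phi s x).
Proof.
rewrite /growthE -lnM ?posrE ?hsE_gt0// ler_ln ?posrE ?mulr_gt0 ?hsE_gt0//.
exact: (hsflow_submul g_posdef PiE_idem PiE_equivariant s t x).
Qed.

Lemma growthF_sub s t x : growthF (s + t) x <= growthF s x + growthF t (phi s x).
Proof.
rewrite /growthF -lnM ?posrE ?hsF_gt0// ler_ln ?posrE ?mulr_gt0 ?hsF_gt0//.
rewrite phiD; have := hsflow_submul g_posdef PiF_idem PiF_equivariant (- t) (- s)
  (phi t (phi s x)).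
by rewrite phi_V opprD [- s + _]addrC mulrC.
Qed.

Lemma pullback_g_posdef t x : posdef (pullback t g x).
Proof. exact: posdef_pullback. Qed.

Lemma growth_vol_continuous : continuous (fun p : R * G => growth_vol p.1 p.2).
Proof.
move=> p0; apply: (@continuous_comp _ _ _
  (fun p : R * G => volratio p.2 (pullback p.1 g p.2)) (@ln R)).
  apply: volratio_cvg; first exact: cvg_snd.
  exact: pullback_continuous.
exact/continuous_ln/volratio_gt0/pullback_g_posdef.
Qed.

Lemma growth_volD s t x :
  growth_vol (s + t) x = growth_vol s x + growth_vol t (phi s x).
Proof.
rewrite /growth_vol -lnM ?posrE; try exact/volratio_gt0/pullback_g_posdef.
congr ln; rewrite mulrC -(volratio_pullback s x (pullback t g)).
by congr volratio; rewrite /pullback DD phiD trmx_mul !mulmxA.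
Qed.

(** The constants C, K and Cd, and what is lost in passing to Hilbert-Schmidt norms,
    contribute bounded amounts to the logarithms, whereas the exponential rates
    contribute multiples of T. *)
Lemma large_time : exists T eps, [/\ 0 < T, 0 < eps,
  forall x, growthE T x <= - 3 * (eps * T),
  forall x, growthE T x + growthF T x <= - 4 * (eps * T) &
  forall x, eps * T <= growth_vol T x].
Proof.
have [KE KE0 HKE] := hsflow_bound g_posdef g_continuous PiE_continuous PiE_idem.
have [KF KF0 HKF] := hsflow_bound g_posdef g_continuous PiF_continuous PiF_idem.
have PE x v : v *m PiE x = v -> (v <= E x)%MS by move=> <-; exact: PiE_sub.
have PF x v : v *m PiF x = v -> (v <= F x)%MS by move=> <-; exact: PiF_sub.
pose A1 := ln (KE * C); pose A2 := ln (KE * KF * K); pose A3 := - ln Cd.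
pose mu := Num.min lam (Num.min lam' lamd).
have mu0 : 0 < mu by rewrite !lt_min lam_gt0 lam'_gt0.
have mu1 : mu <= lam by rewrite ge_min lexx.
have mu2 : mu <= lam' by rewrite !ge_min lexx orbT.
have mu3 : mu <= lamd by rewrite !ge_min lexx !orbT.
pose eps := mu / 8.
have eps0 : 0 < eps by rewrite divr_gt0.
pose T := (`|A1| + `|A2| + `|A3| + 1) / eps.
have T0 : 0 < T by rewrite divr_gt0// ltr_wpDl// !addr_ge0.
have eT : eps * T = `|A1| + `|A2| + `|A3| + 1.
  by rewrite /T mulrCA divff ?mulr1// gt_eqF.
have a1 := ler_norm A1; have a2 := ler_norm A2; have a3 := ler_norm A3.
have n1 := normr_ge0 A1; have n2 := normr_ge0 A2; have n3 := normr_ge0 A3.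
have muT : mu * T = 8 * (eps * T).
  by rewrite /eps; field.
have l1 : mu * T <= lam * T by rewrite ler_pM2r.
have l2 : mu * T <= lam' * T by rewrite ler_pM2r.
have l3 : mu * T <= lamd * T by rewrite ler_pM2r.
exists T, eps; split=> // x.
- have : growthE T x <= A1 + - lam * T.
    rewrite -[- lam * T]expRK -lnM ?posrE ?mulr_gt0 ?expR_gt0//.
    rewrite ler_ln ?posrE ?hsE_gt0 ?mulr_gt0 ?expR_gt0// -mulrA.
    apply: HKE => [|v /PE vE]; first by rewrite mulr_ge0 ?expR_ge0// ltW.
    by apply: E_contracted => //; exact: ltW.
  by rewrite mulNr; lra.
- have : growthE T x + growthF T x <= A2 + - lam' * T.
    have [p [q [p0 q0 pq Hp Hq]]] := EF_dominated x T0.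
    have K0 : 0 < KE * KF * K by rewrite !mulr_gt0.
    have e0 : 0 < expR (- lam' * T) by exact: expR_gt0.
    have -> : A2 + - lam' * T = ln (KE * KF * K * expR (- lam' * T)).
      by rewrite lnM// expRK.
    have hE0 := hsE_gt0 T x; have hF0 := hsF_gt0 (- T) (phi T x).
    rewrite /growthE /growthF -lnM// ler_ln ?posrE//; try exact: mulr_gt0.
    have hE : hsflow g PiE T x <= KE * p by apply: HKE => // v /PE/Hp.
    have hF : hsflow g PiF (- T) (phi T x) <= KF * q.
      by apply: HKF => // v /PF/Hq; rewrite phi_V.
    apply: (@le_trans _ _ (KE * p * (KF * q))).
      by apply: ler_pM => //; apply/ltW; [exact: hsE_gt0|exact: hsF_gt0].
    rewrite [leLHS](_ : _ = KE * KF * (p * q)); last by ring.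
    by rewrite -[leRHS]mulrA ler_pM2l// mulr_gt0.
  by rewrite mulNr; lra.
- have : - A3 + lamd * T <= growth_vol T x.
    have v0 := volratio_gt0 x (pullback_g_posdef T x).
    have e0 : 0 < expR (lamd * T) by exact: expR_gt0.
    have -> : - A3 + lamd * T = ln (Cd * expR (lamd * T)).
      by rewrite opprK lnM// expRK.
    by rewrite /growth_vol ler_ln ?posrE//; [exact: F_expanding|exact: mulr_gt0].
  by lra.
Qed.

(** D t does not shrink a vector of F by more than the norm of its inverse allows,
    so the pulled-back metric is bounded below by a multiple of g on F, and volume
    is monotone in the metric. *)
Lemma growth_vol_ge t x : - (\rank (F x))%:R * growthF t x <= growth_vol t x.
Proof.
have := @le_volratio x (pullback t g x) (expR (- growthF t x) *: g x).
rewrite volratioZ volratio_g mulr1 -expRM_natl mulrN -mulNr => H.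
rewrite -[leLHS]expRK /growth_vol ler_ln ?posrE ?expR_gt0//; last first.
  exact/volratio_gt0/pullback_g_posdef.
apply: H => [||w wF].
- by apply: posdefZ => //; exact: expR_gt0.
- exact: pullback_g_posdef.
rewrite qformZ qform_pullback expRN lnK ?posrE ?hsF_gt0//.
rewrite mulrC ler_pdivrMr ?hsF_gt0// mulrC.
have := @qform_hsflow g PiF g_posdef (- t) (phi t x) (w *m D t x).
rewrite phi_V -(mulmxA w _ (D (- t) _)) D_V mulmx1; apply.
by apply: PiF_id; exact: F_pushed.
Qed.

(** In the metric h the growth of E, the growth of the inverse on F and the volume
    growth of F (all squared) are controlled by the orbit integrals of a, b + eps
    and delta, where a <= - 2 eps, a + b <= - 2 eps and delta >= eps. *)
Theorem adapted_form : exists h eps,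
  [/\ 0 < eps, forall x, posdef (h x), continuous_form h &
   forall x t, 0 < t ->
     (exists p q, [/\ 0 <= p, 0 <= q, p * q <= expR (- eps * t),
       p <= expR (- eps * t) &
       (forall v, (v <= E x)%MS ->
         qform (h (phi t x)) (v *m D t x) <= p * qform (h x) v) /\
       (forall w, (w <= F x)%MS ->
         qform (h x) w <= q * qform (h (phi t x)) (w *m D t x))]) /\
     expR (eps * t) * gramdet (h x) (row_base (F x)) <=
       gramdet (pullback t h x) (row_base (F x))].
Proof.
have [T [eps [T0 eps0 HE HEF Hvol]]] := large_time.
(* adding eps to the time-T means absorbs, over a long time L, the constants C1
   and C2 of the comparison with orbit integrals *)
pose a x := growthE T x / T + eps; pose b x := growthF T x / T + eps.
have ca0 : continuous (growthE T) by exact: continuous_pair2 growthE_continuous.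
have cb0 : continuous (growthF T) by exact: continuous_pair2 growthF_continuous.
have cd0 : continuous (growth_vol T) by exact: continuous_pair2 growth_vol_continuous.
have cdiv (f : G -> R) : continuous f -> continuous (fun x => f x / T).
  by move=> cf x; apply: cvgM; [exact: cf|exact: cvg_cst].
have caT := cdiv _ ca0; have cbT := cdiv _ cb0; have cdT := cdiv _ cd0.
have cst_c (c : R) : continuous (cst c : G -> R) by move=> x; exact: cvg_cst.
have ca : continuous a by move=> x; apply: cvgD; [exact: caT|exact: cst_c].
have cb : continuous b by move=> x; apply: cvgD; [exact: cbT|exact: cst_c].
have [C1 HC1] := subadditive_average G_compact phiD phi_continuous
  growthE_continuous growthE_sub T0.
have [C2 HC2] := subadditive_average G_compact phiD phi_continuous
  growthF_continuous growthF_sub T0.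
pose n := Num.bound ((`|C1| + `|C2|) / (eps * T)).
pose L := n%:R * T.
have eT0 : 0 < eps * T by rewrite mulr_gt0.
have nb : (`|C1| + `|C2|) / (eps * T) < n%:R.
  by apply: archi_boundP; rewrite divr_ge0 ?addr_ge0// ltW.
have nL : `|C1| + `|C2| < eps * L.
  by move: nb; rewrite ltr_pdivrMr// /L mulrCA.
have L0 : 0 < L.
  by rewrite -(pmulr_rgt0 _ eps0); apply: le_lt_trans nL; rewrite addr_ge0.
have addc (f : G -> R) x : continuous f ->
    orbit_int phi (fun y => f y + eps) L x = orbit_int phi f L x + eps * L.
  move=> cf; rewrite orbit_int_add//; last exact: cst_c.
  by rewrite (orbit_int_cst phi eps).
have aL x : hsflow g PiE L x <= expR (orbit_int phi a L x).
  rewrite -[leLHS]lnK ?posrE ?hsE_gt0// ler_expR addc//.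
  have := HC1 n x; rewrite -/L /growthE.
  by have := ler_norm C1; have := normr_ge0 C2; lra.
have bL x : hsflow g PiF (- L) (phi L x) <= expR (orbit_int phi b L x).
  rewrite -[leLHS]lnK ?posrE ?hsF_gt0// ler_expR addc//.
  have := HC2 n x; rewrite -/L /growthF.
  by have := ler_norm C2; have := normr_ge0 C1; lra.
pose delta x := growth_vol T x / T.
pose l x := int (growth_vol^~ x) 0 T / T.
have [cl Hl] := cocycle_average phi_continuous growth_vol_continuous growth_volD T0.
have Hl' t x : volratio x (pullback t g x) * expR (l (phi t x)) =
    expR (l x + orbit_int phi delta t x).
  rewrite -Hl expRD mulrC; congr (_ * _).
  by rewrite lnK// posrE; exact/volratio_gt0/pullback_g_posdef.
have db x : 0 <= (\rank (F x))%:R * b x + delta x.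
  rewrite /b /delta mulrDr mulrA addrAC -mulrDl addr_ge0//.
    rewrite divr_ge0 ?(ltW T0)//.
    by have := growth_vol_ge T x; rewrite mulNr lerNl -subr_ge0 opprK addrC addrC.
  by rewrite mulr_ge0// ltW.
have H4 t x : 0 < t ->
    orbit_int phi a t x + orbit_int phi b t x <= - (2 * eps) * t.
  move=> t0; rewrite -(orbit_int_add phi_continuous t x ca cb).
  rewrite -(orbit_int_cst phi _ t x).
  apply: (orbit_int_le phi_continuous _ _ (cst_c _) (ltW t0)) => [|y].
    by move=> y; apply: cvgD; [exact: ca|exact: cb].
  rewrite /a /b addrACA -mulrDl -lerBrDr ler_pdivrMr//.
  by apply: le_trans (HEF y) _; rewrite [leRHS](_ : _ = - 4 * (eps * T))// /cst; ring.
have H3 t x : 0 < t -> orbit_int phi a t x <= - (2 * eps) * t.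
  move=> t0; rewrite -(orbit_int_cst phi _ t x).
  apply: (orbit_int_le phi_continuous _ ca (cst_c _) (ltW t0)) => y.
  rewrite /a -lerBrDr ler_pdivrMr//.
  by apply: le_trans (HE y) _; rewrite [leRHS](_ : _ = - 3 * (eps * T))// /cst; ring.
pose M := metricE a L; pose N := metricF b L eps l.
have pM x : posdef (M x) by exact: (metricE_posdef ca L0).
have pN x : posdef (N x) by apply: metricF_posdef.
(* h makes E and F orthogonal *)
pose h x := PiE x *m M x *m (PiE x)^T + PiF x *m N x *m (PiF x)^T.
have qh x v : qform (h x) v = qform (M x) (v *m PiE x) + qform (N x) (v *m PiF x).
  by rewrite qformD !qform_congr.
have qhE x v : (v <= E x)%MS -> qform (h x) v = qform (M x) v.
  by move=> vE; rewrite qh (PiE_id vE) (PiF_0 vE) qform0 addr0.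
have qhF x v : (v <= F x)%MS -> qform (h x) v = qform (N x) v.
  by move=> vF; rewrite qh (PiE_0 vF) (PiF_id vF) qform0 add0r.
have ph x : posdef (h x).
  split; first by rewrite linearD /= !sym_congr//; [case: (pN x)|case: (pM x)].
  move=> v v0; rewrite qh lt_neqAle addr_ge0 ?qform_ge0// andbT eq_sym.
  apply: contraNneq v0 => /eqP; rewrite paddr_eq0 ?qform_ge0// => /andP[/eqP m0 /eqP n0].
  have z (P : 'M[R]_m) (w : 'rV[R]_m) : posdef P -> qform P w = 0 -> w = 0.
    by move=> [_ P0] w0; apply/eqP; apply: contra_eqT w0 => /P0; case: ltgtP.
  by rewrite -[v]mulmx1 -(PiDE x) mulmxDr (z _ _ (pM x) m0) (z _ _ (pN x) n0) addr0.
have ch : continuous_form h.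
  move=> x0; have cE := PiE_continuous (x0 := x0).
  have cF := PiF_continuous (x0 := x0).
  have cM : tau x0 x *m M x *m (tau x0 x)^T @[x --> x0] --> M x0.
    exact: (metricE_continuous ca).
  have cN : tau x0 x *m N x *m (tau x0 x)^T @[x --> x0] --> N x0.
    by apply: (metricF_continuous cb L0 eps0 bL cl).
  have lim (Pi P : G -> 'M[R]_m) :
      tau x0 x *m Pi x *m invmx (tau x0 x) @[x --> x0] --> Pi x0 ->
      tau x0 x *m P x *m (tau x0 x)^T @[x --> x0] --> P x0 ->
      tau x0 x *m (Pi x *m P x *m (Pi x)^T) *m (tau x0 x)^T @[x --> x0] -->
      Pi x0 *m P x0 *m (Pi x0)^T.
    move=> cPi cP.
    have : (tau x0 x *m Pi x *m invmx (tau x0 x)) *m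
        (tau x0 x *m P x *m (tau x0 x)^T) *m
        (tau x0 x *m Pi x *m invmx (tau x0 x))^T @[x --> x0] -->
        Pi x0 *m P x0 *m (Pi x0)^T.
      by apply: cvg_mulmx; [exact: cvg_mulmx|exact: cvg_trmx].
    apply: cvg_trans; apply: near_eq_cvg; near=> x => /=.
    have u : tau x0 x \in unitmx by near: x; exact: tau_unit.
    rewrite !trmx_mul !mulmxA mulmxKV// -(mulmxA _ (tau x0 x)^T).
    by rewrite -trmx_mul mulVmx// trmx1 mulmx1.
  have limD := cvgD (lim _ _ cE cM) (lim _ _ cF cN).
  have splith : (fun x => tau x0 x *m h x *m (tau x0 x)^T) =
      (fun x => tau x0 x *m (PiE x *m M x *m (PiE x)^T) *m (tau x0 x)^T +
                tau x0 x *m (PiF x *m N x *m (PiF x)^T) *m (tau x0 x)^T).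
    by apply/funext => x; rewrite /h mulmxDr mulmxDl.
  by rewrite splith; exact: limD.
exists h, eps; split => // x t t0; split; last first.
  have fB := baseF_free x.
  have pullF (k : G -> 'M[R]_m) v : (v <= row_base (F x))%MS ->
      qform (pullback t k x) v = qform (k (phi t x)) (v *m D t x) /\
      (v *m D t x <= F (phi t x))%MS.
    by move=> /baseF_sub vF; rewrite qform_pullback; split=> //; exact: F_pushed.
  have -> : gramdet (h x) (row_base (F x)) = gramdet (N x) (row_base (F x)).
    by apply: eq_gramdet => // v /baseF_sub/qhF.
  have -> : gramdet (pullback t h x) (row_base (F x)) =
      gramdet (pullback t N x) (row_base (F x)).
    apply: eq_gramdet => //; [exact: posdef_pullback|exact: posdef_pullback|].
    move=> v vB; have [-> vF] := pullF h v vB; have [-> _] := pullF N v vB.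
    by rewrite qhF.
  have := volratio_pullback_metricF cb L0 eps0 bL Hl' t x.
  have := volratio_metricF cb L0 eps0 bL l x.
  rewrite -/N /volratio => e1 e2.
  have g0 := gramdet_g_gt0 x.
  rewrite -(ler_pM2r (_ : 0 < (gramdet (g x) (row_base (F x)))^-1)) ?invr_gt0//.
  rewrite -mulrA e1 e2 -expRD ler_expR addrC lerD2l.
  rewrite -(orbit_int_cst phi eps t x).
  apply: (orbit_int_le phi_continuous _ (cst_c _) cdT (ltW t0)) => y.
  by rewrite /delta ler_pdivlMr.
exists (expR (orbit_int phi a t x)), (expR (orbit_int phi b t x + eps * t)).
have h4 := H4 t x t0; have h3 := H3 t x t0.
split; [exact: expR_ge0|exact: expR_ge0| | |split=> [v vE|w wF]].
- rewrite -expRD ler_expR addrA -lerBrDr.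
  by have -> : - eps * t - eps * t = - (2 * eps) * t by ring.
- rewrite ler_expR; apply: le_trans h3 _.
  by rewrite ler_pM2r// lerN2 ler_peMl ?ler1n// ltW.
- rewrite (qhE _ _ vE) (qhE _ _ (E_pushed t vE)).
  exact: (metricE_growth ca aL vE (ltW t0)).
- rewrite (qhF _ _ wF) (qhF _ _ (F_pushed t wF)).
  by apply: (metricF_growth cb L0 eps0 bL cdT Hl' db) => //; exact: ltW.
Unshelve. all: by end_near. Qed.

End Adapted.

End Splitting.
End Cocycle.

(** * Differentials relative to a set *)

Section DiffWithin.
Context {R : realType}.

Lemma norm_entry_le p q (A : 'M[R]_(p, q)) i j : `|A i j| <= `|A|.
Proof.
rewrite [leRHS]mx_normrE.
exact: (@le_bigmax _ _ _ 0 (fun ij : 'I_p * 'I_q => `|A ij.1 ij.2|) (i, j)).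
Qed.

Lemma norm_mx_le p q (A : 'M[R]_(p, q)) c : 0 <= c ->
  (forall i j, `|A i j| <= c) -> `|A| <= c.
Proof.
move=> c0 H; rewrite [leLHS]mx_normrE; by apply: bigmax_le.
Qed.

Lemma norm_mulmx_bound p q (L : 'M[R]_(p, q)) :
  exists2 C, 0 < C & forall w : 'rV[R]_p, `|w *m L| <= C * `|w|.
Proof.
exists (p%:R * `|L| + 1) => [|w]; first by rewrite ltr_wpDl// mulr_ge0.
apply: norm_mx_le => [|i j]; first by rewrite mulr_ge0// addr_ge0// mulr_ge0.
rewrite mxE (le_trans (ler_norm_sum _ _ _))//.
apply: (@le_trans _ _ (\sum_(k < p) `|w| * `|L|)).
  apply: ler_sum => k _; rewrite normrM ler_pM//; exact: norm_entry_le.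
rewrite sumr_const card_ord -[_ *+ p]mulr_natl.
have -> : (p%:R * `|L| + 1) * `|w| = p%:R * (`|w| * `|L|) + `|w| by ring.
by rewrite lerDl.
Qed.

Implicit Types p q r : nat.

(** Enough for a differential relative to A to be determined: A contains short
    segments from u in the coordinate directions. *)
Definition fat p (A : set 'rV[R]_p) (u : 'rV[R]_p) :=
  forall i, \forall t \near (0 : R)^'+, A (u + t *: delta_mx 0 i).

Lemma diff_within_unique p q (A : set 'rV[R]_p) (f : 'rV[R]_p -> 'rV[R]_q) u L L' :
  fat A u -> has_diff_within A f u (fun h => h *m L) ->
  has_diff_within A f u (fun h => h *m L') -> L = L'.
Proof.
move=> fA dL dL'; apply/row_matrixP => i; apply/eqP; rewrite -subr_eq0 -normr_eq0.
apply/eqP/le_anti; rewrite normr_ge0 andbT; apply/ler_addgt0Pl => e e0.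
rewrite addr0; have e2 : 0 < e / 2 by rewrite divr_gt0.
have seg : u + t *: delta_mx 0 i @[t --> (0 : R)^'+] --> u.
  rewrite -[X in _ --> X]addr0 -(scale0r (delta_mx 0 i)).
  apply: cvgD; first exact: cvg_cst.
  apply: cvgZl; apply: cvg_at_right_filter; exact: cvg_id.
have N1 : \forall t \near (0 : R)^'+, A (u + t *: delta_mx 0 i) ->
    `|f (u + t *: delta_mx 0 i) - f u - (u + t *: delta_mx 0 i - u) *m L| <=
    e / 2 * `|u + t *: delta_mx 0 i - u| by exact: seg _ (dL _ e2).
have N2 : \forall t \near (0 : R)^'+, A (u + t *: delta_mx 0 i) ->
    `|f (u + t *: delta_mx 0 i) - f u - (u + t *: delta_mx 0 i - u) *m L'| <=
    e / 2 * `|u + t *: delta_mx 0 i - u| by exact: seg _ (dL' _ e2).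
near (0 : R)^'+ => t.
have t0 : 0 < t by near: t; exact: nbhs_right_gt.
have At : A (u + t *: delta_mx 0 i) by near: t; exact: fA.
have : A (u + t *: delta_mx 0 i) ->
    `|f (u + t *: delta_mx 0 i) - f u - (u + t *: delta_mx 0 i - u) *m L| <=
    e / 2 * `|u + t *: delta_mx 0 i - u| by near: t.
have : A (u + t *: delta_mx 0 i) ->
    `|f (u + t *: delta_mx 0 i) - f u - (u + t *: delta_mx 0 i - u) *m L'| <=
    e / 2 * `|u + t *: delta_mx 0 i - u| by near: t.
move=> /(_ At) h2 /(_ At) h1.
set v := u + t *: delta_mx 0 i in At h1 h2 *.
have vu : v - u = t *: delta_mx 0 i by rewrite /v addrAC subrr add0r.
have nvu : `|v - u| <= t.
  rewrite vu normrZ gtr0_norm// ler_piMr ?(ltW t0)//.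
  apply: norm_mx_le => // j k; rewrite mxE.
  by case: (_ && _); rewrite ?normr1 ?normr0.
have : `|t *: (row i L - row i L')| <= e * t.
  have -> : t *: (row i L - row i L') =
      (f v - f u - (v - u) *m L') - (f v - f u - (v - u) *m L).
    have aux (V : zmodType) (a b x : V) : (x - b) - (x - a) = a - b.
      by rewrite opprB addrC addrA subrK.
    by rewrite aux vu -!scalemxAl -!rowE scalerBr.
  apply: (le_trans (ler_normB _ _)); apply: (le_trans (lerD h2 h1)).
  by rewrite -mulrDl -splitr ler_pM2l.
by rewrite normrZ gtr0_norm// mulrC ler_pM2r.
Unshelve. all: by end_near. Qed.

Lemma jac_withinE p q (A : set 'rV[R]_p) (f : 'rV[R]_p -> 'rV[R]_q) u L :
  has_diff_within A f u (fun h => h *m L) ->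
  (forall L', has_diff_within A f u (fun h => h *m L') -> L' = L) ->
  jac_within A f u = L.
Proof.
move=> dL uniq; apply: uniq.
exact: (@xgetPex _ 0 [set L | has_diff_within A f u (fun h => h *m L)]
  (ex_intro _ L dL)).
Qed.

Lemma diff_within_near p q (A B : set 'rV[R]_p) (f g : 'rV[R]_p -> 'rV[R]_q) u L :
  (\forall v \near u, B v -> A v /\ f v = g v) -> f u = g u ->
  has_diff_within A f u (fun h => h *m L) ->
  has_diff_within B g u (fun h => h *m L).
Proof.
move=> AB fgu dL e e0; apply: filterS2 AB (dL e e0) => v H1 H2 Bv.
by have [Av <-] := H1 Bv; rewrite -fgu; exact: H2.
Qed.

Lemma diff_within_continuous p q (A : set 'rV[R]_p) (f : 'rV[R]_p -> 'rV[R]_q)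
    u L : has_diff_within A f u (fun h => h *m L) ->
  f v @[v --> within A (nbhs u)] --> f u.
Proof.
move=> dL; have [C C0 HC] := norm_mulmx_bound L.
apply/cvgrPdist_lt => e e0.
have C1 : 0 < C + 1 by rewrite addr_gt0.
have N : \forall v \near u, `|u - v| < e / (C + 1).
  exact: (@cvgr_dist_lt _ _ _ (nbhs u) _ id u cvg_id _ (divr_gt0 e0 C1)).
apply: filterS2 N (dL 1 ltr01) => v uv H Av; have := H Av.
rewrite mul1r => h1; rewrite distrC.
have : `|f v - f u| <= (C + 1) * `|v - u|.
  rewrite -[f v - f u](subrK ((v - u) *m L)) (le_trans (ler_normD _ _))//.
  by rewrite mulrDl mul1r addrC lerD.
move=> /le_lt_trans; apply; rewrite distrC mulrC -ltr_pdivlMr//.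
Qed.

Lemma diff_within_comp p q r (A C : set 'rV[R]_p) (B : set 'rV[R]_q)
    (f : 'rV[R]_p -> 'rV[R]_q) (g : 'rV[R]_q -> 'rV[R]_r) u L L' :
  (\forall v \near u, C v -> A v /\ B (f v)) ->
  has_diff_within A f u (fun h => h *m L) ->
  has_diff_within B g (f u) (fun h => h *m L') ->
  has_diff_within C (g \o f) u (fun h => h *m (L *m L')).
Proof.
move=> CAB dL dL' e e0.
have [K K0 HK] := norm_mulmx_bound L; have [K' K'0 HK'] := norm_mulmx_bound L'.
have K1 : 0 < K + 1 by rewrite addr_gt0.
pose e1 := e / 2 / (K + 1); pose e2 := e / 2 / K'.
have e10 : 0 < e1 by rewrite !divr_gt0.
have e20 : 0 < e2 by rewrite !divr_gt0.
have N1 := dL _ ltr01; have N2 := dL _ e20.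
have N3 : \forall v \near u, A v -> B (f v) ->
    `|g (f v) - g (f u) - (f v - f u) *m L'| <= e1 * `|f v - f u|.
  exact: (diff_within_continuous dL (dL' _ e10)).
rewrite near_withinE; near=> v => Cv.
have [Av Bfv] : A v /\ B (f v) by move: Cv; near: v.
have h1 : `|f v - f u - (v - u) *m L| <= 1 * `|v - u| by move: Av; near: v.
have h2 : `|f v - f u - (v - u) *m L| <= e2 * `|v - u| by move: Av; near: v.
have h3 : `|g (f v) - g (f u) - (f v - f u) *m L'| <= e1 * `|f v - f u|.
  by move: Av Bfv; near: v.
have h4 : `|f v - f u| <= (K + 1) * `|v - u|.
  rewrite -[f v - f u](subrK ((v - u) *m L)) (le_trans (ler_normD _ _))//.
  by rewrite mulrDl addrC lerD.
rewrite /= -[X in `|X|](subrK ((f v - f u - (v - u) *m L) *m L')).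
have -> : g (f v) - g (f u) - (v - u) *m (L *m L') -
    (f v - f u - (v - u) *m L) *m L' =
    g (f v) - g (f u) - (f v - f u) *m L'.
  have aux (V : zmodType) (a b x : V) : x - a - (b - a) = x - b.
    by rewrite opprB addrA subrK.
  by rewrite (mulmxBl (f v - f u) ((v - u) *m L)) -mulmxA aux.
apply: (le_trans (ler_normD _ _)); rewrite [e]splitr mulrDl; apply: lerD.
  apply: (le_trans h3); rewrite /e1.
  have -> : e / 2 * `|v - u| = e / 2 / (K + 1) * ((K + 1) * `|v - u|).
    by rewrite mulrA divfK// gt_eqF.
  by rewrite ler_pM2l.
apply: (le_trans (HK' _)).
have -> : e / 2 * `|v - u| = K' * (e2 * `|v - u|).
  by rewrite mulrA /e2 mulrCA divff ?mulr1// gt_eqF.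
by rewrite ler_pM2l.
Unshelve. all: by end_near. Qed.

Lemma diff_within_id p (A : set 'rV[R]_p) u :
  has_diff_within A id u (fun h => h *m 1%:M).
Proof.
move=> e e0; rewrite near_withinE; apply: nearW => v _.
by rewrite mulmx1 subrr normr0 mulr_ge0// ltW.
Qed.

Lemma Ck1_diff p q (A : set 'rV[R]_p) (f : 'rV[R]_p -> 'rV[R]_q) :
  Ck 1 A f -> exists J : 'rV[R]_p -> 'M[R]_(p, q),
    (forall u, A u -> has_diff_within A f u (fun h => h *m J u)) /\
    (forall u, A u -> J v @[v --> within A (nbhs u)] --> J u).
Proof.
case=> Df [dDf cDf]; exists (fun u => \matrix_(i < p) Df i u); split=> u Au.
  move=> e e0; apply: filterS (dDf u Au e e0) => v H.
  rewrite mulmx_sum_row; under eq_bigr => i _ do rewrite rowK.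
  exact: H.
apply/cvg_mxP => i j; rewrite mxE.
under eq_cvg do rewrite mxE.
by have /subspace_continuousP/(_ u Au)/cvg_mxP := cDf i; apply.
Qed.

End DiffWithin.

(** * Tangent maps in charts *)

Section Charts.
Context {R : realType} {m : nat} {M : topologicalType}.
Variable S : @smooth_structure R m M.
Local Notation pt := (chart_at S).
Implicit Types (c : @chart R m M) (x : M) (N : set M).

Lemma cimg_cmap c x : cdom c x -> cimg c (cmap c x).
Proof. by exists x. Qed.

Lemma cinvK c u : cimg c u -> cmap c (cinv c u) = u.
Proof. by move=> [x cx <-]; rewrite cmapK. Qed.

Lemma nbhs_cdom c x : cdom c x -> nbhs x (cdom c).
Proof. by move=> cx; apply: open_nbhs_nbhs; split => //; exact: cdom_open. Qed.

Lemma cinv_near c x N : cdom c x -> nbhs x N ->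
  \forall v \near cmap c x, cimg c v -> N (cinv c v).
Proof.
move=> cx xN; have /subspace_continuousP H := @cinv_continuous R m M c.
by rewrite -(cmapK cx) in xN; exact: H _ (cimg_cmap cx) _ xN.
Qed.

Lemma cimg_near c x : cdom c x ->
  \forall v \near cmap c x, half_space v -> cimg c v.
Proof.
move=> cx; have [V oV VE] := @cimg_open R m M c.
have Vx : V (cmap c x).
  by have : (V `&` half_space (m := m)) (cmap c x); [rewrite -VE; exists x|case].
have : nbhs (cmap c x) V by exact: open_nbhs_nbhs.
by apply: filterS => v Vv hv; rewrite /cimg VE.
Qed.

Lemma cmap_half_space c x : cdom c x -> half_space (cmap c x).
Proof.
move=> cx; have [V oV VE] := @cimg_open R m M c.
by have : (V `&` half_space (m := m)) (cmap c x); [rewrite -VE; exists x|case].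
Qed.

Lemma cmap_cvg c x : cdom c x -> cmap c y @[y --> x] --> cmap c x.
Proof.
move=> cx; have /subspace_continuousP/(_ x cx) := @cmap_continuous R m M c.
move=> H V /H cV.
have {}cV : \forall y \near x, cdom c y -> V (cmap c y) by exact: cV.
suff : \forall y \near x, V (cmap c y) by [].
by apply: filterS2 cV (nbhs_cdom cx) => y; apply.
Qed.

(** The inward normal of the half-space is a coordinate direction. *)
Lemma half_space_fat (A : set 'rV[R]_m) u : half_space u ->
  (\forall v \near u, half_space v -> A v) -> fat A u.
Proof.
move=> hu NA i.
have seg : u + t *: delta_mx 0 i @[t --> (0 : R)^'+] --> u.
  rewrite -[X in _ --> X]addr0 -(scale0r (delta_mx 0 i)).
  apply: cvgD; first exact: cvg_cst.
  apply: cvgZl; apply: cvg_at_right_filter; exact: cvg_id.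
have : \forall t \near (0 : R)^'+, half_space (u + t *: delta_mx 0 i) ->
  A (u + t *: delta_mx 0 i) by exact: seg _ NA.
apply: filterS2 (nbhs_right_gt (0 : R)) => t t0; apply=> j j0.
rewrite !mxE addr_ge0 ?hu// mulr_ge0 ?(ltW t0)//.
Qed.

Lemma chart_fat c x N (A : set 'rV[R]_m) : cdom c x -> nbhs x N ->
  (forall v, cimg c v -> N (cinv c v) -> A v) -> fat A (cmap c x).
Proof.
move=> cx xN NA; apply: half_space_fat; first exact: cmap_half_space.
apply: filterS2 (cinv_near cx xN) (cimg_near cx) => v H1 H2 hv.
by apply: NA; [exact: H2|exact/H1/H2].
Qed.

(** Matrices chosen by jac_within compose only when differentials are unique, while
    this relation composes always; the chosen matrices are recovered from it by
    uniqueness. *)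
Definition is_tangent (A : set M) (f : M -> M) c c' x (L : 'M[R]_m) :=
  has_diff_within (rep_dom A f c c') (rep f c c') (cmap c x) (fun h => h *m L).

Lemma is_tangent_id c x : cdom c x -> is_tangent setT id c c x 1%:M.
Proof.
move=> cx; apply: (@diff_within_near _ _ _ setT _ id _ _ _ _ _ (diff_within_id setT _)).
  by near=> v => -[cv _ _]; split=> //; rewrite /rep /= cinvK.
by rewrite /rep /= cmapK.
Unshelve. all: by end_near. Qed.

(** The chain rule. The last hypothesis makes the intermediate chart available on
    the whole domain on which the composite is read. *)
Lemma is_tangent_comp (A B C : set M) (f g k : M -> M) c c' c'' x L L' :
  cdom c x -> cdom c' (f x) -> A x ->
  f y @[y --> within A (nbhs x)] --> f x ->
  (forall y, C y -> [/\ A y, B (f y) & g (f y) = k y]) -> C x ->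
  is_tangent A f c c' x L -> is_tangent B g c' c'' (f x) L' ->
  (\forall v \near cmap c x, rep_dom C k c c'' v -> cdom c' (f (cinv c v))) ->
  is_tangent C k c c'' x (L *m L').
Proof.
move=> cx c'fx Ax cf CAB Cx dL dL' near_dom.
have fu : rep f c c' (cmap c x) = cmap c' (f x) by rewrite /rep cmapK.
have D : has_diff_within (rep_dom C k c c'') (rep g c' c'' \o rep f c c')
    (cmap c x) (fun h => h *m (L *m L')).
  apply: diff_within_comp dL _; last by rewrite fu; exact: dL'.
  apply: filterS near_dom => v H /[dup] /H c'v [cv Cv c''v].
  have [Av Bv gfk] := CAB _ Cv.
  split; first by split.
  rewrite /rep; split; first by exists (f (cinv c v)).
    by rewrite cmapK.
  by rewrite cmapK// gfk.
apply: (diff_within_near _ _ D).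
  apply: filterS near_dom => v H /[dup] /H c'v /[dup] Cv [cv Ccv c''v]; split=> //.
  have [_ _ gfk] := CAB _ Ccv.
  by rewrite /= /rep cmapK// gfk.
have [_ _ gfk] := CAB _ Cx.
by rewrite /= /rep !cmapK// gfk.
Qed.

Lemma atlas_tangent c c' : atlas S c -> atlas S c' ->
  exists J : 'rV[R]_m -> 'M[R]_m,
    (forall x, cdom c x -> cdom c' x -> is_tangent setT id c c' x (J (cmap c x))) /\
    (forall x, cdom c x -> cdom c' x -> J (cmap c y) @[y --> x] --> J (cmap c x)).
Proof.
move=> ac ac'; have [J [dJ cJ]] := Ck1_diff (atlas_compat ac ac' 1%N).
have dom x : cdom c x -> cdom c' x -> rep_dom setT id c c' (cmap c x).
  by move=> cx c'x; split; rewrite ?cmapK//; exact: cimg_cmap.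
exists J; split=> x cx c'x; first exact/dJ/dom.
move=> V /(cJ _ (dom _ cx c'x)) NV.
have {}NV : \forall v \near cmap c x, rep_dom setT id c c' v -> V (J v).
  by exact: NV.
suff : \forall y \near x, V (J (cmap c y)) by [].
have cN : \forall y \near x, cdom c y /\ cdom c' y.
  exact: filterI (nbhs_cdom cx) (nbhs_cdom c'x).
have NVc : \forall y \near x,
    rep_dom setT id c c' (cmap c y) -> V (J (cmap c y)) by exact: cmap_cvg cx _ NV.
by apply: filterS2 NVc cN => y H [cy c'y]; exact/H/dom.
Qed.

Lemma fat_overlap c c' x : cdom c x -> cdom c' x ->
  fat (rep_dom setT id c c') (cmap c x).
Proof.
move=> cx c'x; apply: (chart_fat cx (nbhs_cdom c'x)) => v cv c'v.
by split.
Qed.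

Lemma tchangeE c c' x L : cdom c x -> cdom c' x ->
  is_tangent setT id c c' x L -> tchange c c' x = L.
Proof.
move=> cx c'x dL; apply: (jac_withinE dL) => L' dL'.
exact: diff_within_unique (fat_overlap cx c'x) dL' dL.
Qed.

Lemma tchange_tangent c c' x : atlas S c -> atlas S c' ->
  cdom c x -> cdom c' x -> is_tangent setT id c c' x (tchange c c' x).
Proof.
move=> ac ac' cx c'x; have [J [dJ _]] := atlas_tangent ac ac'.
by rewrite (tchangeE cx c'x (dJ _ cx c'x)); exact: dJ.
Qed.

Lemma tchange_cvg c c' x : atlas S c -> atlas S c' -> cdom c x -> cdom c' x ->
  tchange c c' y @[y --> x] --> tchange c c' x.
Proof.
move=> ac ac' cx c'x; have [J [dJ cJ]] := atlas_tangent ac ac'.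
rewrite (tchangeE cx c'x (dJ _ cx c'x)); apply: cvg_trans (cJ _ cx c'x).
apply: near_eq_cvg.
apply: filterS2 (nbhs_cdom cx) (nbhs_cdom c'x) => y cy c'y.
by rewrite (tchangeE cy c'y (dJ _ cy c'y)).
Qed.

Lemma tchangexx c x : cdom c x -> tchange c c x = 1%:M.
Proof. by move=> cx; apply: tchangeE => //; exact: is_tangent_id. Qed.

Lemma tchange_comp c c' c'' x : atlas S c -> atlas S c' -> atlas S c'' ->
  cdom c x -> cdom c' x -> cdom c'' x ->
  tchange c c' x *m tchange c' c'' x = tchange c c'' x.
Proof.
move=> ac ac' ac'' cx c'x c''x; apply/esym/tchangeE => //.
apply: (@is_tangent_comp setT setT setT id id id c c' c'') => //.
- exact: cvg_within_filter cvg_id.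
- exact: tchange_tangent.
- exact: tchange_tangent.
- by apply: filterS (cinv_near cx (nbhs_cdom c'x)) => v H [/H].
Qed.

Lemma tchange_inv c c' x : atlas S c -> atlas S c' -> cdom c x -> cdom c' x ->
  tchange c c' x *m tchange c' c x = 1%:M.
Proof. by move=> *; rewrite tchange_comp// tchangexx. Qed.

Lemma tchange_unit c c' x : atlas S c -> atlas S c' -> cdom c x -> cdom c' x ->
  tchange c c' x \in unitmx.
Proof.
move=> ac ac' cx c'x.
exact: unitmx_left (tchange_inv ac ac' cx c'x).
Qed.

End Charts.

(** * The tangent maps of the flow over an invariant set *)

Section FlowTangent.
Context {R : realType} {m : nat} {M : topologicalType}.
Variables (S : @smooth_structure R m M) (X : M -> 'rV[R]_m) (Phi : R -> M -> M).
Hypothesis Phi_flow : is_flow S X Phi.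
Variable Gamma : set M.
Hypothesis Gamma_inv : flow_invariant Phi Gamma.
Local Notation pt := (chart_at S).
Implicit Types (c : @chart R m M) (x y : M) (s t : R).

Definition time_dom t : set M := [set y | flow_dom Phi (t, y)].

Lemma time_dom_ge0 t x : 0 <= t -> time_dom t x.
Proof. by left. Qed.

Lemma time_dom_inv t x : Gamma x -> time_dom t x.
Proof. by move=> /(@Gamma_inv t)[]. Qed.

Lemma Gamma_flow t x : Gamma x -> Gamma (Phi t x).
Proof. by move=> /(@Gamma_inv t)[]. Qed.

Lemma Phi_add s t x : Gamma x -> Phi (s + t) x = Phi t (Phi s x).
Proof.
move=> Gx; have [] // := flowD Phi_flow (s := s) (t := t) (x := x).
  exact: time_dom_inv.
exact/time_dom_inv/Gamma_flow.
Qed.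

Lemma Phi_add_ge0 s t x : 0 <= s -> 0 <= t -> Phi (s + t) x = Phi t (Phi s x).
Proof.
move=> s0 t0; have [] // := flowD Phi_flow (s := s) (t := t) (x := x).
  by left.
by left.
Qed.

Lemma Phi_subK t x : 0 <= t -> Phi (- t) (Phi t x) = x.
Proof.
move=> t0; have [| |_ <-] := flowD Phi_flow (s := t) (t := - t) (x := x).
- by left.
- by right; exists x; rewrite /= opprK.
- by rewrite subrr (flow0 Phi_flow).
Qed.

Lemma Phi_cvg p0 : flow_dom Phi p0 ->
  Phi p.1 p.2 @[p --> within (flow_dom Phi) (nbhs p0)] --> Phi p0.1 p0.2.
Proof.
by move=> d; have /subspace_continuousP/(_ p0 d) := flow_continuous Phi_flow.
Qed.

Lemma Phi_cvg_space t x : time_dom t x ->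
  Phi t y @[y --> within (time_dom t) (nbhs x)] --> Phi t x.
Proof.
move=> d V /(Phi_cvg d) NV.
have {}NV : \forall p \near (t, x), flow_dom Phi p -> V (Phi p.1 p.2) by exact: NV.
have cp : (t, y) @[y --> x] --> (t, x).
  by apply: cvg_pair_at; [exact: cvg_cst|exact: cvg_id].
exact: cp _ NV.
Qed.

Lemma Phi_near c t x N : cdom c x -> time_dom t x -> nbhs (Phi t x) N ->
  \forall v \near cmap c x, cimg c v -> time_dom t (cinv c v) ->
    N (Phi t (cinv c v)).
Proof.
move=> cx dx NN; apply: (cinv_near cx (N := [set y | time_dom t y -> N (Phi t y)])).
exact: Phi_cvg_space dx _ NN.
Qed.

Lemma Phi_nbhs t x N : 0 <= t -> nbhs (Phi t x) N -> nbhs x (Phi t @^-1` N).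
Proof.
move=> t0 NN; have H : \forall y \near x, time_dom t y -> N (Phi t y).
  exact: Phi_cvg_space (time_dom_ge0 _ t0) _ NN.
by apply: filterS H => y; apply; exact: time_dom_ge0.
Qed.

(** The pair (t, u), in the encoding used for the C^1 regularity of the flow. *)
Definition time_point t (u : 'rV[R]_m) : 'rV[R]_(1 + m) := row_mx (const_mx t) u.

Definition time_rep_dom c c' : set 'rV[R]_(1 + m) :=
  [set w | [/\ cimg c (rsubmx w),
      flow_dom Phi (lsubmx w 0 0, cinv c (rsubmx w)) &
      cdom c' (Phi (lsubmx w 0 0) (cinv c (rsubmx w)))]].

Lemma time_rep_domE c c' t u :
  time_rep_dom c c' (time_point t u) = rep_dom (time_dom t) (Phi t) c c' u.
Proof. by rewrite /time_rep_dom /= /time_point row_mxKl row_mxKr mxE. Qed.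

(** The differential in space is the restriction of the joint differential in time
    and space to the slice of constant time. *)
Lemma flow_tangent c c' : atlas S c -> atlas S c' ->
  exists J : 'rV[R]_(1 + m) -> 'M[R]_m,
    (forall t x, cdom c x -> time_dom t x -> cdom c' (Phi t x) ->
      is_tangent (time_dom t) (Phi t) c c' x (J (time_point t (cmap c x)))) /\
    (forall w, time_rep_dom c c' w ->
      J v @[v --> within (time_rep_dom c c') (nbhs w)] --> J w).
Proof.
move=> ac ac'; have [J [dJ cJ]] := Ck1_diff (flow_C1 Phi_flow ac ac').
exists (fun w => dsubmx (J w)); split=> [t x cx dx c'x|w Ww]; last first.
  have /cvg_mxP H := cJ w Ww; apply/cvg_mxP => i j; rewrite mxE.
  by under eq_cvg do rewrite mxE; exact: H.
have dom : rep_dom (time_dom t) (Phi t) c c' (cmap c x).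
  by split; rewrite ?cmapK//; exact: cimg_cmap.
have dslice : has_diff_within (rep_dom (time_dom t) (Phi t) c c')
    (time_point t) (cmap c x) (fun h => h *m row_mx 0 1%:M).
  move=> e e0; rewrite near_withinE; near=> v => _.
  rewrite mul_mx_row mulmx0 mulmx1 /time_point opp_row_mx add_row_mx.
  rewrite opp_row_mx add_row_mx !subrr row_mx0 normr0.
  by rewrite mulr_ge0// ltW.
have dJw := dJ (time_point t (cmap c x)).
rewrite -time_rep_domE in dom.
have := diff_within_comp _ dslice (dJw dom).
have -> : row_mx 0 1%:M *m J (time_point t (cmap c x)) =
    dsubmx (J (time_point t (cmap c x))).
  by rewrite -{1}[J _]vsubmxK mul_row_col mul0mx mul1mx add0r.
move=> /(_ (rep_dom (time_dom t) (Phi t) c c')) H.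
apply: (diff_within_near _ _ (H _)).
- near=> v => dv; split=> //.
  by rewrite /= /rep /time_point row_mxKl row_mxKr mxE.
- by rewrite /= /rep /time_point row_mxKl row_mxKr mxE.
near=> v => dv; split=> //.
by move: dv; rewrite -time_rep_domE.
Unshelve. all: by end_near. Qed.

Lemma flow_tangent_ex t x c c' : atlas S c -> atlas S c' -> cdom c x ->
  time_dom t x -> cdom c' (Phi t x) ->
  exists L, is_tangent (time_dom t) (Phi t) c c' x L.
Proof.
move=> ac ac' cx dx c'x; have [J [dJ _]] := flow_tangent ac ac'.
by exists (J (time_point t (cmap c x))); exact: dJ.
Qed.

Lemma fat_flow c c' t x : 0 <= t -> cdom c x -> cdom c' (Phi t x) ->
  fat (rep_dom (time_dom t) (Phi t) c c') (cmap c x).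
Proof.
move=> t0 cx c'x; apply: (chart_fat cx (Phi_nbhs t0 (nbhs_cdom c'x))) => v cv c'v.
by split=> //; exact: time_dom_ge0.
Qed.

(** The backward map is defined only on the image of the forward map, where a
    differential need not be determined for lack of directions; the chain rule
    for Phi (- t) \o Phi t = id forces it nevertheless. *)
Lemma flow_tangent_inv c c' t x L L' : atlas S c -> atlas S c' -> 0 <= t ->
  cdom c x -> cdom c' (Phi t x) ->
  is_tangent (time_dom t) (Phi t) c c' x L ->
  is_tangent (time_dom (- t)) (Phi (- t)) c' c (Phi t x) L' ->
  L *m L' = 1%:M.
Proof.
move=> ac ac' t0 cx c'x dL dL'.
apply: (@diff_within_unique _ _ _ _ _ _ _ _ (fat_overlap cx cx)); last first.
  exact: is_tangent_id.
apply: (@is_tangent_comp _ _ _ (time_dom t) (time_dom (- t)) setT (Phi t)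
  (Phi (- t)) id c c' c) => //.
- exact: time_dom_ge0.
- exact/Phi_cvg_space/time_dom_ge0.
- move=> y _; split; [exact: time_dom_ge0| |exact: Phi_subK].
  by right; exists y; rewrite /= opprK.
- have := Phi_near cx (time_dom_ge0 _ t0) (nbhs_cdom c'x).
  by apply: filterS => v H [cv _ _]; apply: H => //; exact: time_dom_ge0.
Qed.

Lemma flow_tangent_unique c c' t x L L' : atlas S c -> atlas S c' -> Gamma x ->
  cdom c x -> cdom c' (Phi t x) ->
  is_tangent (time_dom t) (Phi t) c c' x L ->
  is_tangent (time_dom t) (Phi t) c c' x L' -> L = L'.
Proof.
move=> ac ac' Gx cx c'x dL dL'; have [t0|/ltW t0] := leP 0 t.
  exact: diff_within_unique (fat_flow t0 cx c'x) dL dL'.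
have nt0 : 0 <= - t by rewrite oppr_ge0.
have xE : Phi (- t) (Phi t x) = x by rewrite -Phi_add// subrr (flow0 Phi_flow).
have cy : cdom c (Phi (- t) (Phi t x)) by rewrite xE.
have [K dK] := flow_tangent_ex ac' ac c'x (time_dom_ge0 _ nt0) cy.
have inv N : is_tangent (time_dom t) (Phi t) c c' x N -> K *m N = 1%:M.
  move=> dN; apply: (flow_tangent_inv ac' ac nt0 c'x cy dK).
  by rewrite opprK xE.
have uK := unitmx_left (inv _ dL).
by rewrite -[LHS](mulKmx uK) (inv _ dL) -(inv _ dL') mulKmx.
Qed.

Lemma Dflow_tangent t x : Gamma x ->
  is_tangent (time_dom t) (Phi t) (pt x) (pt (Phi t x)) x (Dflow S Phi t x).
Proof.
move=> Gx.
have ax := chart_at_atlas S x; have ay := chart_at_atlas S (Phi t x).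
have cx := chart_at_dom S x; have cy := chart_at_dom S (Phi t x).
have [L dL] := flow_tangent_ex ax ay cx (time_dom_inv t Gx) cy.
rewrite /Dflow /tmap (jac_withinE dL)// => L' dL'.
exact: (flow_tangent_unique ax ay Gx cx cy dL' dL).
Qed.

Lemma Dflow_chart c c' t x L : atlas S c -> atlas S c' -> Gamma x ->
  cdom c x -> cdom c' (Phi t x) ->
  is_tangent (time_dom t) (Phi t) c c' x L ->
  tchange c (pt x) x *m Dflow S Phi t x *m
    tchange (pt (Phi t x)) c' (Phi t x) = L.
Proof.
move=> ac ac' Gx cx c'x dL.
have ax := chart_at_atlas S x; have ay := chart_at_atlas S (Phi t x).
have px := chart_at_dom S x; have py := chart_at_dom S (Phi t x).
apply: (flow_tangent_unique ac ac' Gx cx c'x _ dL).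
apply: (@is_tangent_comp _ _ _ (time_dom t) setT (time_dom t) (Phi t) id (Phi t)
  c (pt (Phi t x)) c') => //.
- exact: time_dom_inv.
- exact/Phi_cvg_space/time_dom_inv.
- exact: time_dom_inv.
- apply: (@is_tangent_comp _ _ _ setT (time_dom t) (time_dom t) id (Phi t) (Phi t)
    c (pt x) (pt (Phi t x))) => //.
  + exact: cvg_within_filter cvg_id.
  + exact: time_dom_inv.
  + exact: (tchange_tangent ac ax).
  + exact: Dflow_tangent.
  + by apply: filterS (cinv_near cx (nbhs_cdom px)) => v H [/H].
- exact: (tchange_tangent ay ac').
- have := Phi_near cx (time_dom_inv t Gx) (nbhs_cdom py).
  by apply: filterS => v H [cv dv _]; exact: H.
Qed.

Lemma Dflow_add_ge0 s t x : Gamma x -> 0 <= s -> 0 <= t ->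
  Dflow S Phi (s + t) x = Dflow S Phi s x *m Dflow S Phi t (Phi s x).
Proof.
move=> Gx s0 t0.
have ax := chart_at_atlas S x; have az := chart_at_atlas S (Phi (s + t) x).
have px := chart_at_dom S x; have pz := chart_at_dom S (Phi (s + t) x).
apply: (flow_tangent_unique ax az Gx px pz (Dflow_tangent _ Gx)).
have py := chart_at_dom S (Phi s x).
apply: (@is_tangent_comp _ _ _ (time_dom s) (time_dom t) (time_dom (s + t))
  (Phi s) (Phi t) (Phi (s + t)) (pt x) (pt (Phi s x))) => //.
- exact: time_dom_inv.
- exact/Phi_cvg_space/time_dom_inv.
- move=> y _; split; [exact: time_dom_ge0|exact: time_dom_ge0|].
  by rewrite Phi_add_ge0.
- exact: time_dom_inv.
- exact: Dflow_tangent.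
- by rewrite Phi_add//; exact/Dflow_tangent/Gamma_flow.
- have := Phi_near px (time_dom_inv s Gx) (nbhs_cdom py).
  by apply: filterS => v H [cv _ _]; apply: H => //; exact: time_dom_ge0.
Qed.

Lemma Dflow_inv t x : Gamma x -> 0 <= t ->
  Dflow S Phi t x *m Dflow S Phi (- t) (Phi t x) = 1%:M.
Proof.
move=> Gx t0.
have ax := chart_at_atlas S x; have ay := chart_at_atlas S (Phi t x).
have px := chart_at_dom S x; have py := chart_at_dom S (Phi t x).
apply: (flow_tangent_inv ax ay t0 px py (Dflow_tangent t Gx)).
have := Dflow_tangent (- t) (Gamma_flow t Gx).
by rewrite Phi_subK.
Qed.

Lemma Dflow_unit_ge0 t x : Gamma x -> 0 <= t -> Dflow S Phi t x \in unitmx.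
Proof. by move=> Gx t0; exact: unitmx_left (Dflow_inv Gx t0). Qed.

(** The chain rule is available for nonnegative times only. Measuring time from z, a
    point of the past, makes all times that occur nonnegative. *)
Lemma Dflow_past r a z : Gamma z -> 0 <= r -> 0 <= r + a ->
  Dflow S Phi a (Phi r z) = invmx (Dflow S Phi r z) *m Dflow S Phi (r + a) z.
Proof.
move=> Gz r0 ra; have u := Dflow_unit_ge0 Gz r0.
have [a0|/ltW a0] := leP 0 a; first by rewrite Dflow_add_ge0// mulKmx.
have na : 0 <= - a by rewrite oppr_ge0.
have := Dflow_add_ge0 Gz ra na; rewrite addrK => ->.
set A := Dflow S Phi (r + a) z; set y := Phi (r + a) z.
have Gy : Gamma y by exact: Gamma_flow.
have := Dflow_inv Gy na; rewrite opprK /y -Phi_add// addrK => H.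
apply: right_inverse_mul H; last exact: Dflow_unit_ge0.
exact: Dflow_unit_ge0.
Qed.

Lemma Dflow_add s t x : Gamma x ->
  Dflow S Phi (s + t) x = Dflow S Phi s x *m Dflow S Phi t (Phi s x).
Proof.
move=> Gx; pose r := `|s| + `|t|.
have [z Gz xE] : exists2 z, Gamma z & x = Phi r z.
  exists (Phi (- r) x); first exact: Gamma_flow.
  by rewrite -Phi_add// addNr (flow0 Phi_flow).
have s1 := ler_norm s; have s2 := ler_norm (- s).
have t1 := ler_norm t; have t2 := ler_norm (- t).
rewrite normrN in s2; rewrite normrN in t2.
have r0 : 0 <= r by rewrite addr_ge0.
have rs : 0 <= r + s by rewrite /r; have := normr_ge0 t; lra.
have rst : 0 <= r + (s + t) by rewrite /r; lra.
have yE : Phi s x = Phi (r + s) z by rewrite xE -Phi_add.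
rewrite yE xE (Dflow_past Gz r0 rst) (Dflow_past Gz r0 rs).
rewrite (Dflow_past Gz rs); last by rewrite -addrA.
rewrite -(addrA r s t) (@mulmx_invmx_mid _ _ _ _ _ (Dflow_unit_ge0 Gz rs)).
by [].
Qed.

Lemma Dflow0 x : Gamma x -> Dflow S Phi 0 x = 1%:M.
Proof.
move=> Gx; have u : Dflow S Phi 0 x \in unitmx by exact: Dflow_unit_ge0.
have := Dflow_add 0 0 Gx; rewrite addr0 (flow0 Phi_flow) => e.
exact: unitmx_idem u e.
Qed.

End FlowTangent.

(** * Singular-hyperbolic sets as linear cocycles *)

Section SubspaceType.
Context {M : topologicalType} (Gamma : set M).

Lemma set_val_in (x : Gamma) : Gamma (set_val x).
Proof. exact: set_valP. Qed.

Definition in_Gamma y (Gy : Gamma y) : Gamma := exist _ y (mem_set Gy).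

Lemma in_GammaK y (Gy : Gamma y) : set_val (in_Gamma Gy) = y.
Proof. by rewrite set_valE. Qed.

Lemma set_val_inj (x y : Gamma) : set_val x = set_val y -> x = y.
Proof. exact: val_inj. Qed.

Lemma set_val_cvg (x : Gamma) : set_val y @[y --> x] --> set_val x.
Proof. exact: initial_continuous. Qed.

Lemma set_type_cvg {T : Type} (F : set_system T) {FF : Filter F}
    (f : T -> Gamma) (x : Gamma) :
  set_val (f p) @[p --> F] --> set_val x -> f p @[p --> F] --> x.
Proof.
move=> cf V [B [[O oO <-] Ox BV]].
have NO : nbhs (set_val x) O by exact: open_nbhs_nbhs.
have H : \forall p \near F, O (set_val (f p)) by exact: cf.
suff : \forall p \near F, V (f p) by [].
by apply: filterS H => p; exact: BV.
Qed.

Lemma near_set_type (x : Gamma) (P : Gamma -> Prop) : (\forall y \near x, P y) ->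
  \forall y \near set_val x, forall Gy : Gamma y, P (in_Gamma Gy).
Proof.
move=> [B [[O oO <-] Ox BP]].
have NO : nbhs (set_val x) O by exact: open_nbhs_nbhs.
by apply: filterS NO => y Oy Gy; exact: BP.
Qed.

Lemma compact_set_type : compact Gamma -> compact [set: Gamma].
Proof.
move=> /compact_near_coveringP/near_covering_withinP cG.
apply/compact_near_coveringP => J F P FF H.
have := cG J F (fun i y => forall Gy : Gamma y, P i (in_Gamma Gy)) FF.
have H' y : Gamma y -> \forall y' \near y & i \near F, Gamma y' ->
    forall Gy : Gamma y', P i (in_Gamma Gy).
  move=> Gy; have [[U V] /= [NU FV] UV] := H (in_Gamma Gy) I.
  exists ([set y' | forall Gy' : Gamma y', U (in_Gamma Gy')], V) => /=.
    split=> //; have := @near_set_type (in_Gamma Gy) U NU.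
    by rewrite in_GammaK.
  by move=> [y' i] /= [Uy Vi] _ Gy'; exact: (UV (in_Gamma Gy', i) (conj (Uy Gy') Vi)).
move=> /(_ H'); apply: filterS => i Pi x _.
have -> : x = in_Gamma (set_val_in x) by apply: set_val_inj; rewrite in_GammaK.
exact/Pi/set_val_in.
Qed.

End SubspaceType.

Section OperatorNorm.
Context {R : realType} {m : nat}.
Implicit Types G H W L : 'M[R]_m.

Lemma tnormE G v : tnorm G v = Num.sqrt (qform G v).
Proof. by []. Qed.

Lemma qform_le1 G v : tnorm G v <= 1 -> qform G v <= 1.
Proof. by rewrite tnormE -[X in _ <= X]sqrtr1 ler_sqrt. Qed.

Lemma opnorm_le G H W L c : 0 <= c ->
  (forall v : 'rV_m, (v <= W)%MS -> qform H (v *m L) <= c * qform G v) ->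
  opnorm G H W L <= Num.sqrt c.
Proof.
move=> c0 cW; apply: ge_sup.
  by exists (tnorm H (0 *m L)), 0 => //; split; rewrite ?sub0mx// tnormE qform0 sqrtr0.
move=> _ [v [vW v1] <-]; rewrite tnormE; apply: ler_wsqrtr.
apply: le_trans (cW v vW) _; rewrite -[leRHS]mulr1 ler_wpM2l//.
exact: qform_le1.
Qed.

Lemma qform_scale G (a : R) (v : 'rV[R]_m) : qform G (a *: v) = a ^+ 2 * qform G v.
Proof.
rewrite /qform linearZ /= -scalemxAl -scalemxAr -scalemxAl !mxE.
by rewrite mulrA -expr2.
Qed.

Lemma opnorm_ub G H W L (v : 'rV[R]_m) : posdef G -> posdef H ->
  (v <= W)%MS -> tnorm G v <= 1 -> tnorm H (v *m L) <= opnorm G H W L.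
Proof.
move=> pG pH vW v1; apply: ub_le_sup; last by exists v.
exists (Num.sqrt (hsnorm G H L)) => _ [w [_ w1] <-].
rewrite tnormE; apply: ler_wsqrtr; apply: le_trans (qform_hsnorm L w pG pH) _.
rewrite -[leRHS]mulr1 ler_wpM2l ?hsnorm_ge0//.
exact: qform_le1.
Qed.

Lemma opnorm_ge0 G H W L : posdef G -> posdef H -> 0 <= opnorm G H W L.
Proof.
move=> pG pH; have := @opnorm_ub G H W L 0 pG pH (sub0mx _ _).
by rewrite !tnormE mul0mx !qform0 sqrtr0; apply; exact: ler01.
Qed.

Lemma qform_opnorm G H W L v : posdef G -> posdef H -> (v <= W)%MS ->
  qform H (v *m L) <= opnorm G H W L ^+ 2 * qform G v.
Proof.
move=> pG pH vW; have [->|v0] := eqVneq v 0; first by rewrite mul0mx !qform0 mulr0.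
have q0 : 0 < qform G v by case: pG => _; apply.
pose n := Num.sqrt (qform G v); have n0 : 0 < n by rewrite sqrtr_gt0.
have n2 : n ^+ 2 = qform G v by rewrite sqr_sqrtr// ltW.
have := @opnorm_ub G H W L (n^-1 *: v) pG pH (scalemx_sub _ vW).
rewrite tnormE qform_scale -n2 -exprMn mulVf ?gt_eqF// expr1n sqrtr1 => /(_ (lexx _)).
rewrite tnormE -scalemxAl qform_scale => op.
have q'0 : 0 <= qform H (v *m L) by exact: qform_ge0.
have : n^-1 ^+ 2 * qform H (v *m L) <= opnorm G H W L ^+ 2.
  have ni0 : 0 <= n^-1 ^+ 2 * qform H (v *m L) by rewrite mulr_ge0// sqr_ge0.
  rewrite -[leLHS]sqr_sqrtr//.
  by apply: lerXn2r => //; rewrite nnegrE ?sqrtr_ge0 ?opnorm_ge0.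
by rewrite exprVn mulrC ler_pdivrMr// exprn_gt0.
Qed.

Lemma absdet_gramdet G H W L : absdet G H W L =
  Num.sqrt (gramdet (L *m H *m L^T) (row_base W)) /
  Num.sqrt (gramdet G (row_base W)).
Proof.
rewrite /absdet /gramdet; move: (row_base W) => B.
by rewrite trmx_mul !mulmxA.
Qed.

Lemma sqrt_expR (x : R) : Num.sqrt (expR x) = expR (x / 2).
Proof.
have -> : expR x = expR (x / 2) ^+ 2.
  by rewrite -expRM_natr; congr expR; field.
by rewrite sqrtr_sqr ger0_norm ?expR_ge0.
Qed.

End OperatorNorm.

Section SingularHyperbolic.
Context {R : realType} {m : nat} {M : topologicalType}.
Variables (S : @smooth_structure R m M) (X : M -> 'rV[R]_m) (Phi : R -> M -> M).
Hypothesis Phi_flow : is_flow S X Phi.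
Variables (g : M -> 'M[R]_m) (Gamma : set M) (E F : M -> 'M[R]_m).
Hypothesis g_metric : riemannian_metric S g.
Hypothesis Gamma_sh : singular_hyperbolic S Phi g Gamma E F.
Local Notation pt := (chart_at S).

Let Gamma_inv : flow_invariant Phi Gamma.
Proof. by case: Gamma_sh => -[]. Qed.

Let dom_split : dominated_splitting S Phi g Gamma E F.
Proof. by case: Gamma_sh => -[]. Qed.

Implicit Types (x y : Gamma) (s t : R).

Let inG x : Gamma (set_val x) := set_val_in x.

Definition flowG t x : Gamma := in_Gamma (Gamma_flow Gamma_inv t (inG x)).

Definition DG t x := Dflow S Phi t (set_val x).

Definition tauG x y := tchange (pt (set_val x)) (pt (set_val y)) (set_val y).

Lemma flowGE t x : set_val (flowG t x) = Phi t (set_val x).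
Proof. exact: in_GammaK. Qed.

Lemma flowG0 x : flowG 0 x = x.
Proof. by apply: set_val_inj; rewrite flowGE (flow0 Phi_flow). Qed.

Lemma flowGD s t x : flowG (s + t) x = flowG t (flowG s x).
Proof.
by apply: set_val_inj; rewrite !flowGE (Phi_add Phi_flow Gamma_inv)//.
Qed.

Lemma flowG_within (p0 : R * Gamma) :
  (p.1, set_val p.2) @[p --> p0] -->
  within (flow_dom Phi) (nbhs (p0.1, set_val p0.2)).
Proof.
move=> V NV.
have cp : (p.1, set_val p.2) @[p --> p0] --> (p0.1, set_val p0.2).
  apply: cvg_pair_at; first exact: cvg_fst.
  exact: (@cvg_at_comp _ _ _ snd set_val p0 p0.2 _ cvg_snd (@set_val_cvg _ _ p0.2)).
have NV' : \forall p \near p0, flow_dom Phi (p.1, set_val p.2) ->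
  V (p.1, set_val p.2) by exact: cp _ NV.
suff : \forall p \near p0, V (p.1, set_val p.2) by [].
by apply: filterS NV' => p; apply; exact: (time_dom_inv Gamma_inv _ (inG p.2)).
Qed.

Lemma flowG_continuous : continuous (fun p : R * Gamma => flowG p.1 p.2).
Proof.
move=> p0; apply: set_type_cvg; rewrite flowGE.
under eq_cvg do rewrite flowGE.
move=> V /(Phi_cvg Phi_flow (time_dom_inv Gamma_inv p0.1 (inG p0.2))) NV.
exact: flowG_within NV.
Qed.

Lemma pt_dom (z : M) : cdom (pt z) z.
Proof. exact: chart_at_dom. Qed.

Lemma near_cdom x (c : @chart R m M) : cdom c (set_val x) ->
  \forall y \near x, cdom c (set_val y).
Proof. by move=> cx; exact: set_val_cvg (nbhs_cdom cx). Qed.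

Lemma tauG1 x : tauG x x = 1%:M.
Proof. by apply: tchangexx; exact: pt_dom. Qed.

Lemma tauG_unit x0 : \forall x \near x0, tauG x0 x \in unitmx.
Proof.
apply: filterS (near_cdom (pt_dom (set_val x0))) => x cx.
exact: (tchange_unit (chart_at_atlas S _) (chart_at_atlas S _) cx (pt_dom _)).
Qed.

Lemma DG0 x : DG 0 x = 1%:M.
Proof. exact: (Dflow0 Phi_flow Gamma_inv (inG x)). Qed.

Lemma DGD s t x : DG (s + t) x = DG s x *m DG t (flowG s x).
Proof. by rewrite /DG flowGE; exact: (Dflow_add Phi_flow Gamma_inv _ _ (inG x)). Qed.

(** In the charts at x0 and y0 the tangent maps are given by the continuous function J
    of flow_tangent. *)
Lemma DG_continuous (p0 : R * Gamma) :
  tauG p0.2 p.2 *m DG p.1 p.2 *m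
    invmx (tauG (flowG p0.1 p0.2) (flowG p.1 p.2)) @[p --> p0] --> DG p0.1 p0.2.
Proof.
set x0 := p0.2; set y0 := flowG p0.1 x0.
pose c := pt (set_val x0); pose c' := pt (set_val y0).
have ac : atlas S c := chart_at_atlas S _.
have ac' : atlas S c' := chart_at_atlas S _.
have [J [dJ cJ]] := flow_tangent Phi_flow ac ac'.
pose w (p : R * Gamma) := time_point p.1 (cmap c (set_val p.2)).
have formula p : cdom c (set_val p.2) -> cdom c' (set_val (flowG p.1 p.2)) ->
    tauG x0 p.2 *m DG p.1 p.2 *m invmx (tauG y0 (flowG p.1 p.2)) = J (w p).
  rewrite flowGE => cx c'y.
  have dx := time_dom_inv Gamma_inv p.1 (inG p.2).
  have <- := Dflow_chart Phi_flow Gamma_inv ac ac' (inG p.2) cx c'y (dJ _ _ cx dx c'y).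
  rewrite /tauG flowGE; congr (_ *m _).
  set a := tchange c' _ _.
  have inv := tchange_inv (chart_at_atlas S (Phi p.1 (set_val p.2))) ac'
    (pt_dom _) c'y.
  exact: invmx_of_right_inverse inv.
have cx0 : cdom c (set_val x0) by exact: pt_dom.
have cy0 : cdom c' (set_val y0) by exact: pt_dom.
have near_dom : \forall p \near p0,
    cdom c (set_val p.2) /\ cdom c' (set_val (flowG p.1 p.2)).
  apply: filterI.
    have c2 : p.2 @[p --> p0] --> x0 by exact: cvg_snd.
    exact: c2 _ (near_cdom cx0).
  exact: flowG_continuous (near_cdom cy0).
have W0 : time_rep_dom Phi c c' (w p0).
  rewrite time_rep_domE; split.
  - exact: cimg_cmap.
  - by rewrite cmapK//; exact: (time_dom_inv Gamma_inv _ (inG _)).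
  - by rewrite cmapK// -flowGE.
have cw : w p @[p --> p0] --> w p0.
  have c2 : set_val p.2 @[p --> p0] --> set_val x0.
    exact: (@cvg_at_comp _ _ _ snd set_val p0 x0 _ cvg_snd (@set_val_cvg _ _ x0)).
  have cc : cmap c (set_val p.2) @[p --> p0] --> cmap c (set_val x0).
    exact: (@cvg_at_comp _ _ _ (fun p : R * Gamma => set_val p.2) (cmap c) p0
      (set_val x0) _ c2 (cmap_cvg cx0)).
  by apply: cvg_row_mx cc; apply: cvg_const_mx; exact: cvg_fst.
have -> : DG p0.1 x0 = J (w p0).
  by rewrite -formula// tauG1 mul1mx tauG1 invmx1 mulmx1.
have limJ : J (w p) @[p --> p0] --> J (w p0).
  move=> V /(cJ _ W0) NV.
  have NV' : \forall p \near p0, time_rep_dom Phi c c' (w p) -> V (J (w p)).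
    exact: cw _ NV.
  suff : \forall p \near p0, V (J (w p)) by [].
  apply: filterS2 NV' near_dom => p H [cx c'y]; apply: H.
  rewrite time_rep_domE; split.
  - exact: cimg_cmap.
  - by rewrite cmapK//; exact: (time_dom_inv Gamma_inv _ (inG _)).
  - by rewrite cmapK// -flowGE.
apply: cvg_trans limJ; apply: near_eq_cvg.
by apply: filterS near_dom => p [cx c'y]; rewrite -formula.
Qed.

Definition gG x := g (set_val x).
Definition EG x := E (set_val x).
Definition FG x := F (set_val x).

Lemma gG_posdef x : posdef (gG x).
Proof. by case: g_metric => + _ => /(_ (set_val x) I)[]. Qed.

Lemma gG_continuous : continuous_form tauG gG.
Proof.
move=> x0; have [_ /(_ _ (chart_at_atlas S (set_val x0)) 0%N) /=] := g_metric.
set c := pt (set_val x0) => /subspace_continuousP cg.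
have cx0 : cdom c (set_val x0) by exact: pt_dom.
have gE : gG x0 = gram_in S g c (cinv c (cmap c (set_val x0))).
  by rewrite cmapK// /gram_in tchangexx// mul1mx trmx1 mulmx1.
rewrite gE => V NV0; have NV := cg _ (cimg_cmap cx0) V NV0.
have {}NV : \forall u \near cmap c (set_val x0),
  cimg c u -> V (gram_in S g c (cinv c u)) by exact: NV.
have cc : cmap c (set_val x) @[x --> x0] --> cmap c (set_val x0).
  exact: (@cvg_at_comp _ _ _ set_val (cmap c) x0 _ _ (@set_val_cvg _ _ x0)
    (cmap_cvg cx0)).
have {}NV : \forall x \near x0, cimg c (cmap c (set_val x)) ->
    V (gram_in S g c (cinv c (cmap c (set_val x)))) by exact: cc _ NV.
suff : \forall x \near x0, V (tauG x0 x *m gG x *m (tauG x0 x)^T) by [].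
apply: filterS2 NV (near_cdom cx0) => x + cx.
by rewrite cmapK// => /(_ (cimg_cmap cx)).
Qed.

Lemma frameG (W : M -> 'M[R]_m) : continuous_subbundle S Gamma W ->
  forall x0, exists k e, @local_frame R m Gamma tauG x0 k (fun x => W (set_val x)) e.
Proof.
move=> cW x0; have [k [U [e [oU Ux0 Uc ce eW]]]] := cW _ (inG x0).
exists k, (fun x => e (set_val x)).
have NU : nbhs (set_val x0) U by exact: open_nbhs_nbhs.
have NUG : \forall x \near x0, U (set_val x) by exact: set_val_cvg NU.
split.
  have /subspace_continuousP/(_ _ (conj (inG x0) Ux0)) := ce.
  move=> H V /H NV.
  have {}NV : \forall x \near x0, (Gamma `&` U) (set_val x) -> V (e (set_val x)).
    exact: (@set_val_cvg _ _ x0 _ NV).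
  suff : \forall x \near x0, V (e (set_val x)) by [].
  by apply: filterS2 NV NUG => x H' Ux; apply: H'.
apply: filterS NUG => x Ux; have [fe /eqmxP eWx] := eW _ (inG x) Ux.
split=> //; apply/eqmxP; apply: eqmx_trans (eqmxMr (tauG x0 x) eWx) _.
rewrite -mulmxA (tchange_inv (chart_at_atlas S _) (chart_at_atlas S _)) ?mulmx1//.
  exact: pt_dom.
exact: Uc.
Qed.

Lemma flow_opnorm_qform (W : M -> 'M[R]_m) t x v : (v <= W (set_val x))%MS ->
  qform (gG (flowG t x)) (v *m DG t x) <=
  flow_opnorm S Phi g W t (set_val x) ^+ 2 * qform (gG x) v.
Proof.
move=> vW; rewrite /gG flowGE; apply: qform_opnorm => //.
  exact: gG_posdef.
by have := gG_posdef (flowG t x); rewrite /gG flowGE.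
Qed.

Lemma flow_opnorm_ge0 (W : M -> 'M[R]_m) t x :
  0 <= flow_opnorm S Phi g W t (set_val x).
Proof.
apply: opnorm_ge0; first exact: gG_posdef.
by have := gG_posdef (flowG t x); rewrite /gG flowGE.
Qed.

Lemma expR_sqr (c t : R) : expR (c * t) ^+ 2 = expR (2 * c * t).
Proof. by rewrite -expRM_natr; congr expR; ring. Qed.

(** The squares of the norms and of the Jacobian satisfy the hypotheses of
    adapted_form, with doubled rates; on the way back its rate eps is halved. *)
Lemma singular_adapted_ex : exists h, singular_adapted S Phi h Gamma E F.
Proof.
have [spl_full spl_direct spl_neq0 [cE cF] [iE iF] [K [lam' [K0 lam'0 HK]]]] := dom_split.
have [[cG _ _ [C [lam [C0 lam0 HC]]]] [Cd [lamd [Cd0 lamd0 Hd]]]] := Gamma_sh.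
have Efull x : row_full (EG x + FG x)%MS by exact/spl_full/inG.
have Ecap x : (EG x :&: FG x)%MS = 0 by exact/spl_direct/inG.
have E0 x : EG x != 0 by have [] := spl_neq0 _ (inG x).
have F0 x : FG x != 0 by have [] := spl_neq0 _ (inG x).
have Einv t x : (EG x *m DG t x == EG (flowG t x))%MS.
  by rewrite /EG flowGE; exact/iE/inG.
have Finv t x : (FG x *m DG t x == FG (flowG t x))%MS.
  by rewrite /FG flowGE; exact/iF/inG.
have contr x t v : 0 <= t -> (v <= EG x)%MS ->
    qform (gG (flowG t x)) (v *m DG t x) <=
    C ^+ 2 * expR (- (2 * lam) * t) * qform (gG x) v.
  move=> t0 vE; apply: le_trans (flow_opnorm_qform t vE) _.
  rewrite ler_wpM2r ?qform_ge0//; first exact: gG_posdef.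
  rewrite -mulrN -expR_sqr -exprMn lerXn2r ?nnegrE ?flow_opnorm_ge0//.
    by rewrite mulr_ge0 ?expR_ge0// ltW.
  by apply: HC => //; exact: inG.
have domi x t : 0 < t -> exists p q,
    [/\ 0 <= p, 0 <= q, p * q <= K ^+ 2 * expR (- (2 * lam') * t),
     forall v, (v <= EG x)%MS ->
       qform (gG (flowG t x)) (v *m DG t x) <= p * qform (gG x) v &
     forall w, (w <= FG (flowG t x))%MS ->
       qform (gG x) (w *m DG (- t) (flowG t x)) <= q * qform (gG (flowG t x)) w].
  move=> t0; exists (flow_opnorm S Phi g E t (set_val x) ^+ 2).
  exists (flow_opnorm S Phi g F (- t) (set_val (flowG t x)) ^+ 2).
  split; rewrite ?sqr_ge0//.
  - rewrite -exprMn -mulrN -expR_sqr -exprMn lerXn2r ?nnegrE//.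
    + by rewrite mulr_ge0// flow_opnorm_ge0.
    + by rewrite mulr_ge0 ?expR_ge0// ltW.
    + by rewrite flowGE; apply/ltW/HK => //; exact: inG.
  - by move=> v vE; exact: flow_opnorm_qform.
  - move=> w wF; have := flow_opnorm_qform (- t) wF.
    by rewrite -flowGD subrr flowG0.
have pullg t x : posdef (pullback flowG DG t gG x).
  by apply: (posdef_pullback DG0 DGD); exact: gG_posdef.
have expa x t : 0 < t ->
    Cd ^+ 2 * expR (2 * lamd * t) <= volratio gG FG x (pullback flowG DG t gG x).
  move=> t0; have := Hd _ t (inG x) t0; rewrite /flow_absdet absdet_gramdet => /ltW H.
  have N0 : 0 < gramdet (pullback flowG DG t gG x) (row_base (FG x)).
    by apply: gramdet_gt0 => //; exact: row_base_free.
  have D0 : 0 < gramdet (gG x) (row_base (FG x)).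
    by apply: gramdet_gt0; [exact: gG_posdef|exact: row_base_free].
  rewrite -expR_sqr -exprMn /volratio.
  rewrite -[X in X / _]sqr_sqrtr ?(ltW N0)// -[X in _ / X]sqr_sqrtr ?(ltW D0)//.
  rewrite -expr_div_n lerXn2r ?nnegrE ?divr_ge0 ?sqrtr_ge0//.
    by rewrite mulr_ge0 ?expR_ge0// ltW.
have C20 : 0 < C ^+ 2 by exact: exprn_gt0.
have K20 : 0 < K ^+ 2 by exact: exprn_gt0.
have Cd20 : 0 < Cd ^+ 2 by exact: exprn_gt0.
have two0 (c : R) : 0 < c -> 0 < 2 * c by exact: mulr_gt0.
have [h0 [eps [eps0 ph ch Hh]]] := adapted_form (compact_set_type cG) flowG0 flowGD
  flowG_continuous tauG1 tauG_unit DG0 DGD DG_continuous gG_posdef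
  gG_continuous Efull Ecap E0 F0 Einv Finv (frameG cE) (frameG cF)
  C20 (two0 _ lam0) contr K20 (two0 _ lam'0) domi Cd20 (two0 _ lamd0) expa.
pose h (z : M) : 'M[R]_m := if pselect (Gamma z) is left Gz then h0 (in_Gamma Gz) else 0.
have hE x : h (set_val x) = h0 x.
  rewrite /h; case: pselect => [Gx|/(_ (inG x))//].
  by congr h0; apply: set_val_inj; rewrite in_GammaK.
exists h; split.
  split=> [z Gz|c ac].
    by rewrite -(in_GammaK Gz) hE; exact: ph.
  apply/subspace_continuousP => z [Gz cz].
  set x0 := in_Gamma Gz; have zE : z = set_val x0 by rewrite in_GammaK.
  rewrite {}zE in cz *.
  have ax0 := chart_at_atlas S (set_val x0).
  have lim : gram_in S h c (set_val x) @[x --> x0] --> gram_in S h c (set_val x0).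
    have cK : tchange c (pt (set_val x0)) (set_val x) @[x --> x0] -->
        tchange c (pt (set_val x0)) (set_val x0).
      exact: (@cvg_at_comp _ _ _ set_val (tchange c (pt (set_val x0))) x0 _ _
        (@set_val_cvg _ _ x0) (tchange_cvg ac ax0 cz (pt_dom _))).
    have H0 : gram_in S h c (set_val x0) = tchange c (pt (set_val x0)) (set_val x0) *m
        h0 x0 *m (tchange c (pt (set_val x0)) (set_val x0))^T by rewrite /gram_in hE.
    have lim0 := cvg_mulmx (cvg_mulmx cK (@ch x0)) (cvg_trmx cK).
    rewrite {}H0 => V /lim0 NV.
    have {}NV : \forall x \near x0,
        V (tchange c (pt (set_val x0)) (set_val x) *m
           (tauG x0 x *m h0 x *m (tauG x0 x)^T) *m
           (tchange c (pt (set_val x0)) (set_val x))^T) by exact: NV.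
    have Nc := near_cdom cz; have Nc0 := near_cdom (pt_dom (set_val x0)).
    suff : \forall x \near x0, V (gram_in S h c (set_val x)) by [].
    apply: filterS3 NV Nc Nc0 => x + cx c0x.
    rewrite /gram_in hE.
    rewrite -(tchange_comp ac ax0 (chart_at_atlas S (set_val x)) cx c0x (pt_dom _)).
    by rewrite /tauG trmx_mul !mulmxA.
  move=> V /lim/near_set_type NV; rewrite /nbhs /=.
  have {}NV : \forall y \near set_val x0, (Gamma `&` cdom c) y -> V (gram_in S h c y).
    by apply: filterS NV => y H [Gy _]; have := H Gy; rewrite /= in_GammaK.
  exact: NV.
have half0 : 0 < eps / 2 by rewrite divr_gt0.
exists (eps / 2) => // z t Gz t0.
have zE : z = set_val (in_Gamma Gz) by rewrite in_GammaK.
set x := in_Gamma Gz in zE; rewrite {}zE.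
have [[p [q [p0 q0 pq p1 [HE HF]]]] Hvol] := Hh x t t0.
have sq c : c <= expR (- eps * t) -> Num.sqrt c <= expR (- (eps / 2) * t).
  move=> /ler_wsqrtr/le_trans; apply; rewrite sqrt_expR.
  by rewrite (_ : - eps * t / 2 = - (eps / 2) * t)//; field.
have oE : flow_opnorm S Phi h E t (set_val x) <= Num.sqrt p.
  apply: opnorm_le => // v vE; rewrite hE -flowGE hE.
  exact: HE.
have oF : flow_inv_opnorm S Phi h F t (set_val x) <= Num.sqrt q.
  apply: opnorm_le => // w wF; rewrite hE -flowGE hE.
  have uD : DG t x \in unitmx by exact: (D_unit DG0 DGD).
  have wF' : (w *m invmx (DG t x) <= FG x)%MS.
    rewrite -(mulmxK uD (FG x)) submxMr// (eqmxP (Finv t x)).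
    by rewrite /FG flowGE.
  have := HF _ wF'; rewrite mulmxKV//.
have oE0 : 0 <= flow_opnorm S Phi h E t (set_val x).
  by apply: opnorm_ge0; [rewrite hE; exact: ph|rewrite -flowGE hE; exact: ph].
have oF0 : 0 <= flow_inv_opnorm S Phi h F t (set_val x).
  by apply: opnorm_ge0; [rewrite -flowGE hE; exact: ph|rewrite hE; exact: ph].
split.
- apply: (@le_trans _ _ (Num.sqrt p * Num.sqrt q)); first exact: ler_pM.
  by rewrite -sqrtrM//; exact: sq.
- exact: le_trans oE (sq _ p1).
rewrite /flow_absdet absdet_gramdet.
have D0 : 0 < gramdet (h0 x) (row_base (FG x)).
  by apply: gramdet_gt0; [exact: ph|exact: row_base_free].
rewrite ler_pdivlMr ?sqrtr_gt0 ?hE//.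
have -> : expR (eps / 2 * t) = Num.sqrt (expR (eps * t)).
  by rewrite sqrt_expR; congr expR; field.
rewrite -sqrtrM ?expR_ge0//; apply: ler_wsqrtr.
by rewrite -flowGE hE; exact: Hvol.
Qed.

End SingularHyperbolic.

Theorem theorem1 (R : realType) (m : nat) (hm : (3 <= m)%N)
    (M : topologicalType) (S : @smooth_structure R m M)
    (M_hausdorff : hausdorff_space M) (M_compact : compact [set: M])
    (M_connected : connected [set: M])
    (X : M -> 'rV[R]_m) (X_C1 : C1_vector_field S X)
    (X_inward : inward_transverse S X)
    (Phi : R -> M -> M) (Phi_flow : is_flow S X Phi)
    (g : M -> 'M[R]_m) (g_metric : riemannian_metric S g)
    (Gamma : set M) (E F : M -> 'M[R]_m)
    (Gamma_sh : singular_hyperbolic S Phi g Gamma E F) :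
  exists h : M -> 'M[R]_m, singular_adapted S Phi h Gamma E F.
Proof. exact: (singular_adapted_ex Phi_flow g_metric Gamma_sh). Qed.
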